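(* Let $\mathcal H_1,\mathcal H_2$ be Hilbert spaces, $A$ a self-adjoint operator in $\mathcal H_1$ bounded from below, $B$ a densely defined closable operator from $\mathcal H_2$ to $\mathcal H_1$, and $D$ a self-adjoint operator in $\mathcal H_2$ bounded from above; let $\mathfrak a$, $\mathfrak d$ be the closed quadratic forms associated with $A$, $D$. Assume that $\mathrm{dom}(\mathfrak a)\subset\mathrm{dom}(B^* )$ and that either (I) $\mathrm{dom}(B)\subset\mathrm{dom}(D)$ and $\mathrm{dom}(B)$ is a core for $D$, or (II) $\mathrm{dom}(\mathfrak d)\subset\mathrm{dom}(B)$. Let $\mathcal M$ be the closure of $\mathcal M_0=\begin{pmatrix}A&B\\ -B^*&D\end{pmatrix}$ with $\mathrm{dom}(\mathcal M_0)=(\mathrm{dom}(A)\cap\mathrm{dom}(B^* ))\times(\mathrm{dom}(B)\cap\mathrm{dom}(D))$ in $\mathcal H_1\oplus\mathcal H_2$. Let $a\in\mathbb R$, $b\ge0$ be such that $\|B^*x\|^2\le a\|x\|^2+b\,\mathfrak a[x]$ for all $x\in\mathrm{dom}(\mathfrak a)$, let $\delta_+=\max\sigma(D)$ and $\mu=\delta_++b+\sqrt{\max\{b\delta_++b^2+a,0\}}$. Let $S(\lambda)$, $\lambda\in(\mu,\infty)$, be the Schur complement and assume that there exists $\gamma\in(\mu,\infty)$ with $\kappa_-(S(\gamma))<\infty$. Let $\lambda_{\rm e}=\inf(\sigma_{\rm ess}(\mathcal M)\cap(\mu,\infty))$ if this set is non-empty and $\lambda_{\rm e}=\infty$ otherwise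 (one has $\lambda_{\rm e}>\mu$), let $\gamma_0\in(\mu,\lambda_{\rm e})$ be arbitrary, let $\kappa=\kappa_-(S(\gamma_0))$ (which is finite), and let $(\lambda_j)_{j=1}^N$, $N\in\mathbb N_0\cup\{\infty\}$, be the finite or infinite sequence of eigenvalues of $\mathcal M$ in $[\gamma_0,\lambda_{\rm e})$ in non-decreasing order and repeated according to multiplicities. Then $$\lambda_n=\min_{\substack{\mathcal L\subset\mathrm{dom}(\mathfrak a)\\ \dim\mathcal L=\kappa+n}}\ \max_{x\in\mathcal L\setminus\{0\}}\ \inf_{y\in\mathrm{dom}(\mathfrak d)\setminus\{0\}}\operatorname{Re}\lambda_+\binom{x}{y}=\max_{\substack{\mathcal L\subset\mathcal H_1\\ \dim\mathcal L=\kappa+n-1}}\ \inf_{\substack{x\in\mathrm{dom}(\mathfrak a)\setminus\{0\}\\ x\perp\mathcal L}}\ \inf_{y\in\mathrm{dom}(\mathfrak d)\setminus\{0\}}\operatorname{Re}\lambda_+\binom{x}{y}$$ for $n\in\mathbb N$, $n\le N$. Moreover, if $N$ is finite and $\mathcal H_1$ is infinite-dimensional, then $\lambda_{\rm e}<\infty$ and $$\lambda_{\rm e}=\inf_{\substack{\mathcal L\subset\mathrm{dom}(\mathfrak a)\\ \dim\mathcal L=\kappa+n}}\ \max_{x\in\mathcal L\setminus\{0\}}\ \inf_{y\in\mathrm{dom}(\mathfrak d)\setminus\{0\}}\operatorname{Re}\lambda_+\binom{x}{y}=\sup_{\substack{\mathcal L\subset\mathcal H_1\\ \dim\mathcal L=\kappa+n-1}}\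 \inf_{\substack{x\in\mathrm{dom}(\mathfrak a)\setminus\{0\}\\ x\perp\mathcal L}}\ \inf_{y\in\mathrm{dom}(\mathfrak d)\setminus\{0\}}\operatorname{Re}\lambda_+\binom{x}{y}$$ for $n>N$. (Here $\mathcal L$ ranges over linear subspaces.)
   Context: Hilbert spaces are non-zero and complex; inner products are linear in the first argument. $\mathfrak a$ has domain $\mathrm{dom}(|A|^{1/2})$, with sesquilinear form $\mathfrak a[x,y]$ and $\mathfrak a[x]=\mathfrak a[x,x]$; $\mathfrak d$ has domain $\mathrm{dom}(|D|^{1/2})$, $\mathfrak d[y]=\mathfrak d[y,y]$. Under the stated assumptions $\mathcal M_0$ is closable and such $a,b$ exist. $\sigma_{\rm ess}(T)=\{z\in\mathbb C:T-z\text{ is not Fredholm}\}$. For $\lambda\in(\mu,\infty)$ let $\mathfrak s(\lambda)[x,y]=\mathfrak a[x,y]-\lambda\langle x,y\rangle+\langle(D-\lambda)^{-1}B^*x,B^*y\rangle$, $x,y\in\mathrm{dom}(\mathfrak a)$; this is a closed symmetric form bounded from below, and $S(\lambda)$ is the associated self-adjoint operator in $\mathcal H_1$ (the Schur complement). For a self-adjoint operator $T$, $\kappa_-(T)$ denotes the dimension of the spectral subspace of $T$ corresponding to $(-\infty,0)$. For $x\in\mathrm{dom}(\mathfrak a)\setminus\{0\}$, $y\in\mathrm{dom}(\mathfrak d)\setminus\{0\}$, $$\lambda_\pm\binom{x}{y}=\frac12\Biggl(\frac{\mathfrak a[x]}{\|x\|^2}+\frac{\mathfrak d[y]}{\|y\|^2}\pm\sqrt{\Bigl(\frac{\mathfrak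 a[x]}{\|x\|^2}-\frac{\mathfrak d[y]}{\|y\|^2}\Bigr)^2-4\frac{|\langle y,B^*x\rangle|^2}{\|x\|^2\|y\|^2}}\Biggr),$$ where $\sqrt t\ge0$ for $t\ge0$ and $\operatorname{Im}\sqrt t>0$ for $t<0$. *)

(* Defs.v *)
From HB Require Import structures.
From mathcomp Require Import all_boot all_order all_algebra.
From mathcomp Require Import complex.
From mathcomp Require Import all_classical all_reals all_analysis.
Set Implicit Arguments.
Unset Strict Implicit.
Unset Printing Implicit Defensive.
Import Order.TTheory GRing.Theory Num.Theory.
Import numFieldNormedType.Exports.
Local Open Scope classical_set_scope.
Local Open Scope ring_scope.
Local Open Scope complex_scope.
Local Open Scope card_scope.

(* Complex Hilbert spaces.  The library's {dot _ for conj} is linear in its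
   first argument, conjugate-linear in the second, and positive definite. *)
HB.mixin Record isHilbert (R : realType) H of CompleteNormedModule R[i] H := {
  inner : {dot H for (Num.conj : R[i] -> R[i])} ;
  innerE : forall x : H, inner x x = `|x| ^+ 2
}.

#[short(type="hilbertType")]
HB.structure Definition Hilbert (R : realType) :=
  {H of CompleteNormedModule R[i] H & isHilbert R H}.

Notation "''[' x , y ]" := (inner x y) : ring_scope.

(* `|z| takes values in R[i] for complex normed spaces, and for R[i] itself. *)
Definition normsq (R : realType) (V : normedZmodType R[i]) (x : V) : R :=
  complex.Re (`|x| ^+ 2).

Section Dimension.
Variables (R : realType) (V : lmodType R[i]).

Definition lin_subspace (L : set V) :=
  L 0 /\ forall (c : R[i]) x y, L x -> L y -> L (c *: x + y).

Definition has_dim (L : set V) (n : nat) := exists e : 'I_n -> V,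
  (forall c : 'I_n -> R[i], \sum_i c i *: e i = 0 -> forall i, c i = 0) /\
  L = [set x | exists c : 'I_n -> R[i], x = \sum_i c i *: e i].

Definition finite_dim (L : set V) := exists n, has_dim L n.

End Dimension.

(* Unbounded operators; the values of ap outside dom are irrelevant. *)
Record op (V W : Type) := Op { dom : set V ; ap :> V -> W }.

Section Operators.
Variables (R : realType) (V W : normedModType R[i]).
Implicit Type T : op V W.

Definition linear_op T := lin_subspace (dom T) /\
  forall (c : R[i]) x y, dom T x -> dom T y -> T (c *: x + y) = c *: T x + T y.

Definition graph_op T : set (V * W) := [set p | dom T p.1 /\ T p.1 = p.2].

Definition op_of (G : set (V * W)) : op V W :=
  Op [set x | exists y, G (x, y)] (fun x => xget 0 [set y | G (x, y)]).

Definition densely_defined T := dense (dom T).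

Definition closable T := forall y, closure (graph_op T) (0, y) -> y = 0.

Definition closure_op T := op_of (closure (graph_op T)).

Definition restrict_op T (S : set V) := Op (dom T `&` S) (ap T).

Definition is_core T (S : set V) :=
  S `<=` dom T /\ closure (graph_op (restrict_op T S)) = graph_op T.

Definition opp_op T := Op (dom T) (fun x => - T x).

Definition ker_op T : set V := [set x | dom T x /\ T x = 0].

Definition range_op T : set W := [set T x | x in dom T].

Definition fredholm T := [/\ closed (graph_op T), finite_dim (ker_op T),
  closed (range_op T) &
  exists2 F, finite_dim F &
    forall w, exists r f, [/\ range_op T r, F f & w = r + f]].

End Operators.

Section OperatorAlgebra.
Variables (R : realType) (U V W : normedModType R[i]).

Definition comp_op (S : op V W) (T : op U V) : op U W :=
  Op [set x | dom T x /\ dom S (T x)] (S \o T).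

Definition inv_op (T : op V W) : op W V :=
  op_of [set p | graph_op T (p.2, p.1)].

End OperatorAlgebra.

Section Spectrum.
Variables (R : realType) (V : normedModType R[i]).
Implicit Type T : op V V.

Definition shift_op T (z : R[i]) : op V V := Op (dom T) (fun x => T x - z *: x).

Definition resolvent_set T : set R[i] := [set z |
  (forall y, exists! x, dom T x /\ shift_op T z x = y) /\
  exists c : R, forall x, dom T x -> `|x| <= c%:C * `|shift_op T z x| ].

Definition spectrum T : set R[i] := ~` resolvent_set T.

Definition ess_spectrum T : set R[i] := [set z | ~ fredholm (shift_op T z)].

End Spectrum.

Section HilbertOperators.
Variables (R : realType) (H K : hilbertType R).

Definition adjoint (T : op H K) : op K H := op_of
  [set p | forall y, dom T y -> '[T y, p.1] = '[y, p.2]].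

End HilbertOperators.

Section SelfAdjoint.
Variables (R : realType) (H : hilbertType R).
Implicit Types T P Q : op H H.

Definition selfadjoint T := densely_defined T /\ graph_op (adjoint T) = graph_op T.

Definition bounded_below T :=
  exists c : R, forall x, dom T x -> c * normsq x <= complex.Re '[T x, x].

Definition bounded_above T :=
  exists c : R, forall x, dom T x -> complex.Re '[T x, x] <= c * normsq x.

(* Q = P^{1/2} *)
Definition is_sqrt_op P Q := [/\ selfadjoint Q,
  forall x, dom Q x -> 0 <= complex.Re '[Q x, x] & graph_op (comp_op Q Q) = graph_op P].

(* P = |T| = (T^* T)^{1/2} *)
Definition is_abs_op T P := is_sqrt_op (comp_op (adjoint T) T) P.

(* E is the spectral measure of T, i.e. T is the integral of t dE(t). *)
Record spectral_measure T (E : set R -> H -> H) : Prop := {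
  sm_idem : forall W x, measurable W -> E W (E W x) = E W x ;
  sm_sym : forall W x y, measurable W -> '[E W x, y] = '[x, E W y] ;
  sm_setT : forall x, E setT x = x ;
  sm_sigma_additive : forall (F : (set R)^nat) x,
    (forall n, measurable (F n)) -> trivIset setT F ->
    series (fun n => E (F n) x) @ \oo --> E (\bigcup_n F n) x ;
  sm_dom : forall x, dom T x <->
    (\int[fun W => (complex.Re '[E W x, x])%:E]_t (t ^+ 2)%:E < +oo)%E ;
  sm_value : forall x, dom T x ->
    '[T x, x] = (fine (\int[fun W => (complex.Re '[E W x, x])%:E]_t t%:E))%:C
}.

(* The range of the orthogonal projection E(W). *)
Definition spectral_subspace T (W : set R) : set H :=
  [set x | exists2 E, spectral_measure T E & E W x = x].

(* kappa_-(T) = k *)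
Definition kappa_minus T (k : nat) :=
  has_dim (spectral_subspace T `]-oo, 0[) k.

End SelfAdjoint.

(* Sesquilinear forms; the values of fval outside fdom are irrelevant. *)
Record sform (R : realType) (V : Type) :=
  SForm { fdom : set V ; fval :> V -> V -> R[i] }.

Section Forms.
Variables (R : realType) (H : hilbertType R).
Implicit Types (t : sform R H) (T : op H H).

Definition quad t (x : H) : R := complex.Re (t x x).

Definition sesquilinear t := lin_subspace (fdom t) /\
  forall (c : R[i]) x y z, fdom t x -> fdom t y -> fdom t z ->
    t (c *: x + y) z = c * t x z + t y z /\
    t z (c *: x + y) = Num.conj c * t z x + t z y.

Definition symmetric_form t :=
  forall x y, fdom t x -> fdom t y -> t x y = Num.conj (t y x).

Definition form_bounded_below t :=
  exists c : R, forall x, fdom t x -> c * normsq x <= quad t x.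

(* Closedness of a symmetric form that is bounded from below. *)
Definition closed_form t := forall (u : nat -> H) (x : H),
  (forall n, fdom t (u n)) -> u @ \oo --> x ->
  (forall e : R, 0 < e -> exists N, forall m n, (N <= m)%N -> (N <= n)%N ->
     `|quad t (u m - u n)| < e) ->
  fdom t x /\ (fun n => quad t (u n - x)) @ \oo --> (0 : R).

(* The operator associated with a form by the first representation theorem. *)
Definition op_of_form t : op H H := op_of
  [set p | fdom t p.1 /\ forall y, fdom t y -> t p.1 y = '[p.2, y]].

Definition opp_form t : sform R H := SForm (fdom t) (fun x y => - t x y).

(* t is the closed form associated with T, for T self-adjoint and bounded from
   below; its domain is dom(|T|^{1/2}). *)
Definition is_form_of T t := [/\ sesquilinear t, symmetric_form t,
  form_bounded_below t & closed_form t] /\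
  [/\ dense (fdom t), graph_op (op_of_form t) = graph_op T &
      exists P Q, [/\ is_abs_op T P, is_sqrt_op P Q & fdom t = dom Q]].

End Forms.

(* The square root with values in R[i] of a real number with Im > 0 when t < 0. *)
Definition csqrt (R : realType) (t : R) : R[i] :=
  if 0 <= t then (Num.sqrt t)%:C else 0 +i* Num.sqrt (- t).

Section BlockOperator.
Variables (R : realType) (H1 H2 : hilbertType R).
Variables (A : op H1 H1) (B : op H2 H1) (D : op H2 H2).
Variables (fa : sform R H1) (fd : sform R H2).

(* H1 * H2 carries the sup norm, which is equivalent to the Hilbert norm of the
   orthogonal sum: closures, kernels and the Fredholm property are the same. *)
Definition block_op : op (H1 * H2)%type (H1 * H2)%type :=
  Op [set p | [/\ dom A p.1, dom (adjoint B) p.1, dom B p.2 & dom D p.2]]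
     (fun p => (A p.1 + B p.2, - adjoint B p.1 + D p.2)).

Definition schur_form (lam : R) : sform R H1 :=
  SForm (fdom fa) (fun x y => fa x y - lam%:C * '[x, y] +
    '[inv_op (shift_op D lam%:C) (adjoint B x), adjoint B y]).

Definition schur (lam : R) : op H1 H1 := op_of_form (schur_form lam).

Definition lambda_plus (x : H1) (y : H2) : R[i] :=
  let p := quad fa x / normsq x in
  let q := quad fd y / normsq y in
  2^-1 * ((p + q)%:C + csqrt ((p - q) ^+ 2 -
    4 * (normsq '[y, adjoint B x] / (normsq x * normsq y)))).

Local Open Scope ereal_scope.

Definition inf_lambda_plus (x : H1) : \bar R :=
  ereal_inf [set (complex.Re (lambda_plus x y))%:E | y in fdom fd `\ 0%R].

Definition lambda_values (L : set H1) : set (\bar R) :=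
  [set inf_lambda_plus x | x in L `\ 0%R].

Definition sup_on (L : set H1) : \bar R := ereal_sup (lambda_values L).

Definition inf_perp (L : set H1) : \bar R := ereal_inf (lambda_values
  [set x | fdom fa x /\ forall z, L z -> '[x, z] = 0%R]).

End BlockOperator.

Section Enumeration.
Variables (R : realType) (V : normedModType R[i]).

(* Index range 1 <= n <= N, where N = None stands for an infinite sequence. *)
Definition in_range (N : option nat) (n : nat) : Prop :=
  (1 <= n)%N /\ if N is Some m then (n <= m)%N else true.

(* lam 1 <= lam 2 <= ... are the eigenvalues of T in [lo, hi), each repeated
   dim ker (T - lam n) times. *)
Definition eigenvalue_sequence (T : op V V) (lo : R) (hi : \bar R)
    (N : option nat) (lam : nat -> R) :=
  [/\ forall n, in_range N n -> lo <= lam n /\ ((lam n)%:E < hi)%E,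
      forall m n, in_range N m -> in_range N n -> (m <= n)%N ->
        lam m <= lam n &
      forall t : R, lo <= t -> (t%:E < hi)%E ->
        exists2 k, has_dim (ker_op (shift_op T t%:C)) k &
          [set n | in_range N n /\ lam n = t] #= `I_k].

End Enumeration.

Definition is_max (R : realType) (S : set (\bar R)) (m : \bar R) :=
  S m /\ ubound S m.

Definition is_min (R : realType) (S : set (\bar R)) (m : \bar R) :=
  S m /\ lbound S m.

(* Main.v *)
(* Write s_l for the form of the Schur complement S(l). For l > mu the map
   l |-> s_l[x] is strictly decreasing wherever it is close to or below 0, and
   inf_y Re lambda_+(x,y) < l exactly when s_l[x] < 0 (take y = (l - D)^-1 B^* x).
   Hence both variational expressions are governed by n(l) = kappa_-(S(l)).

   The closure of M_0 is {(x, y) : x in dom a, y in dom D, a[x,.] + <y, B^* .> is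
   bounded}, so that ker(M - l) and ker S(l) are isomorphic and M - l is Fredholm
   exactly when S(l) is. Off the essential spectrum S(l) therefore has a spectral
   gap around 0, and by monotonicity n is left continuous at l and jumps there by
   dim ker(M - l). An induction along [gamma_0, lambda_e) then gives
   n(l) = kappa + #{j : lambda_j < l}; beyond lambda_e, n is infinite.

   The spectral measure of a lower semibounded operator T is built from
   K = (T + c)^-1: iterating s |-> s (3 - s^2) / 2 on K - tau produces the
   spectral projections of K, which define Lebesgue-Stieltjes measures and then,
   by a Dynkin argument, projections for all Borel sets. Any spectral measure of T
   commutes with K, which makes the subspace for ]-oo, 0[ unique. *)
From HB Require Import structures.
Require Import Defs.
From mathcomp Require Import all_boot all_order all_algebra.
From mathcomp Require Import complex.
From mathcomp Require Import all_classical all_reals all_analysis.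
From mathcomp Require Import measurable_realfun ring lra.
Import Order.TTheory GRing.Theory Num.Theory.
Import numFieldNormedType.Exports.
Local Open Scope classical_set_scope.
Local Open Scope ring_scope.
Local Open Scope complex_scope.
Set Implicit Arguments.
Unset Strict Implicit.
Unset Printing Implicit Defensive.

(** Origin of [mu]: put d = [dplus], q = l - d > b and R_l = (l - D)^-1, of norm at most 1/q. If
    s_l[x] <= 0, then |B^* x|^2 <= q (a + b l) / (q - b) |x|^2. The derivative of s_l[x] in l is
    |R_l B^* x|^2 - |x|^2, which is therefore negative once a + b l < q (q - b), that is, b d + b^2
    + a < (q - b)^2. Beyond [mu] this holds together with q > b. The decrease is needed uniformly,
    for s_l[x] <= e |x|^2 with e > 0 depending on l alone: nonnegativity of a later form on a space
    of finite codimension then becomes a positive lower bound at l. The opposite estimate, that s_l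
    loses at most |x|^2 per unit of l, keeps strict signs at nearby parameters. M is in general not
    self-adjoint, so all spectral information comes from the forms s_l. Each is shifted by its own
    constant, which provides a bounded resolvent K with |K x|^2 <= <K x, x>. Counting uses only the
    projections for ]-oo, r[ built from K; integration serves to match them with [kappa_minus]. *)

Section InnerProduct.
Variables (R : realType) (H : hilbertType R).
Implicit Types (x y z : H) (r : R) (c : R[i]).

Lemma ipDl x y z : '[x + y, z] = '[x, z] + '[y, z].
Proof. exact: linearDl. Qed.
Lemma ipDr x y z : '[z, x + y] = '[z, x] + '[z, y].
Proof. exact: linearDr. Qed.
Lemma ipNl x z : '[- x, z] = - '[x, z].
Proof. exact: linearNl. Qed.
Lemma ipNr x z : '[z, - x] = - '[z, x].
Proof. exact: linearNr. Qed.
Lemma ipBl x y z : '[x - y, z] = '[x, z] - '[y, z].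
Proof. exact: linearBl. Qed.
Lemma ip0l z : '[0, z] = 0.
Proof. exact: linear0l. Qed.
Lemma ip0r z : '[z, 0] = 0.
Proof. exact: linear0r. Qed.
Lemma ipZl c x z : '[c *: x, z] = c * '[x, z].
Proof. exact: linearZl_LR. Qed.
Lemma ipZr c x z : '[z, c *: x] = Num.conj c * '[z, x].
Proof. exact: linearZr_LR. Qed.
Lemma ipC x y : '[x, y] = Num.conj '[y, x].
Proof. by rewrite hermC expr0 mul1r. Qed.
Lemma ip_suml n (f : 'I_n -> H) z : '[\sum_i f i, z] = \sum_i '[f i, z].
Proof. by elim/big_rec2: _ => [|i a b _ <-]; rewrite ?ip0l ?ipDl. Qed.
Lemma ip_sumr n (f : 'I_n -> H) z : '[z, \sum_i f i] = \sum_i '[z, f i].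
Proof. by elim/big_rec2: _ => [|i a b _ <-]; rewrite ?ip0r ?ipDr. Qed.

Lemma ReD c c' : complex.Re (c + c') = complex.Re c + complex.Re c'.
Proof. by case: c c' => ? ? []. Qed.
Lemma ReN c : complex.Re (- c) = - complex.Re c.
Proof. by case: c. Qed.
Lemma ReJ c : complex.Re (Num.conj c) = complex.Re c.
Proof. by case: c. Qed.
Lemma ImJ c : complex.Im (Num.conj c) = - complex.Im c.
Proof. by case: c. Qed.
Lemma ReMr r c : complex.Re (r%:C * c) = r * complex.Re c.
Proof. by case: c => a b /=; rewrite mul0r subr0. Qed.
Lemma conjr r : Num.conj (r%:C) = r%:C :> R[i].
Proof. by rewrite /Num.conj /= oppr0. Qed.
Lemma complex_ext c c' : complex.Re c = complex.Re c' ->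
  complex.Im c = complex.Im c' -> c = c'.
Proof. by case: c c' => ? ? [? ?] /= -> ->. Qed.

(** The real inner product keeps estimates within real arithmetic. Testing with y and i y recovers
    the complex one ([ip_rip]). *)
Definition rip x y : R := complex.Re '[x, y].

Lemma ripDl x y z : rip (x + y) z = rip x z + rip y z.
Proof. by rewrite /rip ipDl ReD. Qed.
Lemma ripDr x y z : rip z (x + y) = rip z x + rip z y.
Proof. by rewrite /rip ipDr ReD. Qed.
Lemma ripNl x z : rip (- x) z = - rip x z.
Proof. by rewrite /rip ipNl ReN. Qed.
Lemma ripNr x z : rip z (- x) = - rip z x.
Proof. by rewrite /rip ipNr ReN. Qed.
Lemma ripBl x y z : rip (x - y) z = rip x z - rip y z.
Proof. by rewrite ripDl ripNl. Qed.
Lemma ripBr x y z : rip z (x - y) = rip z x - rip z y.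
Proof. by rewrite ripDr ripNr. Qed.
Lemma rip0l z : rip 0 z = 0.
Proof. by rewrite /rip ip0l. Qed.
Lemma rip0r z : rip z 0 = 0.
Proof. by rewrite /rip ip0r. Qed.
Lemma ripZl r x z : rip (r%:C *: x) z = r * rip x z.
Proof. by rewrite /rip ipZl ReMr. Qed.
Lemma ripZr r x z : rip z (r%:C *: x) = r * rip z x.
Proof. by rewrite /rip ipZr conjr ReMr. Qed.
Lemma ripC x y : rip x y = rip y x.
Proof. by rewrite /rip ipC ReJ. Qed.

Local Notation ripE := (ripDl, ripDr, ripNl, ripNr, rip0l, rip0r, ripZl, ripZr).
Local Notation ipE := (ipDl, ipDr, ipNl, ipNr, ip0l, ip0r, ipZl, ipZr).

Lemma nsqE x : normsq x = rip x x.
Proof. by rewrite /normsq /rip innerE. Qed.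

Lemma ip_nsq x : '[x, x] = (normsq x)%:C.
Proof.
rewrite nsqE /rip; apply: complex_ext => //=.
have : '[x, x] = Num.conj '[x, x] by rewrite -ipC.
by case: ('[x, x]) => a b /= [] hb; apply/eqP; lra.
Qed.

Lemma nsq_ge0 x : 0 <= normsq x.
Proof. by rewrite -ler0c -ip_nsq dnorm_ge0. Qed.

Lemma nsq_eq0 x : normsq x = 0 -> x = 0.
Proof. by move=> h; apply/eqP; rewrite -(dnorm_eq0 inner) ip_nsq h. Qed.

Lemma nsq0 : normsq (0 : H) = 0.
Proof. by rewrite nsqE rip0l. Qed.

Lemma nsq_gt0 x : x != 0 -> 0 < normsq x.
Proof.
move=> x0; rewrite lt_def nsq_ge0 andbT.
by apply: contra x0 => /eqP/nsq_eq0/eqP.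
Qed.

Lemma nsqN x : normsq (- x) = normsq x.
Proof. by rewrite !nsqE !ripE opprK. Qed.
Lemma nsqBC x y : normsq (x - y) = normsq (y - x).
Proof. by rewrite -nsqN opprB. Qed.
Lemma nsqZ r x : normsq (r%:C *: x) = r ^+ 2 * normsq x.
Proof. by rewrite !nsqE !ripE mulrA. Qed.
Lemma nsqD x y : normsq (x + y) = normsq x + 2 * rip x y + normsq y.
Proof. by rewrite !nsqE !ripE (ripC y x); ring. Qed.
Lemma nsqB x y : normsq (x - y) = normsq x - 2 * rip x y + normsq y.
Proof. by rewrite !nsqE !ripE (ripC y x); ring. Qed.

Lemma nsqDle x y : normsq (x + y) <= 2 * normsq x + 2 * normsq y.
Proof. by have := nsq_ge0 (x - y); rewrite nsqB nsqD; lra. Qed.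

Lemma normE x : `|x| = (Num.sqrt (normsq x))%:C.
Proof.
have h : `|x| ^+ 2 = (normsq x)%:C by rewrite -innerE ip_nsq.
apply/eqP; rewrite -(@eqrXn2 _ 2) //; last by rewrite ler0c sqrtr_ge0.
by rewrite h -rmorphXn /= sqr_sqrtr // nsq_ge0.
Qed.

Lemma ip_ext x y : (forall z, '[x, z] = '[y, z]) -> x = y.
Proof.
move=> h; apply/eqP; rewrite -subr_eq0; apply/eqP/nsq_eq0.
by rewrite nsqE /rip ipBl h subrr.
Qed.

Lemma Im_ip x y : complex.Im '[x, y] = rip x ('i *: y).
Proof. by rewrite /rip ipZr; case: ('[x, y]) => a b /=; ring. Qed.

Lemma ip_rip x y x' y' : rip x y = rip x' y' ->
  rip x ('i *: y) = rip x' ('i *: y') -> '[x, y] = '[x', y'].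
Proof. by rewrite -!Im_ip; exact: complex_ext. Qed.

Lemma rip_ext x y : (forall z, rip x z = rip y z) -> x = y.
Proof. by move=> h; apply: ip_ext => z; apply: ip_rip; apply: h. Qed.

Lemma rip_i x y : rip ('i *: x) ('i *: y) = rip x y.
Proof. by rewrite /rip !ipE; case: ('[x, y]) => a b /=; ring. Qed.

Lemma rip_iC x y : rip ('i *: x) y = - rip x ('i *: y).
Proof. by rewrite /rip !ipE; case: ('[x, y]) => a b /=; ring. Qed.

Lemma normsqC c : normsq c = (complex.Re c) ^+ 2 + (complex.Im c) ^+ 2.
Proof. by rewrite /normsq -add_Re2_Im2. Qed.

Lemma scaleriE c x : c *: x =
  (complex.Re c)%:C *: x + (complex.Im c)%:C *: ('i *: x).
Proof. by rewrite scalerA -scalerDl mulrC -complexE. Qed.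

End InnerProduct.

Notation ripE := (ripDl, ripDr, ripNl, ripNr, rip0l, rip0r, ripZl, ripZr).
Notation ipE := (ipDl, ipDr, ipNl, ipNr, ip0l, ip0r, ipZl, ipZr).

Ltac vec := apply: rip_ext => ?; rewrite !ripE; ring.
Ltac cvec := apply: ip_ext => ?; rewrite !ipE; ring.

(** * Nonnegative real bilinear forms and their Cauchy-Schwarz inequality *)

Section RealForms.
Variables (R : realType) (H : hilbertType R) (V : set H) (b : H -> H -> R).

(** Real scalars only: complex forms enter through their real parts. Instances are the inner product
    on a subspace, shifted closed forms, the form of l - D and <K x, y>. *)
Record posform : Prop := {
  pf_0 : V 0;
  pf_V : forall (r : R) x y, V x -> V y -> V (r%:C *: x + y);
  pf_lin : forall (r : R) x y z, V x -> V y -> V z ->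
    b (r%:C *: x + y) z = r * b x z + b y z;
  pf_sym : forall x y, V x -> V y -> b x y = b y x;
  pf_ge0 : forall x, V x -> 0 <= b x x }.

Hypothesis pb : posform.

Lemma pf_VZ (r : R) x : V x -> V (r%:C *: x).
Proof. by move=> Vx; rewrite -[_ *: _]addr0; apply: pf_V pb _ _ _ Vx (pf_0 pb). Qed.
Lemma pf_VD x y : V x -> V y -> V (x + y).
Proof.
by move=> Vx Vy; have := pf_V pb 1 Vx Vy; rewrite scale1r.
Qed.
Lemma pf_VN x : V x -> V (- x).
Proof.
by move=> Vx; have := pf_VZ (- 1) Vx; rewrite rmorphN scaleN1r.
Qed.
Lemma pf_VB x y : V x -> V y -> V (x - y).
Proof. by move=> Vx Vy; apply/pf_VD/pf_VN. Qed.

Lemma pf_Dl x y z : V x -> V y -> V z -> b (x + y) z = b x z + b y z.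
Proof. by move=> Vx Vy Vz; have := pf_lin pb 1 Vx Vy Vz; rewrite scale1r mul1r. Qed.
Lemma pf_0l z : V z -> b 0 z = 0.
Proof.
by move=> Vz; have := pf_Dl (pf_0 pb) (pf_0 pb) Vz; rewrite addr0 => /eqP; lra.
Qed.
Lemma pf_Zl r x z : V x -> V z -> b (r%:C *: x) z = r * b x z.
Proof.
by move=> Vx Vz; have := pf_lin pb r Vx (pf_0 pb) Vz; rewrite addr0 pf_0l // addr0.
Qed.
Lemma pf_Nl x z : V x -> V z -> b (- x) z = - b x z.
Proof.
by move=> Vx Vz; have := pf_Zl (- 1) Vx Vz; rewrite rmorphN scaleN1r mulN1r.
Qed.
Lemma pf_Bl x y z : V x -> V y -> V z -> b (x - y) z = b x z - b y z.
Proof. by move=> Vx Vy Vz; rewrite pf_Dl ?pf_Nl //; apply: pf_VN. Qed.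
Lemma pf_Br x y z : V x -> V y -> V z -> b z (x - y) = b z x - b z y.
Proof.
by move=> Vx Vy Vz; rewrite !(pf_sym pb Vz) ?pf_Bl //; apply: pf_VB.
Qed.
Lemma pf_Dr x y z : V x -> V y -> V z -> b z (x + y) = b z x + b z y.
Proof.
by move=> Vx Vy Vz; rewrite !(pf_sym pb Vz) ?pf_Dl //; apply: pf_VD.
Qed.
Lemma pf_Zr r x z : V x -> V z -> b z (r%:C *: x) = r * b z x.
Proof.
by move=> Vx Vz; rewrite !(pf_sym pb Vz) ?pf_Zl //; apply: pf_VZ.
Qed.
Lemma pf_qB x y : V x -> V y -> b (x - y) (x - y) = b x x - 2 * b x y + b y y.
Proof.
move=> Vx Vy; have Vxy := pf_VB Vx Vy.
by rewrite pf_Bl // !pf_Br // (pf_sym pb Vy Vx); ring.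
Qed.
Lemma pf_qD x y : V x -> V y -> b (x + y) (x + y) = b x x + 2 * b x y + b y y.
Proof.
move=> Vx Vy; have Vxy := pf_VD Vx Vy.
by rewrite pf_Dl // !pf_Dr // (pf_sym pb Vy Vx); ring.
Qed.
Lemma pf_qZ r x : V x -> b (r%:C *: x) (r%:C *: x) = r ^+ 2 * b x x.
Proof.
by move=> Vx; have Vrx := pf_VZ r Vx; rewrite pf_Zl // pf_Zr // mulrA.
Qed.

(** For p > 0 the minimiser r = q / p gives the discriminant inequality. For p <= 0 a large r forces
    first q = 0 and then p = 0. *)
Lemma quad_disc (p q s : R) : 0 <= s -> (forall r, 0 <= s - 2 * (r * q) + r ^+ 2 * p) ->
  q ^+ 2 <= p * s.
Proof.
move=> s0 h; have [p0|p0] := ltrP 0 p.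
  have := h (q / p); rewrite -(pmulr_lge0 _ p0) => hh.
  suff : p * (s - 2 * (q / p * q) + (q / p) ^+ 2 * p) = p * s - q ^+ 2.
    by move: hh; rewrite mulrC => hh e; move: hh; rewrite e; lra.
  by field; rewrite gt_eqF.
have q0 : q = 0.
  apply/eqP/negPn/negP => q0.
  have q2 : 0 < q ^+ 2 by rewrite exprn_even_gt0.
  have := h ((s + 1) / q).
  have -> : (s + 1) / q * q = s + 1 by field.
  have : ((s + 1) / q) ^+ 2 * p <= 0 by apply: mulr_ge0_le0 => //; exact: sqr_ge0.
  lra.
have p0' : p = 0.
  apply/eqP; rewrite eq_le p0 /=; have [//|pn] := lerP 0 p.
  have := h ((s + 1 - p) / - p); rewrite q0 mulr0 mulr0 subr0.
  set u := _ / _; have hu : u * p = - (s + 1 - p) by rewrite /u; field; lra.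
  rewrite expr2 -mulrA hu; have u1 : 1 <= u.
    by rewrite /u ler_pdivlMr; lra.
  nra.
by rewrite q0 p0' expr0n /= mul0r.
Qed.

Lemma pf_CS x y : V x -> V y -> (b x y) ^+ 2 <= b x x * b y y.
Proof.
move=> Vx Vy; rewrite mulrC; apply: quad_disc => [|r]; first exact: pf_ge0 pb _ Vx.
have Vr := pf_VZ r Vy.
have := pf_ge0 pb (pf_VB Vx Vr).
by rewrite pf_qB // pf_Zr // pf_qZ // mulrA.
Qed.

End RealForms.

(** * Hilbert space geometry and sequential convergence *)

Section Geometry.
Variables (R : realType) (H : hilbertType R).
Implicit Types (x y z : H).

Lemma pf_ip : posform setT (@rip R H).
Proof.
split=> // [r x y z _ _ _|x y _ _|x _]; first by rewrite !ripE.
  exact: ripC.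
by rewrite -nsqE nsq_ge0.
Qed.

Lemma rip_CS x y : rip x y ^+ 2 <= normsq x * normsq y.
Proof. by rewrite !nsqE; apply: (pf_CS pf_ip). Qed.

Lemma rip_young (r : R) x y : 0 < r -> 2 * rip x y <= r * normsq x + r^-1 * normsq y.
Proof.
move=> r0; have := nsq_ge0 (r%:C *: x - y); rewrite nsqB nsqZ ripZl => h.
have ri : 0 < r^-1 by rewrite invr_gt0.
have : 0 <= r^-1 * (r ^+ 2 * normsq x - 2 * (r * rip x y) + normsq y) by apply: mulr_ge0 => //; lra.
have -> : r^-1 * (r ^+ 2 * normsq x - 2 * (r * rip x y) + normsq y) =
  r * normsq x - 2 * rip x y + r^-1 * normsq y by field; rewrite gt_eqF.
lra.
Qed.

Lemma ip_CS x y : normsq '[x, y] <= normsq x * normsq y.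
Proof.
have [->|ne] := eqVneq '[x, y] 0.
  by rewrite normsqC /= expr0n /= addr0 mulr_ge0 // nsq_ge0.
set c := '[x, y]; have n0 : 0 < normsq c.
  rewrite normsqC lt_def addr_ge0 ?sqr_ge0 // andbT.
  apply: contra ne => /eqP h; rewrite -/c; have := sqr_ge0 (complex.Re c); have := sqr_ge0 (complex.Im c).
  move=> h1 h2; apply/eqP/complex_ext => /=; apply/eqP; rewrite -sqrf_eq0; apply/eqP; lra.
have := rip_CS x (c *: y).
have -> : rip x (c *: y) = normsq c.
  by rewrite /rip ipZr normsqC -/c; case: (c) => a b /=; ring.
have -> : normsq (c *: y) = normsq c * normsq y.
  by rewrite [LHS]nsqE /rip !ipE ip_nsq normsqC; case: (c) => a b /=; ring.
rewrite mulrCA expr2 ler_pM2l //.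
Qed.

(** Convergence is measured by real squared norms, open to real arithmetic; [cvsP] ties it to the
    filter [\oo]. *)
Definition cvs (u : nat -> H) x :=
  forall e : R, 0 < e -> exists N, forall n, (N <= n)%N -> normsq (u n - x) < e.

Definition cauchys (u : nat -> H) := forall e : R, 0 < e ->
  exists N, forall m n, (N <= m)%N -> (N <= n)%N -> normsq (u m - u n) < e.

Lemma norm_lt x (e : R) : 0 < e -> (`|x| < e%:C) = (normsq x < e ^+ 2).
Proof.
move=> e0; rewrite normE ltcR -(@ltr_pXn2r _ 2) ?nnegrE ?sqrtr_ge0 ?ltW // sqr_sqrtr ?nsq_ge0 //.
Qed.

End Geometry.

Section Convergence.
Variables (R : realType) (H : hilbertType R).
Implicit Types (x y z : H) (u v : nat -> H).

Lemma pos_real_complex (e : R[i]) : 0 < e -> exists2 r : R, 0 < r & e = r%:C.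
Proof.
case: e => a b; rewrite ltcE /= => /andP[/eqP-> a0]; by exists a.
Qed.

Lemma ballE x y (e : R) : 0 < e -> ball x e%:C y <-> normsq (x - y) < e ^+ 2.
Proof. by move=> e0; rewrite -ball_normE /ball_ /= norm_lt. Qed.

Lemma cvsP u x : u @ \oo --> x <-> cvs u x.
Proof.
split=> [/(@cvgrPdist_lt _ H) h e e0|h].
  have se : 0 < Num.sqrt e by rewrite sqrtr_gt0.
  have sce : 0 < (Num.sqrt e)%:C by rewrite ltcR.
  have [N _ hN] := h _ sce; exists N => n /hN /=.
  by rewrite norm_lt // sqr_sqrtr ?ltW // nsqBC.
apply/(@cvgrPdist_lt _ H) => e /pos_real_complex[r r0 ->].
have r2 : 0 < r ^+ 2 by apply: exprn_gt0.
have [N hN] := h _ r2; exists N => // n /hN /=.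
by rewrite norm_lt // nsqBC.
Qed.

Lemma cauchys_cvs u : cauchys u -> exists x, cvs u x.
Proof.
move=> cu; suff : cvg (u @ \oo) by move=> /cvg_ex[l /cvsP hl]; exists l.
apply: cauchy_cvg; apply: cauchy_exP => e /pos_real_complex[r r0 ->].
have r2 : 0 < r ^+ 2 by apply: exprn_gt0.
have [N hN] := cu _ r2; exists (u N); exists N => // n /= Nn.
by apply/ballE => //; apply: hN.
Qed.

Lemma sqr_small (e : R) : 0 < e -> exists2 r : R, 0 < r & r ^+ 2 < e.
Proof.
move=> e0; exists (Num.sqrt (e / 2)); first by rewrite sqrtr_gt0; lra.
by rewrite sqr_sqrtr; lra.
Qed.

Lemma dense_nsq (A : set H) : dense A <->
  forall x (e : R), 0 < e -> exists2 y, A y & normsq (x - y) < e.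
Proof.
split=> [h x e /sqr_small[r r0 re]|h O [x Ox] Oo].
  have [|y [yx Ay]] := h (ball x r%:C)^° _ (@open_interior _ _).
    exists x; apply: nbhs_singleton; apply: nbhs_interior; apply: nbhsx_ballx.
    by rewrite ltcR.
  by exists y => //; apply: lt_trans re; apply/ballE => //; apply: interior_subset.
have := open_nbhs_nbhs (conj Oo Ox) => /nbhs_ballP[e /= /pos_real_complex[r r0 ->] hB].
have [|y Ay yx] := h x (r ^+ 2); first exact: exprn_gt0.
by exists y; split=> //; apply: hB; apply/ballE.
Qed.

Lemma closure_nsq2 (K : hilbertType R) (A : set (H * K)) p :
  closure A p <-> forall e : R, 0 < e -> exists2 q, A q &
    normsq (p.1 - q.1) < e /\ normsq (p.2 - q.2) < e.
Proof.
split=> [h e /sqr_small[r r0 re]|h B /nbhs_ballP[e /= /pos_real_complex[r r0 ->] hB]].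
  have [|y [Ay [y1 y2]]] := h (ball p r%:C).
    by apply: nbhsx_ballx; rewrite ltcR.
  exists y => //; split; apply: lt_trans re.
    by apply/ballE.
  by rewrite -norm_lt //; move: y2; rewrite /= -ball_normE.
have [|y Ay [y1 y2]] := h (r ^+ 2); first exact: exprn_gt0.
exists y; split=> //; apply: hB; split; first exact/ballE.
by rewrite -ball_normE /ball_ /= norm_lt.
Qed.

Lemma cvs_unique u x y : cvs u x -> cvs u y -> x = y.
Proof.
move=> hx hy; apply/eqP; rewrite -subr_eq0; apply/eqP/nsq_eq0.
apply/eqP; rewrite eq_le nsq_ge0 andbT; apply/ler_addgt0Pr => e e0.
have e4 : 0 < e / 4 by lra.
have [N hN] := hx _ e4; have [M hM] := hy _ e4.
have := hN _ (leq_maxl N M); have := hM _ (leq_maxr N M).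
have := nsqDle (x - u (maxn N M)) (u (maxn N M) - y).
by rewrite subrKA (nsqBC x); lra.
Qed.

Lemma cvs_cst x : cvs (fun=> x) x.
Proof. by move=> e e0; exists 0%N => n _; rewrite subrr nsq0. Qed.

Lemma cvs_cauchys u x : cvs u x -> cauchys u.
Proof.
move=> h e e0; have e4 : 0 < e / 4 by lra.
have [N hN] := h _ e4; exists N => m n /hN hm /hN hn.
have := nsqDle (u m - x) (x - u n).
by rewrite subrKA (nsqBC x); lra.
Qed.

Lemma cvsD u v x y : cvs u x -> cvs v y -> cvs (fun n => u n + v n) (x + y).
Proof.
move=> hu hv e e0; have e4 : 0 < e / 4 by lra.
have [N hN] := hu _ e4; have [M hM] := hv _ e4.
exists (maxn N M) => n; rewrite geq_max => /andP[/hN h1 /hM h2].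
have -> : u n + v n - (x + y) = (u n - x) + (v n - y) by rewrite addrACA -opprD.
by have := nsqDle (u n - x) (v n - y); lra.
Qed.

Lemma cvs_lip (K : hilbertType R) (f : H -> K) (C : R) u x :
  (forall a b, normsq (f a - f b) <= C * normsq (a - b)) ->
  cvs u x -> forall e : R, 0 < e -> exists N, forall n, (N <= n)%N ->
    normsq (f (u n) - f x) < e.
Proof.
move=> hf hu e e0.
have e1 : 0 < e / (`|C| + 1) by rewrite divr_gt0 //; have := normr_ge0 C; lra.
have [N hN] := hu _ e1; exists N => n /hN h.
apply: le_lt_trans (hf _ _) _; have C0 := ler_norm C; have C1 := normr_ge0 C.
have : normsq (u n - x) * (`|C| + 1) < e by rewrite -ltr_pdivlMr //; lra.
have := nsq_ge0 (u n - x); nra.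
Qed.

Lemma cvsZ (r : R) u x : cvs u x -> cvs (fun n => r%:C *: u n) (r%:C *: x).
Proof.
by apply: (@cvs_lip _ _ (r ^+ 2)) => a b; rewrite -scalerBr nsqZ.
Qed.

Lemma cvsN u x : cvs u x -> cvs (fun n => - u n) (- x).
Proof. by apply: (@cvs_lip _ _ 1) => a b; rewrite -opprD nsqN mul1r. Qed.

Lemma cvsB u v x y : cvs u x -> cvs v y -> cvs (fun n => u n - v n) (x - y).
Proof. by move=> hu hv; apply: cvsD hu (cvsN hv). Qed.

Lemma cvs_nsq u x : cvs u x -> forall e : R, 0 < e -> exists N, forall n, (N <= n)%N ->
  `|normsq (u n) - normsq x| < e.
Proof.
(* |u|^2 - |x|^2 = 2 <u - x, x> + |u - x|^2. Once |u - x|^2 < d^2 / 4, Young's inequality with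
   weight 1/d bounds this by d (|x|^2 + 1/2), which is below e. *)
move=> hu e e0; pose d := Num.min 1 (e / (4 * normsq x + 4)).
have x0 := nsq_ge0 x; have d0 : 0 < d.
  by rewrite lt_min ltr01 /= divr_gt0 //; lra.
have d20 : 0 < d ^+ 2 * (1/4) by rewrite mulr_gt0 ?exprn_gt0 //; lra.
have [N hN] := hu _ d20; exists N => n /hN h.
have E : normsq (u n) - normsq x = 2 * rip (u n - x) x + normsq (u n - x).
  by have := nsqD (u n - x) x; rewrite subrK => ->; ring.
have d1 : d <= 1 by rewrite ge_min lexx.
have de : d * (4 * normsq x + 4) <= e.
  by rewrite -ler_pdivlMr ?ge_min ?lexx ?orbT //; lra.
have di : 0 < d^-1 by rewrite invr_gt0.
have y1 := rip_young (u n - x) x di; have y2 := rip_young (- (u n - x)) x di.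
rewrite invrK in y1; rewrite invrK ripNl nsqN in y2.
have y3 : d^-1 * normsq (u n - x) <= d * (1/4).
  rewrite mulrC ler_pdivrMr //; move: h; rewrite expr2; lra.
have hh := nsq_ge0 (u n - x).
have dd : d ^+ 2 <= d by rewrite expr2; nra.
rewrite E ltr_norml; apply/andP; split; nra.
Qed.

Lemma cvs_rip u x y : cvs u x -> forall e : R, 0 < e -> exists N, forall n, (N <= n)%N ->
  `|rip (u n) y - rip x y| < e.
Proof.
move=> hu e e0.
have y0 := nsq_ge0 y.
have e1 : 0 < e ^+ 2 / (normsq y + 1) by rewrite divr_gt0 ?exprn_gt0 //; lra.
have [N hN] := hu _ e1; exists N => n /hN; rewrite ltr_pdivlMr; last lra.
move=> h; have := rip_CS (u n - x) y; rewrite ripBl => h2.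
rewrite -(@ltr_pXn2r _ 2) ?nnegrE ?normr_ge0 ?ltW // real_normK ?num_real //.
have := nsq_ge0 (u n - x); nra.
Qed.

Lemma lim_ge (s : nat -> R) (l a : R) :
  (forall e, 0 < e -> exists N, forall n, (N <= n)%N -> `|s n - l| < e) ->
  (exists N, forall n, (N <= n)%N -> a <= s n) -> a <= l.
Proof.
move=> hl [M hM]; apply/ler_addgt0Pr => e e0; have [N hN] := hl _ e0.
have := hN _ (leq_maxl N M); have := hM _ (leq_maxr N M).
rewrite ltr_norml => h1 /andP[h2 h3]; lra.
Qed.

Lemma lim_eq (s : nat -> R) (l l' : R) :
  (forall e, 0 < e -> exists N, forall n, (N <= n)%N -> `|s n - l| < e) ->
  (forall e, 0 < e -> exists N, forall n, (N <= n)%N -> `|s n - l'| < e) -> l = l'.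
Proof.
move=> hl hl'; apply/eqP; rewrite -subr_eq0 -normr_eq0 eq_le normr_ge0 andbT.
apply/ler_addgt0Pr => e e0; have e2 : 0 < e / 2 by lra.
have [N hN] := hl _ e2; have [M hM] := hl' _ e2.
have := hN _ (leq_maxl N M); have := hM _ (leq_maxr N M).
rewrite !ltr_norml => /andP[h1 h2] /andP[h3 h4]; rewrite add0r ler_norml; lra.
Qed.

Lemma inv_small (e : R) : 0 < e -> exists N, forall n, (N <= n)%N -> n.+1%:R^-1 < e.
Proof.
move=> e0; exists (Num.truncn e^-1) => n hn.
rewrite -[e]invrK ltf_pV2 ?posrE ?invr_gt0 ?ltr0n //.
apply: lt_le_trans (truncnS_gt _) _; by rewrite ler_nat ltnS.
Qed.

Lemma dense_cvs (A : set H) x : dense A -> exists2 u, (forall n, A (u n)) & cvs u x.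
Proof.
move=> /dense_nsq h.
have := fun n => h x n.+1%:R^-1; move=> /(_ _ _)/cid2 => h'.
have p n : 0 < n.+1%:R^-1 :> R by rewrite invr_gt0.
exists (fun n => sval (h' n (p n))).
  by move=> n; case: (h' n (p n)).
move=> e e0; have [N hN] := inv_small e0; exists N => n /hN.
by case: (h' n (p n)) => y Ay /= hy; rewrite nsqBC; apply: lt_trans.
Qed.

Lemma dense_ip_eq (A : set H) x y : dense A ->
  (forall z, A z -> '[x, z] = '[y, z]) -> x = y.
Proof.
move=> /(@dense_cvs _ (x - y))[u Au hu] h.
apply/eqP; rewrite -subr_eq0; apply/eqP/nsq_eq0; rewrite nsqE.
apply: lim_eq (cvs_rip (x - y) hu) _ => e e0; exists 0%N => n _.
by rewrite subr0 ripC /rip ipBl h // subrr normr0.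
Qed.

End Convergence.

(** * Forms and the first representation theorem *)

Section Riesz.
Variables (R : realType) (H : hilbertType R) (V : set H) (b : H -> H -> R).
Hypothesis pb : posform V b.
Hypothesis complete : forall u : nat -> H, (forall n, V (u n)) ->
  (forall e : R, 0 < e -> exists N, forall m n, (N <= m)%N -> (N <= n)%N ->
     b (u m - u n) (u m - u n) < e) ->
  exists2 x, V x & forall e : R, 0 < e -> exists N, forall n, (N <= n)%N ->
     b (u n - x) (u n - x) < e.

(** Minimise J x = b[x] - 2 l(x). The parallelogram identity makes a minimising sequence Cauchy for
    b, and stationarity of J at the limit is the representation. With completeness as a hypothesis
    the same lemma serves closed subspaces, form domains and ranges of projections. *)
Lemma riesz (l : H -> R) (M : R) :
  (forall (r : R) x y, V x -> V y -> l (r%:C *: x + y) = r * l x + l y) ->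
  (forall x, V x -> l x ^+ 2 <= M * b x x) ->
  exists2 x, V x & forall z, V z -> b x z = l z.
Proof.
move=> l_lin lM.
have l0 : l 0 = 0.
  by have := l_lin 1 _ _ (pf_0 pb) (pf_0 pb); rewrite scale1r addr0; lra.
have lZ r x : V x -> l (r%:C *: x) = r * l x.
  by move=> Vx; have := l_lin r _ _ Vx (pf_0 pb); rewrite l0 !addr0.
have lD x y : V x -> V y -> l (x + y) = l x + l y.
  by move=> Vx Vy; have := l_lin 1 _ _ Vx Vy; rewrite scale1r mul1r.
pose J x := b x x - 2 * l x.
pose S := [set J x | x in V].
have M0 : exists M1, forall x, V x -> - M1 <= J x.
  exists `|M| => x Vx; have := lM _ Vx; have := pf_ge0 pb Vx; rewrite /J.
  have := ler_norm M; have := normr_ge0 M.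
  set s := b x x; set q := l x; set m := `|M| => m0 hm s0 hq.
  have h1 : q ^+ 2 <= m * s by nra.
  have h2 := sqr_ge0 (s - m); nra.
have [M1 hM1] := M0.
have infS : has_inf S.
  split; first by exists (J 0), 0 => //; apply: pf_0 pb.
  by exists (- M1) => _ [x Vx <-]; apply: hM1.
pose m := inf S.
have mle x : V x -> m <= J x.
  by move=> Vx; apply: (ge_inf infS.2); exists x.
have hex (n : nat) : exists2 x, V x & J x < m + n.+1%:R^-1.
  have p : 0 < n.+1%:R^-1 :> R by rewrite invr_gt0.
  by have [_ [x Vx <-] hx] := inf_adherent p infS; exists x.
have [u hu] : {u : nat -> H | forall n, V (u n) /\ J (u n) < m + n.+1%:R^-1}.
  apply: cid; exists (fun n => s2val (cid2 (hex n))) => n.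
  by split; [exact: (s2valP (cid2 (hex n))) | exact: (s2valP' (cid2 (hex n)))].
have Vu n : V (u n) by case: (hu n).
have par x y : V x -> V y ->
    b (x - y) (x - y) <= 2 * (J x + J y - 2 * m).
  move=> Vx Vy; have Vxy := pf_VD pb Vx Vy.
  have Vh := pf_VZ pb (1/2) Vxy.
  have := mle _ Vh; rewrite /J (pf_qZ pb) // (pf_qD pb) // lZ // lD // (pf_qB pb) //.
  by set p := b x x; set q := b y y; set w := b x y; lra.
have [|x Vx hx] := complete Vu.
  move=> e e0; have e4 : 0 < e / 4 by lra.
  have [N hN] := inv_small e4; exists N => i j Ni Nj.
  have := par _ _ (Vu i) (Vu j); have := hN _ Ni; have := hN _ Nj.
  move: (hu i) (hu j) => [_ h1] [_ h2]; move: h1 h2.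
  by set p := i.+1%:R^-1; set q := j.+1%:R^-1; lra.
exists x => // z Vz.
(* Minimality at x against x + r z, written so that [quad_disc] with s = 0 forces the linear
   coefficient to vanish. Only the u n are known to be nearly minimal, hence the passage through
   e. *)
have key r : 0 <= 0 - 2 * (r * (l z - b x z)) + r ^+ 2 * b z z.
  suff : 0 <= 2 * r * (b x z - l z) + r ^+ 2 * b z z by lra.
  apply/ler_addgt0Pr => e e0.
  have p0 : 0 <= b z z := pf_ge0 pb Vz.
  have r20 : 0 <= r ^+ 2 := sqr_ge0 r.
  (* Chosen so that, by Cauchy-Schwarz, replacing u n by x in 2 r b(u n, z) costs at most e / 2. *)
  pose d := (e / 2) ^+ 2 / (4 * r ^+ 2 * b z z + 1).
  have d0 : 0 < d by rewrite divr_gt0 ?exprn_gt0 //; nra.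
  have e2 : 0 < e / 2 by lra.
  have [N hN] := hx _ d0; have [N' hN'] := inv_small e2.
  pose n := maxn N N'.
  have h1 := hN n (leq_maxl _ _); have h2 := hN' n (leq_maxr _ _).
  have [_ h3] := hu n.
  have Vrz := pf_VZ pb r Vz.
  have := mle _ (pf_VD pb (Vu n) Vrz).
  rewrite /J (pf_qD pb) // (pf_Zr pb) // (pf_qZ pb) // lD // lZ // => h4.
  have h5 := pf_CS pb (pf_VB pb (Vu n) Vx) Vz.
  rewrite (pf_Bl pb) // in h5.
  have h6 : (2 * r * (b (u n) z - b x z)) ^+ 2 <= (e / 2) ^+ 2.
    have : d * (4 * r ^+ 2 * b z z + 1) = (e / 2) ^+ 2.
      by rewrite /d mulfVK // gt_eqF //; nra.
    move=> <-; have k0 : 0 <= 4 * r ^+ 2 * b z z by apply: mulr_ge0 p0; lra.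
    have k1 : 4 * r ^+ 2 * (b (u n) z - b x z) ^+ 2 <=
        4 * r ^+ 2 * (b (u n - x) (u n - x) * b z z).
      by apply: ler_wpM2l h5; lra.
    have k2 := ler_wpM2l k0 (ltW h1); lra.
  have h7 : 2 * r * (b (u n) z - b x z) <= e / 2.
    rewrite leNgt; apply/negP => hh; move: h6; rewrite leNgt => /negP; apply.
    by rewrite ltr_pXn2r ?nnegrE //; lra.
  move: h2 h3 h4; rewrite /J; set p := n.+1%:R^-1; lra.
have := quad_disc (lexx 0) key; rewrite mulr0 => hq.
have /eqP : (l z - b x z) ^+ 2 == 0 by rewrite eq_le hq sqr_ge0.
by move/eqP; rewrite sqrf_eq0 subr_eq0 => /eqP.
Qed.

End Riesz.

Section Projection.
Variables (R : realType) (H : hilbertType R).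

Lemma lin_subspaceZ (L : set H) c x : lin_subspace L -> L x -> L (c *: x).
Proof. by move=> [L0 hL] Lx; rewrite -[_ *: _]addr0; apply: hL. Qed.
Lemma lin_subspaceD (L : set H) x y : lin_subspace L -> L x -> L y -> L (x + y).
Proof. by move=> [L0 hL] Lx Ly; rewrite -[x]scale1r; apply: hL. Qed.
Lemma lin_subspaceN (L : set H) x : lin_subspace L -> L x -> L (- x).
Proof. by move=> hL Lx; rewrite -scaleN1r; apply: lin_subspaceZ. Qed.
Lemma lin_subspaceB (L : set H) x y : lin_subspace L -> L x -> L y -> L (x - y).
Proof. by move=> hL Lx Ly; apply: lin_subspaceD => //; apply: lin_subspaceN. Qed.

(** The projection represents the functional <x, .> on L; sequential closedness of L is the
    completeness needed. *)
Lemma projection (L : set H) x : lin_subspace L ->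
  (forall u y, (forall n, L (u n)) -> cvs u y -> L y) ->
  exists2 p, L p & forall z, L z -> '[x - p, z] = 0.
Proof.
move=> sL cL.
have pL : posform L (@rip R H).
  split=> [|r y z Ly Lz|r y z w _ _ _|y z _ _|y _].
  - by case: sL.
  - by apply: sL.2.
  - by rewrite !ripE.
  - exact: ripC.
  - by rewrite -nsqE nsq_ge0.
have [u Lu hu|r y z _ _|y _|p Lp hp] := @riesz _ _ _ _ pL _ (rip x) (normsq x).
- have [|y hy] := @cauchys_cvs _ _ u.
    by move=> e /hu[N hN]; exists N => m n Nm Nn; rewrite nsqE; apply: hN.
  exists y; first exact: cL hy.
  by move=> e /hy[N hN]; exists N => n Nn; rewrite -nsqE; apply: hN.
- by rewrite !ripE.
- by rewrite -nsqE rip_CS.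
- exists p => // z Lz; rewrite ipBl (_ : '[x, z] = '[p, z]) ?subrr //.
  by apply: ip_rip; rewrite hp //; apply: lin_subspaceZ.
Qed.

End Projection.

Section ClosedForms.
Variables (R : realType) (H : hilbertType R).

(** The lower bound is written 1 - c so that the shifted form [bt], t + c, dominates the squared
    norm with constant one. *)
Record cform (t : sform R H) (c : R) : Prop := {
  cf_sesq : sesquilinear t;
  cf_sym : Defs.symmetric_form t;
  cf_low : forall x, fdom t x -> (1 - c) * normsq x <= quad t x;
  cf_closed : closed_form t;
  cf_dense : dense (fdom t) }.

Variables (t : sform R H) (c : R).
Hypothesis ct : cform t c.
Let V := fdom t.

Definition rt (x y : H) : R := complex.Re (t x y).
Definition bt (x y : H) : R := rt x y + c * rip x y.

Let sV : lin_subspace V := (cf_sesq ct).1.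

Lemma cf_VZ d x : V x -> V (d *: x).
Proof. exact: lin_subspaceZ. Qed.

Lemma cf_Dr x y z : V x -> V y -> V z -> t z (x + y) = t z x + t z y.
Proof.
move=> Vx Vy Vz; have := ((cf_sesq ct).2 1 _ _ _ Vx Vy Vz).2.
by rewrite scale1r rmorph1 mul1r.
Qed.
Lemma cf_Dl x y z : V x -> V y -> V z -> t (x + y) z = t x z + t y z.
Proof.
move=> Vx Vy Vz; have := ((cf_sesq ct).2 1 _ _ _ Vx Vy Vz).1.
by rewrite scale1r mul1r.
Qed.
Lemma cf_0r z : V z -> t z 0 = 0.
Proof.
move=> Vz; have := cf_Dr sV.1 sV.1 Vz; rewrite addr0 => /esym/eqP.
by rewrite -subr_eq0 addrK => /eqP.
Qed.
Lemma cf_0l z : V z -> t 0 z = 0.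
Proof.
move=> Vz; have := cf_Dl sV.1 sV.1 Vz; rewrite addr0 => /esym/eqP.
by rewrite -subr_eq0 addrK => /eqP.
Qed.
Lemma cf_Zr d x z : V x -> V z -> t z (d *: x) = Num.conj d * t z x.
Proof.
move=> Vx Vz; have := ((cf_sesq ct).2 d _ _ _ Vx sV.1 Vz).2.
by rewrite cf_0r // !addr0.
Qed.
Lemma cf_Zl d x z : V x -> V z -> t (d *: x) z = d * t x z.
Proof.
move=> Vx Vz; have := ((cf_sesq ct).2 d _ _ _ Vx sV.1 Vz).1.
by rewrite cf_0l // !addr0.
Qed.

Lemma rt_i x y : V x -> V y -> rt x ('i *: y) = complex.Im (t x y).
Proof.
by move=> Vx Vy; rewrite /rt cf_Zr //; case: (t x y) => a e /=; ring.
Qed.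
Lemma rt_il x y : V x -> V y -> rt ('i *: x) y = - rt x ('i *: y).
Proof.
by move=> Vx Vy; rewrite /rt cf_Zr // cf_Zl //; case: (t x y) => a e /=; ring.
Qed.

Lemma rt_sym x y : V x -> V y -> rt x y = rt y x.
Proof. by move=> Vx Vy; rewrite /rt (cf_sym ct) // ReJ. Qed.

Lemma quad_rt x : quad t x = rt x x. Proof. by []. Qed.

Lemma bt_ge x : V x -> normsq x <= bt x x.
Proof. by move=> /(cf_low ct); rewrite /bt -nsqE quad_rt; lra. Qed.

Lemma pf_bt : posform V bt.
Proof.
split=> [|r x y Vx Vy|r x y z Vx Vy Vz|x y Vx Vy|x Vx].
- exact: sV.1.
- exact: sV.2.
- rewrite /bt /rt ((cf_sesq ct).2 _ _ _ _ Vx Vy Vz).1 ReD ReMr !ripE; ring.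
- by rewrite /bt rt_sym // ripC.
- exact: le_trans (nsq_ge0 x) (bt_ge Vx).
Qed.

Lemma quad_bt x : quad t x = bt x x - c * normsq x.
Proof. by rewrite /bt nsqE quad_rt; ring. Qed.

Lemma quad_le_bt x : V x -> `|quad t x| <= (1 + `|c|) * bt x x.
Proof.
move=> Vx; have := bt_ge Vx; have := nsq_ge0 x; rewrite quad_bt => h1 h2.
have := ler_norm c; have := ler_norm (- c); rewrite normrN => h3 h4.
by rewrite ler_norml; apply/andP; split; nra.
Qed.

(** [closed_form] wants a limit in H in advance. A sequence that is Cauchy for [bt] is Cauchy in H,
    which supplies it. *)
Lemma bt_complete (u : nat -> H) : (forall n, V (u n)) ->
  (forall e : R, 0 < e -> exists N, forall m n, (N <= m)%N -> (N <= n)%N ->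
     bt (u m - u n) (u m - u n) < e) ->
  exists2 x, V x & forall e : R, 0 < e -> exists N, forall n, (N <= n)%N ->
     bt (u n - x) (u n - x) < e.
Proof.
move=> Vu hu; have VB m n : V (u m - u n) by apply: lin_subspaceB.
have [|x hx] := @cauchys_cvs _ _ u.
  move=> e /hu[N hN]; exists N => m n Nm Nn.
  by apply: le_lt_trans (bt_ge (VB m n)) (hN _ _ Nm Nn).
have [] := cf_closed ct Vu ((cvsP _ _).2 hx).
  move=> e e0; have c1 : 0 < 1 + `|c| by rewrite ltr_pwDl.
  have [|N hN] := hu (e / (1 + `|c|)); first exact: divr_gt0.
  exists N => m n Nm Nn; apply: le_lt_trans (quad_le_bt (VB m n)) _.
  by rewrite mulrC -ltr_pdivlMr //; apply: hN.
move=> Vx /(@cvgrPdist_lt _ R) hq; exists x => // e e0.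
have e2 : 0 < e / 2 by lra.
have [N _ hN] := hq _ e2.
have d0 : 0 < e / 2 / (1 + `|c|) by rewrite divr_gt0 // ltr_pwDl.
have [M hM] := hx _ d0.
exists (maxn N M) => n; rewrite geq_max => /andP[/hN /= h1 /hM h2].
move: h1; rewrite sub0r normrN quad_bt => h1.
move: h2; rewrite ltr_pdivlMr ?ltr_pwDl // => h2.
have h3 := ler_norm c; have h4 := nsq_ge0 (u n - x); have h5 := ler_norm (bt (u n - x) (u n - x) - c * normsq (u n - x)).
nra.
Qed.

Lemma form_riesz (l : H -> R) (M : R) :
  (forall (r : R) x y, V x -> V y -> l (r%:C *: x + y) = r * l x + l y) ->
  (forall x, V x -> l x ^+ 2 <= M * bt x x) ->
  exists2 x, V x & forall z, V z -> bt x z = l z.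
Proof. exact: riesz pf_bt bt_complete _ _. Qed.

Lemma bt_uniq x y : V x -> V y -> (forall z, V z -> bt x z = bt y z) -> x = y.
Proof.
move=> Vx Vy h; have Vxy : V (x - y) by apply: lin_subspaceB.
apply/eqP; rewrite -subr_eq0; apply/eqP/nsq_eq0/eqP; rewrite eq_le nsq_ge0 andbT.
by apply: le_trans (bt_ge Vxy) _; rewrite (pf_Bl pf_bt) // h // subrr.
Qed.

(** This is (T + c)^-1 for the operator T of the form, defined weakly so that linearity and symmetry
    follow from uniqueness. *)
Definition res (f : H) : H := xget 0 [set x | V x /\ forall z, V z -> bt x z = rip f z].

Lemma resP f : V (res f) /\ forall z, V z -> bt (res f) z = rip f z.
Proof.
rewrite /res; case: xgetP => [x _ //|h]; exfalso.
have [r x y _ _|x Vx|x Vx hx] := @form_riesz (rip f) (normsq f).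
- by rewrite !ripE.
- apply: le_trans (rip_CS _ _) _.
  by apply: (ler_wpM2l (nsq_ge0 f)); apply: bt_ge.
- exact: (h x).
Qed.

Lemma resV f : V (res f). Proof. exact: (resP f).1. Qed.
Lemma resE f z : V z -> bt (res f) z = rip f z. Proof. exact: (resP f).2. Qed.
Local Hint Resolve resV : core.

Lemma res_uniq f x : V x -> (forall z, V z -> bt x z = rip f z) -> res f = x.
Proof.
by move=> Vx hx; apply: bt_uniq (resV f) Vx _ => z Vz; rewrite resE ?hx.
Qed.

Lemma bt_i x y : V x -> V y -> bt ('i *: x) y = - bt x ('i *: y).
Proof. by move=> Vx Vy; rewrite /bt rt_il // rip_iC; ring. Qed.

Lemma resL (d : R[i]) f g : res (d *: f + g) = d *: res f + res g.
Proof.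
have rD f' g' : res (f' + g') = res f' + res g'.
  apply: res_uniq => [|z Vz]; first by apply: lin_subspaceD.
  by rewrite (pf_Dl pf_bt) // !resE // ripDl.
have rZ (r : R) f' : res (r%:C *: f') = r%:C *: res f'.
  apply: res_uniq => [|z Vz]; first by apply: cf_VZ.
  by rewrite (pf_Zl pf_bt) // resE // ripZl.
have ri f' : res ('i *: f') = 'i *: res f'.
  apply: res_uniq => [|z Vz]; first by apply: cf_VZ.
  rewrite bt_i // resE ?rip_iC //; exact: cf_VZ.
by rewrite rD scaleriE rD !rZ ri -scaleriE.
Qed.

Lemma res_sym f g : rip (res f) g = rip f (res g).
Proof.
rewrite ripC -resE // -resE //.
by rewrite (pf_sym pf_bt) //.
Qed.

Lemma res_coer f : normsq (res f) <= rip f (res f).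
Proof. by rewrite -resE // bt_ge //. Qed.

Lemma res_inj f : res f = 0 -> f = 0.
Proof.
move=> h; apply: (dense_ip_eq (cf_dense ct)) => z Vz; rewrite ip0l.
have e w : V w -> rip f w = 0 by move=> Vw; rewrite -resE // h (pf_0l pf_bt).
by rewrite -(ip0l z); apply: ip_rip; rewrite rip0l e //; apply: cf_VZ.
Qed.

(* The first representation theorem in weak form. *)
Lemma form_opP x f : graph_op (op_of_form t) (x, f) <->
  V x /\ forall z, V z -> rt x z = rip f z.
Proof.
have uni f1 f2 : (forall y, V y -> t x y = '[f1, y]) ->
    (forall y, V y -> t x y = '[f2, y]) -> f1 = f2.
  by move=> h1 h2; apply: (dense_ip_eq (cf_dense ct)) => z Vz; rewrite -h1 // h2.
split=> [[/= [f' [/= Vx hf']] <-]|[Vx hf]].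
  split => // z Vz; case: xgetP => [y -> [_ /= hy]|/(_ f')[]//].
  by rewrite /rt hy.
have hf2 : forall y, V y -> t x y = '[f, y].
  move=> y Vy; apply: complex_ext; first exact: hf.
  by rewrite Im_ip -hf ?rt_i //; apply: cf_VZ.
split; first by exists f.
rewrite /=; case: xgetP => [y -> [_ /= hy]|/(_ f)[]//]; exact: uni.
Qed.

Lemma form_op_resK f : graph_op (op_of_form t) (res f, f - c%:C *: res f).
Proof.
apply/form_opP; split=> [|z Vz]; first exact: (resV f).
by have := @resE f _ Vz; rewrite /bt ripBl ripZl; lra.
Qed.

Lemma form_op_resP x f : graph_op (op_of_form t) (x, f) -> res (f + c%:C *: x) = x.
Proof.
by move=> /form_opP[Vx h]; apply: res_uniq => // z Vz; rewrite ripDl ripZl /bt h.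
Qed.

End ClosedForms.

(** * Spectral projections from polynomials of the resolvent *)

Section MonotoneSequences.
Variable R : realType.

Lemma mono_lim (f : nat -> R) (M : R) :
  (forall m n, (m <= n)%N -> f m <= f n) -> (forall n, f n <= M) ->
  exists2 l, (forall n, f n <= l) & forall e, 0 < e -> exists N, forall n, (N <= n)%N -> l - e < f n.
Proof.
move=> fi fM; pose S := range f.
have hS : has_sup S by split; [exists (f 0%N), 0%N | exists M => _ [n _ <-]].
exists (sup S) => [n|e e0]; first by apply: (ub_le_sup hS.2); exists n.
have [_ [N _ <-] hN] := sup_adherent e0 hS.
by exists N => n Nn; apply: lt_le_trans hN (fi _ _ Nn).
Qed.

Lemma mono_cauchy (f : nat -> R) (M : R) :
  (forall m n, (m <= n)%N -> f m <= f n) -> (forall n, f n <= M) ->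
  forall e, 0 < e -> exists N, forall m n, (N <= n)%N -> f m - f n < e.
Proof.
move=> fi fM e e0; have [l fl hl] := mono_lim fi fM.
have [N hN] := hl _ e0; exists N => m n /hN; have := fl m; lra.
Qed.

End MonotoneSequences.

Section RealLinear.
Variables (R : realType) (H : hilbertType R).
Implicit Types C P : H -> H.

(** Real linearity lets multiplication by i count among the operators that a projection has to
    commute with; complex linearity is recovered from this in [commutesE]. *)
Definition rlin C := forall (r : R) x y, C (r%:C *: x + y) = r%:C *: C x + C y.
Definition rbnd C := exists M : R, forall x, normsq (C x) <= M * normsq x.

Lemma rlinD C x y : rlin C -> C (x + y) = C x + C y.
Proof. by move=> h; have := h 1 x y; rewrite !scale1r. Qed.
Lemma rlin0 C : rlin C -> C 0 = 0.
Proof. by move=> h; have := rlinD 0 0 h; rewrite addr0 -[LHS]addr0 => /addrI/esym. Qed.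
Lemma rlinZ C r x : rlin C -> C (r%:C *: x) = r%:C *: C x.
Proof. by move=> h; have := h r x 0; rewrite (rlin0 h) !addr0. Qed.
Lemma rlinN C x : rlin C -> C (- x) = - C x.
Proof. by move=> h; have := rlinZ (-1) x h; rewrite rmorphN !scaleN1r. Qed.
Lemma rlinB C x y : rlin C -> C (x - y) = C x - C y.
Proof. by move=> h; rewrite rlinD // rlinN. Qed.

Lemma rbnd_lip C : rlin C -> rbnd C -> exists M : R,
  forall a b, normsq (C a - C b) <= M * normsq (a - b).
Proof. by move=> h [M hM]; exists M => a b; rewrite -rlinB. Qed.

Lemma cvs_rbnd C u x : rlin C -> rbnd C -> cvs u x -> cvs (fun n => C (u n)) (C x).
Proof. by move=> h /(rbnd_lip h)[M hM]; exact: cvs_lip hM. Qed.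

Lemma rlin_i : rlin ( *:%R ('i : R[i]) : H -> H).
Proof. by move=> r x y; rewrite scalerDr !scalerA mulrC. Qed.
Lemma rbnd_i : rbnd ( *:%R ('i : R[i]) : H -> H).
Proof. by exists 1 => x; rewrite !nsqE rip_i mul1r. Qed.

Record oproj P : Prop := {
  op_lin : rlin P;
  op_sym : forall x y, rip (P x) y = rip x (P y);
  op_idem : forall x, P (P x) = P x }.

Lemma oproj_nsq P x : oproj P -> normsq (P x) = rip (P x) x.
Proof. by move=> h; rewrite nsqE (op_sym h) (op_idem h) ripC. Qed.

Lemma oproj_split P x : oproj P -> normsq x = normsq (P x) + normsq (x - P x).
Proof. by move=> h; rewrite nsqB (ripC x) -(oproj_nsq x h); ring. Qed.

Lemma oproj_le P x : oproj P -> normsq (P x) <= normsq x.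
Proof. by move=> h; rewrite (oproj_split x h) lerDl nsq_ge0. Qed.

Lemma oproj_bnd P : oproj P -> rbnd P.
Proof. by move=> h; exists 1 => x; rewrite mul1r oproj_le. Qed.

Lemma oprojC P : oproj P -> oproj (fun x => x - P x).
Proof.
move=> h; split=> [r x y|x y|x].
- by rewrite (op_lin h) scalerBr opprD addrACA.
- by rewrite ripBl ripBr (op_sym h).
- by rewrite (rlinB _ _ (op_lin h)) (op_idem h) subrr subr0.
Qed.

End RealLinear.

Section PolynomialCalculus.
Variables (R : realType) (H : hilbertType R) (K : H -> H).
Hypothesis K_lin : rlin K.
Hypothesis K_sym : forall x y, rip (K x) y = rip x (K y).
Implicit Types p q : {poly R}.

Definition ev p x : H := \sum_(i < size p) (p`_i)%:C *: iter i K x.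

Lemma ev_wide n p x : (size p <= n)%N -> ev p x = \sum_(i < n) (p`_i)%:C *: iter i K x.
Proof.
move=> hn; rewrite /ev (big_ord_widen n (fun i => (p`_i)%:C *: iter i K x)) //.
rewrite big_mkcond /=; apply: eq_bigr => i _; case: ltnP => // hi.
by rewrite nth_default // scale0r.
Qed.

Lemma evD p q x : ev (p + q) x = ev p x + ev q x.
Proof.
pose n := maxn (size p) (size q).
rewrite (ev_wide x (size_polyD p q)) (@ev_wide n p) ?leq_maxl // (@ev_wide n q) ?leq_maxr //.
rewrite -big_split /=; apply: eq_bigr => i _.
by rewrite coefD rmorphD /= scalerDl.
Qed.

Lemma evC a x : ev a%:P x = a%:C *: x.
Proof.
rewrite (@ev_wide 1) ?size_polyC ?leq_b1 // big_ord_recl big_ord0 addr0.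
by rewrite coefC.
Qed.

Lemma ev0 x : ev 0 x = 0.
Proof. by rewrite -polyC0 evC scale0r. Qed.
Lemma ev1 x : ev 1 x = x.
Proof. by rewrite -polyC1 evC scale1r. Qed.

Lemma evMX p x : ev (p * 'X) x = ev p (K x).
Proof.
have [->|p0] := eqVneq p 0; first by rewrite mul0r !ev0.
rewrite (@ev_wide (size p).+1) ?size_mulX // big_ord_recl coefMX eqxx scale0r add0r.
by apply: eq_bigr => i _; rewrite coefMX /= -iterSr.
Qed.

Lemma ev_lin p : rlin (ev p).
Proof.
move=> r x y; have hi n : rlin (iter n K).
  by elim: n => [|n IH] r' x' y' //=; rewrite IH K_lin.
rewrite /ev scaler_sumr -big_split /=; apply: eq_bigr => i _.
by rewrite hi scalerDr !scalerA mulrC.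
Qed.

Lemma evM p q x : ev (p * q) x = ev p (ev q x).
Proof.
have evZ a p' z : ev (a%:P * p') z = a%:C *: ev p' z.
  elim/poly_ind: p' z => [|p' b IH] z; first by rewrite mulr0 !ev0 scaler0.
  rewrite mulrDr mulrA evD evMX IH -rmorphM !evC evD evMX scalerDr evC scalerA.
  by rewrite rmorphM.
elim/poly_ind: q x => [|q a IH] x.
  by rewrite mulr0 !ev0 (rlin0 (ev_lin _)).
rewrite mulrDr mulrA !evD !evMX IH evC (rlinD _ _ (ev_lin p)); congr (_ + _).
by rewrite mulrC evZ (rlinZ _ _ (ev_lin p)).
Qed.

Lemma evN p x : ev (- p) x = - ev p x.
Proof. by rewrite -mulN1r -polyC1 -polyCN evM evC rmorphN scaleN1r. Qed.
Lemma evB p q x : ev (p - q) x = ev p x - ev q x.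
Proof. by rewrite evD evN. Qed.
Lemma evX x : ev 'X x = K x.
Proof. by rewrite -['X]mul1r evMX ev1. Qed.
Lemma evZ a p x : ev (a%:P * p) x = a%:C *: ev p x.
Proof. by rewrite evM evC. Qed.

Lemma ev_comm p (C : H -> H) x : rlin C -> (forall x, C (K x) = K (C x)) ->
  C (ev p x) = ev p (C x).
Proof.
move=> hC hCK; elim/poly_ind: p x => [|p a IH] x; first by rewrite !ev0 rlin0.
by rewrite !evD !evMX !evC rlinD // rlinZ // IH hCK.
Qed.

Lemma ev_sym p x y : rip (ev p x) y = rip x (ev p y).
Proof.
elim/poly_ind: p x y => [|p a IH] x y; first by rewrite !ev0 rip0l rip0r.
by rewrite !evD !evMX !evC !ripDl !ripDr !ripZl !ripZr IH K_sym ev_comm.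
Qed.

Definition pos p := forall x, 0 <= rip (ev p x) x.

Lemma pos_sqM p q : pos q -> pos (p ^+ 2 * q).
Proof. by move=> h x; rewrite expr2 -mulrA evM ev_sym mulrC evM; apply: h. Qed.
Lemma posD p q : pos p -> pos q -> pos (p + q).
Proof. by move=> hp hq x; rewrite evD ripDl addr_ge0. Qed.
Lemma posC a : 0 <= a -> pos a%:P.
Proof. by move=> a0 x; rewrite evC ripZl mulr_ge0 // -nsqE nsq_ge0. Qed.
Lemma posZ a p : 0 <= a -> pos p -> pos (a%:P * p).
Proof. by move=> a0 hp x; rewrite evZ ripZl mulr_ge0. Qed.

Lemma posXn p n : pos p -> pos (p ^+ n).
Proof.
move=> hp; rewrite -(odd_double_half n) -mul2n exprD mulrC mulnC exprM.
by apply: pos_sqM; case: odd => //; rewrite expr0 -polyC1; apply: posC.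
Qed.

Definition nonneg_coef p := forall i, 0 <= p`_i.

Lemma nncD p q : nonneg_coef p -> nonneg_coef q -> nonneg_coef (p + q).
Proof. by move=> hp hq i; rewrite coefD addr_ge0. Qed.
Lemma nncM p q : nonneg_coef p -> nonneg_coef q -> nonneg_coef (p * q).
Proof. by move=> hp hq i; rewrite coefM sumr_ge0 // => j _; rewrite mulr_ge0. Qed.
Lemma nncC a : 0 <= a -> nonneg_coef a%:P.
Proof. by move=> a0 i; rewrite coefC; case: eqP. Qed.
Lemma nncX : nonneg_coef 'X.
Proof. by move=> i; rewrite coefX; case: eqP. Qed.

(** Each power of w is a square times 1 or w, hence positive. Positivity along the iteration can
    thus be read off from coefficients. *)
Lemma pos_comp a w : pos w -> nonneg_coef a -> pos (a \Po w).
Proof.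
move=> hw ha; rewrite comp_polyE; elim/big_ind: _ => [|p q|i _].
- by move=> x; rewrite ev0 rip0l.
- exact: posD.
- by rewrite -mul_polyC; apply: posZ => //; apply: posXn.
Qed.

(* Newton-Schulz iteration s <- s (3 - s^2) / 2; for a contraction s_0 it
   converges strongly to the sign of s_0.  With w = 1 - s^2 one has
   w' = w^2 (3 + w) / 4. *)
Let h : {poly R} := (2^-1)%:P.
Let h2 : 2 * h = 1.
Proof. by rewrite /h -[2]/(2%:R) -polyC_natr -polyCM divff ?polyC1 // pnatr_eq0. Qed.

Variable s0 : {poly R}.
Fixpoint sgn n := if n is m.+1 then h * sgn m * (3 - sgn m ^+ 2) else s0.
Definition wgn n := 1 - sgn n ^+ 2.

Lemma wgnS n : wgn n.+1 = h ^+ 2 * wgn n ^+ 2 * (3 + wgn n).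
Proof.
rewrite /wgn /=; set s := sgn n; have h4 : (2 * h) ^+ 2 = 1 by rewrite h2 expr1n.
have e : (2 * h) ^+ 2 - (h * s * (3 - s ^+ 2)) ^+ 2 =
  h ^+ 2 * (1 - s ^+ 2) ^+ 2 * (4 - s ^+ 2) by ring.
by rewrite -{1}h4 e; ring.
Qed.

Lemma sgnS n : sgn n.+1 = sgn n * (1 + h * wgn n).
Proof.
rewrite /wgn /=; set s := sgn n.
have e : h * s * (3 - s ^+ 2) = s * (2 * h + h * (1 - s ^+ 2)) by ring.
by rewrite e h2.
Qed.

(** Both recursions, s' = s (1 + w / 2) and w' = w^2 (3 + w) / 4, have nonnegative coefficients in
    w, so every later iterate has this shape relative to step n. Monotonicity follows from it. *)
Lemma sgn_factor n k : exists a b, [/\ nonneg_coef a, nonneg_coef b,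
  sgn (k + n) = sgn n * (1 + (a \Po wgn n)) & wgn (k + n) = b \Po wgn n].
Proof.
have nh : nonneg_coef h by apply: nncC; rewrite invr_ge0.
elim: k => [|k [a [b [ha hb es ew]]]].
  exists 0, 'X; split=> //; last by rewrite comp_polyX.
    by move=> i; rewrite coef0.
  exact: nncX.
  by rewrite comp_poly0 addr0 mulr1.
exists (a + h * b + h * (a * b)), (h ^+ 2 * b ^+ 2 * (3%:P + b)); split.
- by apply: nncD; [apply: nncD => // | ]; apply: nncM => //; apply: nncM.
- rewrite !expr2; do ?[apply: nncM => //]; apply: nncD => //; exact: nncC.
- rewrite addSn sgnS es ew !(comp_polyD, comp_polyM, comp_polyC); ring.
- rewrite addSn wgnS ew !(comp_polyD, comp_polyM, comp_polyC, rmorphXn) /=.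
  by rewrite polyC_natr -!expr2.
Qed.

Hypothesis w0_pos : pos (wgn 0).

Lemma wgn_pos n : pos (wgn n).
Proof.
have [a [b [_ hb _]]] := sgn_factor 0 n; rewrite addn0 => ->.
exact: pos_comp.
Qed.

Lemma sgn_mono n k : pos (sgn n * sgn (k + n) - sgn n ^+ 2).
Proof.
have [a [b [ha _ -> _]]] := sgn_factor n k.
have -> : sgn n * (sgn n * (1 + (a \Po wgn n))) - sgn n ^+ 2 = sgn n ^+ 2 * (a \Po wgn n).
  by ring.
by apply: pos_sqM; apply: pos_comp => //; apply: wgn_pos.
Qed.

Lemma sgn_mono' n m x : (n <= m)%N -> normsq (ev (sgn n) x) <= rip (ev (sgn n) x) (ev (sgn m) x).
Proof.
move=> nm; have := sgn_mono n (m - n) x.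
rewrite subnK // evB expr2 !evM ripBl !(ev_sym (sgn n) _ x) -nsqE.
by rewrite (ripC (ev (sgn m) x)); lra.
Qed.

Lemma sgn_le n x : normsq (ev (sgn n) x) <= normsq x.
Proof.
have := wgn_pos n x; rewrite /wgn evB ev1 expr2 evM ripBl ev_sym -!nsqE; lra.
Qed.

Lemma sgn_incr n m x : (n <= m)%N -> normsq (ev (sgn n) x) <= normsq (ev (sgn m) x).
Proof.
move=> nm; have := sgn_mono' x nm; have := nsq_ge0 (ev (sgn n) x - ev (sgn m) x).
rewrite nsqB; lra.
Qed.

(** Since s_m s_n >= s_m^2 for m <= n, |s_m x - s_n x|^2 <= |s_n x|^2 - |s_m x|^2, and these norms
    increase and are bounded by |x|. *)
Lemma sgn_cvs x : exists l, cvs (fun n => ev (sgn n) x) l.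
Proof.
apply: cauchys_cvs => e e0.
have [N hN] := mono_cauchy (fun m n => @sgn_incr m n x) (fun n => sgn_le n x) e0.
have key m n : (N <= m)%N -> (m <= n)%N -> normsq (ev (sgn m) x - ev (sgn n) x) < e.
  move=> Nm mn; rewrite nsqB; have := sgn_mono' x mn; have := hN n m Nm; lra.
exists N => m n Nm Nn; have [mn|/ltnW nm] := leqP m n; first exact: key.
by rewrite nsqBC; apply: key.
Qed.

Definition Sg x := sval (cid (sgn_cvs x)).
Lemma SgP x : cvs (fun n => ev (sgn n) x) (Sg x).
Proof. exact: svalP (cid (sgn_cvs x)). Qed.

Lemma Sg_lin : rlin Sg.
Proof.
move=> r x y; apply: cvs_unique (SgP _) _.
have := cvsD (cvsZ r (SgP x)) (SgP y).
by under eq_fun do rewrite -ev_lin.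
Qed.

Lemma Sg_comm C x : rlin C -> rbnd C -> (forall x, C (K x) = K (C x)) ->
  C (Sg x) = Sg (C x).
Proof.
move=> lC bC hC; apply: cvs_unique (SgP _).
have := cvs_rbnd lC bC (SgP x).
by under eq_fun do rewrite ev_comm //.
Qed.

Lemma Sg_sym x y : rip (Sg x) y = rip x (Sg y).
Proof.
apply: lim_eq (cvs_rip y (SgP x)) _.
have := cvs_rip x (SgP y); rewrite (ripC x).
by under eq_forall do under eq_forall do under eq_exists do under eq_forall do
  under eq_forall do rewrite ev_sym ripC.
Qed.

Lemma cvs_sgn (u : nat -> H) x : cvs u x -> cvs (fun n => ev (sgn n) (u n)) (Sg x).
Proof.
move=> hu; have h1 : cvs (fun n => ev (sgn n) (u n - x)) 0.
  move=> e /hu[N hN]; exists N => n /hN; rewrite subr0; apply: le_lt_trans.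
  exact: sgn_le.
have := cvsD h1 (SgP x); rewrite add0r.
by under eq_fun do rewrite -(rlinD _ _ (ev_lin _)) subrK.
Qed.

(** The limit of s' = s (3 - s^2) / 2 is S = (3 S - S^3) / 2, so S takes only the values -1, 0 and
    1. *)
Lemma Sg3 x : Sg (Sg (Sg x)) = Sg x.
Proof.
have h1 := SgP x; have hs := cvs_sgn (cvs_sgn h1).
have := cvsB (cvsZ 3 h1) hs; move/(cvsZ 2^-1).
have e n : (2^-1)%:C *: (3%:C *: ev (sgn n) x - ev (sgn n) (ev (sgn n) (ev (sgn n) x)))
   = ev (sgn n.+1) x.
  rewrite -!evM -!evZ -evB -evZ /=; congr (ev _ x).
  by rewrite -/h polyC_natr; ring.
under eq_fun do rewrite e; move=> h2'.
have h3 : cvs (fun n => ev (sgn n.+1) x) (Sg x).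
  by move=> d /h1[N hN]; exists N => n Nn; apply: hN; apply: leqW.
have := cvs_unique h2' h3 => e'.
by apply: rip_ext => z; have := congr1 (fun w => rip w z) e'; rewrite /= !ripE; lra.
Qed.

(** This ties S to the sign of s_0: where S = -1 it says <s_0 x, x> <= - |s_0 x|^2, where S = 1 the
    reverse. *)
Lemma Sg_ge x : normsq (ev s0 x) <= rip (ev s0 x) (Sg x).
Proof.
rewrite ripC; apply: lim_ge (cvs_rip _ (SgP x)) _; exists 0%N => n _.
by rewrite ripC; apply: (@sgn_mono' 0).
Qed.

Lemma Sg_ker x : ev s0 x = 0 <-> Sg x = 0.
Proof.
split=> e; last by apply: nsq_eq0; have := Sg_ge x; rewrite e rip0r;
  move: (nsq_ge0 (ev s0 x)) => ? ?; apply/eqP; rewrite eq_le; apply/andP.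
apply: cvs_unique (SgP x) _ => d d0; exists 0%N => n _.
have [a [b [_ _ es _]]] := sgn_factor 0 n; rewrite addn0 in es.
by rewrite es /= mulrC evM e (rlin0 (ev_lin _)) subrr nsq0.
Qed.

End PolynomialCalculus.

Section Projections.
Variables (R : realType) (H : hilbertType R).
Implicit Types P Q : H -> H.

Lemma oproj_diff P Q x : oproj P -> oproj Q -> (forall x, P (Q x) = P x) ->
  normsq (Q x - P x) = normsq (Q x) - normsq (P x).
Proof.
move=> hP hQ PQ; rewrite nsqB.
have -> : rip (Q x) (P x) = normsq (P x).
  by rewrite -(op_sym hP) PQ (oproj_nsq _ hP).
ring.
Qed.

Lemma oproj_ker_le P Q : oproj P -> oproj Q -> (forall x, P (Q x) = P x) ->
  forall x, Q (P x) = P x.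
Proof.
move=> hP hQ PQ x; apply: rip_ext => z.
by rewrite (op_sym hQ) (op_sym hP) PQ (op_sym hP).
Qed.

Lemma oproj_0 : oproj (fun _ : H => 0 : H).
Proof.
split=> [r x y|x y|//]; first by rewrite scaler0 addr0.
by rewrite rip0l rip0r.
Qed.

(** For nested projections |E_n x - E_m x|^2 is the increment of the bounded increasing sequence
    |E_n x|^2. *)
Lemma incr_proj (E : nat -> H -> H) x : (forall n, oproj (E n)) ->
  (forall m n x, (m <= n)%N -> E m (E n x) = E m x) -> exists y, cvs (fun n => E n x) y.
Proof.
move=> hE hm; apply: cauchys_cvs => e e0.
have inc m n : (m <= n)%N -> normsq (E m x) <= normsq (E n x).
  move=> mn; rewrite -subr_ge0 -oproj_diff ?nsq_ge0 // => y; exact: hm.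
have [N hN] := mono_cauchy inc (fun n => oproj_le x (hE n)) e0.
have key m n : (N <= m)%N -> (m <= n)%N -> normsq (E n x - E m x) < e.
  by move=> Nm mn; rewrite oproj_diff; [apply: hN | | | move=> y; apply: hm].
exists N => m n Nm Nn; have [mn|/ltnW nm] := leqP m n; last exact: key.
by rewrite nsqBC; apply: key.
Qed.

Lemma decr_proj (E : nat -> H -> H) x : (forall n, oproj (E n)) ->
  (forall m n x, (m <= n)%N -> E n (E m x) = E n x) -> exists y, cvs (fun n => E n x) y.
Proof.
move=> hE hm; have [|m n z mn|y hy] := @incr_proj (fun n x => x - E n x) x.
- by move=> n; apply: oprojC.
- rewrite (rlinB _ _ (op_lin (hE m))).
  rewrite (oproj_ker_le (hE n) (hE m)) => [|w]; last exact: hm.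
  by rewrite opprB addrA subrK.
exists (x - y); have := cvsB (cvs_cst x) hy.
by under eq_fun do rewrite subKr.
Qed.

End Projections.

Section Cut.
Variables (R : realType) (H : hilbertType R) (K : H -> H).
Hypothesis K_lin : rlin K.
Hypothesis K_sym : forall x y, rip (K x) y = rip x (K y).
Hypothesis K_coer : forall x, normsq (K x) <= rip (K x) x.
Hypothesis K_inj : forall x, K x = 0 -> x = 0.

Lemma K_le x : rip (K x) x <= normsq x.
Proof. have := K_coer x; have := rip_young (K x) x ltr01; rewrite invr1; lra. Qed.
Lemma K_ge0 x : 0 <= rip (K x) x.
Proof. exact: le_trans (nsq_ge0 _) (K_coer x). Qed.
Lemma K_bnd : rbnd K.
Proof. by exists 1 => x; have := K_le x; have := K_coer x; lra. Qed.
Lemma K_gt0 x : x != 0 -> 0 < rip (K x) x.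
Proof.
move=> x0; apply: lt_le_trans (K_coer x); apply: nsq_gt0.
by apply: contra x0 => /eqP/K_inj/eqP.
Qed.

(** A bicommutant condition. Since C may be i, K or another such projection, projections obtained
    this way are complex linear and commute with K and with one another. *)
Definition commutes (N : H -> H) := forall C : H -> H, rlin C -> rbnd C ->
  (forall x, C (K x) = K (C x)) -> forall x, C (N x) = N (C x).

(* N is the projection onto the negative part of the symmetric operator A. *)
Record cut (A N : H -> H) : Prop := {
  cut_proj : oproj N;
  cut_comm : commutes N;
  cut_lt : forall x, N x = x -> x != 0 -> rip (A x) x < 0;
  cut_ge : forall x, N x = 0 -> 0 <= rip (A x) x }.

(** With S the sign of s_0, the projection onto S = -1 is N = (S^2 - S) / 2. The kernel of s_0 goes
    to the complement, which is why one inequality of [cut] is strict and the other is not. *)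
Lemma cut_exists (s0 : {poly R}) :
  (forall x, normsq (ev K s0 x) <= normsq x) -> exists N, cut (ev K s0) N.
Proof.
move=> s0_le.
have w0 : pos K (wgn s0 0).
  move=> x; rewrite /wgn /= evB // ev1 expr2 evM // ripBl ev_sym // -!nsqE subr_ge0.
  exact: s0_le.
pose S := Sg K_lin K_sym w0.
have Sl : rlin S := Sg_lin K_lin K_sym w0.
have Ss x y : rip (S x) y = rip x (S y) := Sg_sym K_lin K_sym w0 x y.
have S3 x : S (S (S x)) = S x := Sg3 K_lin K_sym w0 x.
have Sge x : normsq (ev K s0 x) <= rip (ev K s0 x) (S x) := Sg_ge K_lin K_sym w0 x.
have Sker x : ev K s0 x = 0 <-> S x = 0 := Sg_ker K_lin K_sym w0 x.
pose N x := (2^-1)%:C *: (S (S x) - S x).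
have NS x : S (N x) = - N x.
  by rewrite /N (rlinZ _ _ Sl) (rlinB _ _ Sl) S3 -scalerN opprB.
exists N; split.
- split=> [r x y|x y|x].
  + rewrite /N !Sl; apply: rip_ext => z; rewrite !ripE; ring.
  + by rewrite /N !ripE !Ss.
  + rewrite {1}/N !NS (rlinN _ Sl) NS; apply: rip_ext => z; rewrite !ripE; lra.
- move=> C lC bC hC x; rewrite /N (rlinZ _ _ lC) (rlinB _ _ lC).
  by rewrite !(Sg_comm K_lin K_sym w0 _ lC bC hC).
- move=> x Nx x0.
  have Sx : S x = - x by rewrite -[in LHS]Nx NS Nx.
  have := Sge x; rewrite Sx ripNr => h.
  rewrite ltNge; apply/negP => h'; have := nsq_ge0 (ev K s0 x) => h3.
  have h2 : normsq (ev K s0 x) = 0.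
    by apply/eqP; rewrite eq_le h3 andbT; apply: le_trans h _; lra.
  have /Sker := nsq_eq0 h2; rewrite Sx => /eqP; rewrite oppr_eq0; exact/negP.
- move=> x Nx.
  (* [N x = 0] means S^2 x = S x, so S x - x lies in the kernel of S, hence of s_0, and <s_0 x, x> =
     <s_0 x, S x>. *)
  have SS : S (S x) = S x.
    have /eqP := Nx; rewrite scaler_eq0 => /orP[/eqP[]/eqP|/eqP/subr0_eq//].
    by rewrite invr_eq0 pnatr_eq0.
  have e1 : ev K s0 (S x) = ev K s0 x.
    have /Sker : S (S x - x) = 0 by rewrite (rlinB _ _ Sl) SS subrr.
    by rewrite (rlinB _ _ (ev_lin K_lin _)) => /subr0_eq.
  have h1 := Sge x; have h2 := nsq_ge0 (ev K s0 x).
  have e2 : rip (ev K s0 x) x = rip (ev K s0 x) (S x).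
    rewrite -{1}e1 -Ss; congr (rip _ _).
    apply: (Sg_comm K_lin K_sym w0 _ (ev_lin K_lin s0) _ _) => [|y].
      exists 1 => y; rewrite mul1r; exact: s0_le.
    by rewrite (ev_comm _ _ K_lin).
  by rewrite e2; lra.
Qed.

(** As 0 <= K <= 1, the factor 1 / (1 + tau) makes K - tau a contraction, as the iteration requires;
    e = 1 or -1 selects the side. *)
Definition shift_poly (e tau : R) : {poly R} := (e * (1 + tau)^-1)%:P * ('X - tau%:P).

Lemma ev_shift e tau x :
  ev K (shift_poly e tau) x = (e * (1 + tau)^-1)%:C *: (K x - tau%:C *: x).
Proof. by rewrite /shift_poly evZ // evB // evX evC. Qed.

Lemma shift_le e tau x : 0 < tau -> e ^+ 2 = 1 ->
  normsq (ev K (shift_poly e tau) x) <= normsq x.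
Proof.
move=> t0 e1; rewrite ev_shift nsqZ nsqB nsqZ ripZr.
have h1 := K_coer x; have h2 := K_le x; have h3 := K_ge0 x; have h4 := nsq_ge0 x.
set q := (1 + tau)^-1; have qt : q * (1 + tau) = 1 by rewrite mulVf // gt_eqF //; lra.
have E : q ^+ 2 * ((1 + tau) ^+ 2 * normsq x) = normsq x.
  by rewrite mulrA -exprMn qt expr1n mul1r.
rewrite -[leRHS]E exprMn e1 mul1r.
apply: ler_wpM2l; first exact: sqr_ge0.
have h5 := mulr_ge0 (ltW t0) h3; have h6 := mulr_ge0 (ltW t0) h4.
rewrite sqrrD; lra.
Qed.

Lemma rip_shift e tau x : rip (ev K (shift_poly e tau) x) x =
  (1 + tau)^-1 * (e * (rip (K x) x - tau * normsq x)).
Proof. by rewrite ev_shift !ripE nsqE; ring. Qed.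

(* The spectral projections of K for ]-oo, tau[ and ]tau, +oo[. *)
Lemma cut_below tau : 0 < tau -> exists N, [/\ oproj N, commutes N,
  forall x, N x = x -> x != 0 -> rip (K x) x < tau * normsq x &
  forall x, N x = 0 -> tau * normsq x <= rip (K x) x].
Proof.
move=> t0; have q0 : 0 < (1 + tau)^-1 by rewrite invr_gt0; lra.
have [x|N [h1 h2 h3 h4]] := @cut_exists (shift_poly 1 tau).
  by apply: shift_le; rewrite ?expr1n.
exists N; split=> // [x hx x0|x hx].
  by have := h3 _ hx x0; rewrite rip_shift pmulr_rlt0 // mul1r; lra.
by have := h4 _ hx; rewrite rip_shift pmulr_rge0 // mul1r; lra.
Qed.

Lemma cut_above tau : 0 < tau -> exists N, [/\ oproj N, commutes N,
  forall x, N x = x -> x != 0 -> tau * normsq x < rip (K x) x &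
  forall x, N x = 0 -> rip (K x) x <= tau * normsq x].
Proof.
move=> t0; have q0 : 0 < (1 + tau)^-1 by rewrite invr_gt0; lra.
have [x|N [h1 h2 h3 h4]] := @cut_exists (shift_poly (-1) tau).
  by apply: shift_le; rewrite // sqrrN expr1n.
exists N; split=> // [x hx x0|x hx].
  by have := h3 _ hx x0; rewrite rip_shift pmulr_rlt0 // mulN1r; lra.
by have := h4 _ hx; rewrite rip_shift pmulr_rge0 // mulN1r; lra.
Qed.

End Cut.

(** * The resolution of the identity belonging to the resolvent *)

Section Resolution.
Variables (R : realType) (H : hilbertType R) (K : H -> H) (c : R).
Hypothesis K_lin : rlin K.
Hypothesis K_sym : forall x y, rip (K x) y = rip x (K y).
Hypothesis K_coer : forall x, normsq (K x) <= rip (K x) x.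
Hypothesis K_inj : forall x, K x = 0 -> x = 0.

Definition Ncut (tau : R) : H -> H :=
  if pselect (0 < tau) is left h then sval (cid (cut_below K_lin K_sym K_coer h)) else fun=> 0.

Lemma NcutP tau : 0 < tau -> [/\ oproj (Ncut tau), commutes K (Ncut tau),
  forall x, Ncut tau x = x -> x != 0 -> rip (K x) x < tau * normsq x &
  forall x, Ncut tau x = 0 -> tau * normsq x <= rip (K x) x].
Proof.
by move=> t0; rewrite /Ncut; case: pselect => // h; case: cid.
Qed.

(* Spectral projection of K^-1 - c for ]-oo, t]. *)
Definition Et (t : R) (x : H) : H := if 0 < t + c then x - Ncut (t + c)^-1 x else 0.

Let Kbnd := K_bnd K_coer.

Lemma Et_proj t : oproj (Et t).
Proof.
have [h|h] := boolP (0 < t + c); last first.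
  rewrite (_ : Et t = fun=> 0); first exact: oproj_0.
  by apply/funext => x; rewrite /Et (negbTE h).
rewrite (_ : Et t = fun x => x - Ncut (t + c)^-1 x); last first.
  by apply/funext => x; rewrite /Et h.
by apply: oprojC; have [] := NcutP (tau := (t + c)^-1); rewrite ?invr_gt0.
Qed.

Lemma Et_comm t : commutes K (Et t).
Proof.
move=> C lC bC hC x; rewrite /Et; case: ifP => h; last by rewrite (rlin0 lC).
have [//|_ hN _ _] := NcutP (tau := (t + c)^-1); first by rewrite invr_gt0.
by rewrite (rlinB _ _ lC) hN.
Qed.

Lemma Et_K t x : K (Et t x) = Et t (K x).
Proof. exact: Et_comm. Qed.

Lemma Et_Et s t x : Et s (Et t x) = Et t (Et s x).
Proof.
apply: Et_comm; [exact: op_lin (Et_proj s)|exact: oproj_bnd (Et_proj s)|].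
by move=> y; rewrite Et_K.
Qed.

Lemma Et_0 t : t + c <= 0 -> forall x, Et t x = 0.
Proof. by move=> h x; rewrite /Et ltNge h. Qed.

Lemma Et_eq t x : 0 < t + c -> Et t x = x -> normsq x <= (t + c) * rip (K x) x.
Proof.
move=> h; rewrite /Et h => /eqP; rewrite eq_sym -subr_eq0 subKr => /eqP e.
have [|_ _ _ /(_ _ e)] := NcutP (tau := (t + c)^-1); first by rewrite invr_gt0.
by rewrite mulrC ler_pdivrMr // mulrC.
Qed.

Lemma Et_ker t x : 0 < t + c -> Et t x = 0 -> x != 0 -> (t + c) * rip (K x) x < normsq x.
Proof.
move=> h; rewrite /Et h => /subr0_eq e x0.
have [|_ _ /(_ _ (esym e) x0) + _] := NcutP (tau := (t + c)^-1); first by rewrite invr_gt0.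
by rewrite mulrC ltr_pdivlMr // mulrC.
Qed.

Lemma Et_ker' t x : 0 < t + c -> Et t x = 0 -> (t + c) * rip (K x) x <= normsq x.
Proof.
move=> h e; have [->|x0] := eqVneq x 0.
  by rewrite rip0r mulr0 nsq0.
exact/ltW/Et_ker.
Qed.

(** The difference z is fixed by E_s and annihilated by E_t, so that |z|^2 <= (s + c) <K z, z> <= (t
    + c) <K z, z> < |z|^2 unless z = 0. *)
Lemma Et_mono s t x : s <= t -> Et s (Et t x) = Et s x.
Proof.
move=> st; have [s0|s0] := ltrP 0 (s + c); last by rewrite !(Et_0 s0).
have t0 : 0 < t + c by lra.
set z := Et s x - Et s (Et t x).
suff z0 : z = 0 by rewrite -[RHS](subrK (Et s (Et t x))) -/z z0 add0r.
have hs : Et s z = z.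
  by rewrite /z (rlinB _ _ (op_lin (Et_proj s))) !(op_idem (Et_proj s)).
have ht : Et t z = 0.
  rewrite /z (rlinB _ _ (op_lin (Et_proj t))) -(Et_Et s t (Et t x)).
  by rewrite (op_idem (Et_proj t)) Et_Et subrr.
apply/eqP/negPn/negP => zn0.
have h1 := Et_eq s0 hs; have h2 := Et_ker t0 ht zn0.
have h3 := K_ge0 K_coer z; nra.
Qed.

Lemma Et_mono' s t x : s <= t -> Et t (Et s x) = Et s x.
Proof. by move=> st; rewrite -Et_Et Et_mono. Qed.

Lemma Et_lt1 t x : t + c < 1 -> Et t x = 0.
Proof.
move=> h; have [t0|t0] := ltrP 0 (t + c); last exact: Et_0.
have h1 := Et_eq t0 (op_idem (Et_proj t) x).
have h2 := K_le K_coer (Et t x); have h3 := nsq_ge0 (Et t x).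
apply: nsq_eq0; apply/eqP; rewrite eq_le h3 andbT.
have h4 : normsq (Et t x) <= (t + c) * normsq (Et t x).
  by apply: le_trans h1 _; apply: ler_wpM2l => //; apply: ltW.
nra.
Qed.

Lemma Et_nondecr s t x : s <= t -> normsq (Et s x) <= normsq (Et t x).
Proof.
move=> st; rewrite -subr_ge0 -oproj_diff ?nsq_ge0 //; try exact: Et_proj.
by move=> y; apply: Et_mono.
Qed.

Lemma Et_cvs_fix (E : nat -> R) y x t : cvs (fun n => Et (E n) x) y ->
  (forall n, E n <= t) -> Et t y = y.
Proof.
move=> hy hE; apply: cvs_unique _ (hy).
have := cvs_rbnd (op_lin (Et_proj t)) (oproj_bnd (Et_proj t)) hy.
by under eq_fun do rewrite Et_mono' //.
Qed.

(** If y is the limit of E_{t + 1/n} x, then z = y - E_t x is fixed by every E_{t + 1/n} and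
    annihilated by E_t. Hence |z|^2 <= (t + 1/n + c) <K z, z> for all n, against the strict
    inequality of [Et_ker]. That strictness decides for continuity from the right. *)
Lemma Et_right t x (e : R) : 0 < e ->
  exists2 d, 0 < d & normsq (Et (t + d) x) - normsq (Et t x) < e.
Proof.
move=> e0; have [t0|t0] := ltrP 0 (t + c); last first.
  (* Here t + 1/2 + c < 1, where E vanishes because K <= 1. *)
  exists (1/2) => //; rewrite Et_lt1 ?Et_0 ?nsq0 ?subrr //; lra.
pose s n : R := t + n.+1%:R^-1.
have p n : 0 < n.+1%:R^-1 :> R by rewrite invr_gt0.
have ts n : t <= s n by rewrite lerDl ltW.
have dec m n : (m <= n)%N -> s n <= s m.
  by move=> mn; rewrite lerD2l lef_pV2 ?posrE ?ltr0n // ler_nat ltnS.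
have [|m n z mn|y hy] := @decr_proj _ _ (fun n => Et (s n)) x.
- by move=> n; apply: Et_proj.
- by apply: Et_mono; apply: dec.
set z := y - Et t x.
have Ety : Et t y = Et t x.
  apply: cvs_unique (cvs_cst _).
  have := cvs_rbnd (op_lin (Et_proj t)) (oproj_bnd (Et_proj t)) hy.
  by under eq_fun do rewrite Et_mono //.
have z1 : Et t z = 0.
  by rewrite /z (rlinB _ _ (op_lin (Et_proj t))) Ety (op_idem (Et_proj t)) subrr.
have sy n : Et (s n) y = y.
  have hy' : cvs (fun k => Et (s (n + k)%N) x) y.
    move=> d /hy[N hN]; exists N => k Nk; apply: hN; apply: leq_trans Nk _.
    exact: leq_addl.
  by apply: Et_cvs_fix hy' _ => k; apply: dec; apply: leq_addr.
have z2 n : Et (s n) z = z.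
  by rewrite /z (rlinB _ _ (op_lin (Et_proj _))) sy Et_mono'.
have z0 : z = 0.
  apply/eqP/negPn/negP => zn0; have h := Et_ker t0 z1 zn0.
  have k0 := K_ge0 K_coer z.
  pose d := (normsq z - (t + c) * rip (K z) z) / (rip (K z) z + 1).
  have d0 : 0 < d by rewrite divr_gt0 //; lra.
  have [N /(_ N (leqnn N)) hN] := inv_small d0.
  have := @Et_eq (s N) z _ (z2 N); rewrite /s => /(_ _).
  move: hN (p N); set q := N.+1%:R^-1 => hN q0 /(_ _) h5.
  have {}h5 : normsq z <= (t + q + c) * rip (K z) z by apply: h5; lra.
  have hd : d * (rip (K z) z + 1) = normsq z - (t + c) * rip (K z) z.
    by rewrite mulfVK // gt_eqF //; lra.
  nra.
have ey : y = Et t x by apply/eqP; rewrite -subr_eq0 -/z z0.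
have [N hN] := cvs_nsq hy e0; exists N.+1%:R^-1 => //.
by have := hN N (leqnn N); rewrite ey ltr_norml => /andP[_].
Qed.

(** A vector z annihilated by all E_n satisfies (n + c) <K z, z> <= |z|^2 for large n, so <K z, z> =
    0 and z = 0 by injectivity of K. *)
Lemma Et_top x (e : R) : 0 < e -> exists t0, forall t, t0 <= t -> normsq (x - Et t x) < e.
Proof.
move=> e0; have [|m n z mn|y hy] := @incr_proj _ _ (fun n => Et n%:R) x.
- by move=> n; apply: Et_proj.
- by apply: Et_mono; rewrite ler_nat.
set z := x - y.
have hz n : Et n%:R z = 0.
  rewrite /z (rlinB _ _ (op_lin (Et_proj _))); apply/eqP; rewrite subr_eq0; apply/eqP.
  apply: cvs_unique (cvs_cst _) _.
  have := cvs_rbnd (op_lin (Et_proj n%:R)) (oproj_bnd (Et_proj n%:R)) hy.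
  move=> h d /h[N hN]; exists (maxn N n) => k; rewrite geq_max => /andP[Nk nk].
  by have := hN _ Nk; rewrite Et_mono // ler_nat.
have z0 : z = 0.
  apply/eqP/negPn/negP => zn0; have k0 := K_gt0 K_coer K_inj zn0.
  have n0 := nsq_ge0 z.
  pose N := (Num.truncn (normsq z / rip (K z) z + `|c|)).+1.
  have hN : normsq z / rip (K z) z + `|c| < N%:R := truncnS_gt _.
  have c1 := ler_norm (- c); rewrite normrN in c1.
  have q0 : 0 <= normsq z / rip (K z) z by rewrite divr_ge0 // ltW.
  have := Et_ker' _ (hz N) => /(_ _) h.
  have {}h : (N%:R + c) * rip (K z) z <= normsq z by apply: h; lra.
  have h2 : normsq z / rip (K z) z < N%:R + c by lra.
  by move: h2; rewrite ltr_pdivrMr //; lra.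
have [N hN] := hy _ e0; exists N%:R => t Nt.
have := hN N (leqnn N); have -> : y = x by apply/eqP; rewrite eq_sym -subr_eq0 -/z z0.
rewrite nsqBC; apply: le_lt_trans.
have h u : normsq (x - Et u x) = normsq x - normsq (Et u x).
  by have := oproj_split x (Et_proj u); lra.
by rewrite !h lerB // Et_nondecr.
Qed.

End Resolution.

(** * Projections for ]-oo, r[ of the operator of a closed form *)

Section LevelProjection.
Variables (R : realType) (H : hilbertType R) (t : sform R H) (c : R).
Hypothesis ct : cform t c.
Let K := res t c.

Lemma res_rlin : rlin K.
Proof. by move=> r x y; apply: resL. Qed.
Lemma res_coer' x : normsq (K x) <= rip (K x) x.
Proof. by rewrite ripC; apply: res_coer. Qed.
Lemma res_i x : 'i *: K x = K ('i *: x).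
Proof. by have := resL ct 'i x 0; rewrite -/K (rlin0 res_rlin) !addr0. Qed.

Lemma commutesE P : rlin P -> commutes K P -> forall d x y, P (d *: x + y) = d *: P x + P y.
Proof.
move=> lP cP d x y.
have ci z : P ('i *: z) = 'i *: P z by rewrite (cP _ (@rlin_i _ H) (@rbnd_i _ H) res_i).
by rewrite (rlinD _ _ lP) scaleriE (rlinD _ _ lP) !(rlinZ _ _ lP) ci -scaleriE.
Qed.

Lemma oproj_ran_closed (P : H -> H) (u : nat -> H) x : oproj P ->
  (forall n, P (u n) = u n) -> cvs u x -> P x = x.
Proof.
move=> hP hu cu; apply: cvs_unique _ (cu).
have := cvs_rbnd (op_lin hP) (oproj_bnd hP) cu.
by under eq_fun do rewrite hu.
Qed.

(** On the range of P the form <K y, z> is coercive, so Riesz inverts K there. Thus spectral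
    projections below a finite level map into the operator domain. *)
Lemma res_onto P (m : R) x : oproj P -> commutes K P ->
  (forall y, P y = y -> normsq y <= m * rip (K y) y) -> P x = x ->
  exists2 u, P u = u & K u = x.
Proof.
move=> hP cP hm Px.
have PK y : P (K y) = K (P y).
  by rewrite (cP K res_rlin _ (fun _ => erefl)) //; apply: K_bnd; apply: res_coer'.
have m0 : 0 <= `|m| := normr_ge0 m; have m1 := ler_norm m.
have hm' y : P y = y -> normsq y <= `|m| * rip (K y) y.
  move=> /hm; have := K_ge0 res_coer' y; nra.
pose V : set H := [set y | P y = y].
have pV : posform V (fun x y => rip (K x) y).
  split=> [|r y z Vy Vz|r y z w _ _ _|y z _ _|y _].
  - exact: rlin0 (op_lin hP).
  - by rewrite /V /= (op_lin hP) Vy Vz.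
  - by rewrite res_rlin !ripE.
  - by rewrite (res_sym ct) ripC.
  - exact: K_ge0 res_coer' _.
have VB y z : V y -> V z -> V (y - z).
  by move=> Vy Vz; rewrite /V /= (rlinB _ _ (op_lin hP)) Vy Vz.
have [u Vu hu|r y z _ _|y Vy|u Vu hu] := @riesz _ _ _ _ pV _ (rip x) (`|m| * normsq x).
- have [|y hy] := @cauchys_cvs _ _ u.
    move=> e e0; have c0 : 0 < e / (`|m| + 1) by rewrite divr_gt0 //; lra.
    have [N hN] := hu _ c0; exists N => i j Ni Nj.
    have := hN i j Ni Nj; rewrite ltr_pdivlMr; last lra.
    have := hm' _ (VB _ _ (Vu i) (Vu j)); have := K_ge0 res_coer' (u i - u j); nra.
  exists y; first exact: oproj_ran_closed hP Vu hy.
  move=> e /hy[N hN]; exists N => n /hN; apply: le_lt_trans.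
  exact: K_le res_coer' _.
- by rewrite !ripE.
- apply: le_trans (rip_CS x y) _; have := hm' _ Vy; have := nsq_ge0 x; nra.
exists u => //; apply/eqP; rewrite -subr_eq0; apply/eqP/nsq_eq0; rewrite nsqE.
have Vd : V (K u - x) by apply: VB => //; rewrite /V /= PK Vu.
by rewrite ripBl hu // subrr.
Qed.

(** Cauchy-Schwarz for [bt] between K x and x reads |x|^4 <= <K x, x> bt[x], which converts an upper
    bound on K into a lower bound on the form. *)
Lemma low_bound (r : R) x : fdom t x -> 0 < r + c -> (r + c) * rip (K x) x <= normsq x ->
  r * normsq x <= quad t x.
Proof.
move=> Vx rc h; rewrite (quad_bt t c).
suff : (r + c) * normsq x <= bt t c x x by lra.
have := pf_CS (pf_bt ct) (resV ct x) Vx; rewrite (resE ct _ Vx) (resE ct) ?(resV ct) //.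
rewrite -nsqE ripC -/K => h2.
have n0 := nsq_ge0 x; have [n1|n1] := eqVneq (normsq x) 0.
  by rewrite n1 mulr0; apply: le_trans (bt_ge ct Vx); rewrite nsq_ge0.
have n2 : 0 < normsq x by rewrite lt_def n1.
have b0 := bt_ge ct Vx.
rewrite -(ler_pM2l n2).
have h3 : (r + c) * normsq x ^+ 2 <= (r + c) * rip (K x) x * bt t c x x.
  by rewrite -mulrA; apply: ler_wpM2l => //; apply: ltW.
have : (r + c) * rip (K x) x * bt t c x x <= normsq x * bt t c x x.
  by apply: ler_wpM2r => //; lra.
by rewrite expr2 in h3; lra.
exact: resV.
Qed.

(* The spectral projection of the operator of t for ]-oo, r[. *)
Record level (r : R) (F : H -> H) : Prop := {
  lv_proj : oproj F;
  lv_comm : commutes K F;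
  lv_dom : forall x, F x = x -> exists2 u, F u = u & K u = x;
  lv_lt : forall x, F x = x -> x != 0 -> quad t x < r * normsq x;
  lv_ge : forall x, fdom t x -> F x = 0 -> r * normsq x <= quad t x;
  lv_le : 0 < r + c -> forall x, F x = x -> normsq x <= (r + c) * rip (K x) x }.

(** If r + c > 0, F is the projection for K > 1 / (r + c). On its range x = K u with bt[x] = <K u,
    u>, and <K u, u>^2 <= |u|^2 |x|^2 gives the strict upper bound. If r + c <= 0, then F = 0,
    because t >= 1 - c > r. *)
Lemma level_exists r : exists F, level r F.
Proof.
have [rc|rc] := ltrP 0 (r + c); last first.
  exists (fun=> 0); split=> //.
  - exact: oproj_0.
  - by move=> C lC _ _ x; rewrite (rlin0 lC).
  - by move=> x <-; exists 0 => //; rewrite (rlin0 res_rlin).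
  - by move=> x <-; rewrite eqxx.
  - move=> x Vx _; have := cf_low ct Vx; have := nsq_ge0 x; nra.
  - by rewrite ltNge rc.
have rc' : 0 < (r + c)^-1 by rewrite invr_gt0.
have [F [hF cF h3 h4]] := cut_above res_rlin (res_sym ct) res_coer' rc'.
have le x : F x = x -> normsq x <= (r + c) * rip (K x) x.
  move=> Fx; have [->|x0] := eqVneq x 0; first by rewrite nsq0 rip0r mulr0.
  by have := h3 _ Fx x0; rewrite mulrC ltr_pdivrMr // mulrC => /ltW.
have dm x : F x = x -> exists2 u, F u = u & K u = x.
  by move=> Fx; apply: (res_onto hF cF le Fx).
exists F; split=> // [x Fx x0|x Vx Fx].
  have [u Fu xE] := dm _ Fx; have Vx : fdom t x by rewrite -xE; apply: resV.
  have u0 : u != 0 by apply: contra x0 => /eqP u0; rewrite -xE u0 (rlin0 res_rlin).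
  have h5 := h3 _ Fu u0; rewrite mulrC ltr_pdivrMr // in h5.
  have h6 := rip_CS u x; rewrite -{1 2}xE (ripC u) in h6.
  have h7 : bt t c x x = rip (K u) u by rewrite -{1}xE (resE ct) // ripC xE.
  rewrite (quad_bt t c) h7; suff : rip (K u) u < (r + c) * normsq x by lra.
  have p0 := nsq_gt0 u0; have q0 := nsq_gt0 x0.
  have P0 : 0 < rip (K u) u by apply: K_gt0 u0; [exact: res_coer' | exact: res_inj].
  rewrite -(ltr_pM2l P0); apply: le_lt_trans (_ : normsq u * normsq x < _).
    by move: h6; rewrite expr2 xE.
  by rewrite -(ltr_pM2r q0) in h5; lra.
apply: low_bound => //; have := h4 _ Fx.
by rewrite mulrC ler_pdivlMr // mulrC.
Qed.

Variables (r : R) (F : H -> H).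
Hypothesis hF : level r F.

Lemma lvE d x y : F (d *: x + y) = d *: F x + F y.
Proof. exact: commutesE (op_lin (lv_proj hF)) (lv_comm hF) _ _ _. Qed.
Lemma lvB x y : F (x - y) = F x - F y.
Proof. exact: rlinB (op_lin (lv_proj hF)). Qed.
Lemma lv_idem x : F (F x) = F x.
Proof. exact: op_idem (lv_proj hF) _. Qed.
Lemma lvK x : F (K x) = K (F x).
Proof.
apply/esym; apply: (lv_comm hF) => //; [exact: res_rlin | apply: K_bnd; exact: res_coer'].
Qed.
Lemma lvV x : fdom t (F x).
Proof. by have [u _ <-] := lv_dom hF (lv_idem x); apply: resV. Qed.
Lemma lv_sym x y : '[F x, y] = '[x, F y].
Proof.
have h := op_sym (lv_proj hF).
apply: ip_rip; rewrite h //; congr (rip _ _).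
by have := lvE 'i y 0; rewrite (rlin0 (op_lin (lv_proj hF))) !addr0.
Qed.
End LevelProjection.

(** * Finite-dimensional subspaces *)

Section Dimension.
Variables (R : realType) (V : lmodType R[i]).
Implicit Types (L : set V).

Lemma has_dim_sub L n : has_dim L n -> lin_subspace L.
Proof.
move=> [e [_ ->]]; split=> [|d _ _ [c ->] [c' ->]].
  by exists (fun=> 0); rewrite big1 // => i _; rewrite scale0r.
exists (fun i => d * c i + c' i); rewrite scaler_sumr -big_split /=.
by apply: eq_bigr => i _; rewrite scalerA scalerDl.
Qed.

Lemma lsubZ L c x : lin_subspace L -> L x -> L (c *: x).
Proof. by move=> [L0 hL] Lx; rewrite -[_ *: _]addr0; apply: hL. Qed.
Lemma lsubD L x y : lin_subspace L -> L x -> L y -> L (x + y).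
Proof. by move=> [L0 hL] Lx Ly; rewrite -[x]scale1r; apply: hL. Qed.
Lemma lsub_sum L n (c : 'I_n -> R[i]) (e : 'I_n -> V) : lin_subspace L ->
  (forall i, L (e i)) -> L (\sum_i c i *: e i).
Proof.
move=> hL he; elim/big_ind: _ => [|x y|i _]; first by case: hL.
  exact: lsubD.
exact: lsubZ.
Qed.

Lemma basis_in n (e : 'I_n -> V) i :
  exists c : 'I_n -> R[i], e i = \sum_j c j *: e j.
Proof.
exists (fun j => (j == i)%:R); rewrite (bigD1 i) //= eqxx scale1r big1 ?addr0 //.
by move=> j /negbTE ->; rewrite scale0r.
Qed.

Lemma kernel_vector n m (f : 'I_n -> 'I_m -> R[i]) : (m < n)%N ->
  exists2 c : 'I_n -> R[i], exists i, c i != 0 & forall j, \sum_i c i * f i j = 0.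
Proof.
move=> mn; pose A : 'M[R[i]]_(n, m) := \matrix_(i, j) f i j.
have kA : kermx A != 0.
  by rewrite kermx_eq0 /row_free neq_ltn (leq_ltn_trans (rank_leq_col A) mn).
have /rowV0Pn[v /sub_kermxP vA v0] := kA.
exists (v 0).
  apply: contrapT => h; case/negP: v0; apply/eqP/rowP => i; rewrite mxE.
  by apply: contrapT => /eqP vi; apply: h; exists i.
move=> j; have := congr1 (fun B : 'M[R[i]]_(1, m) => B 0 j) vA.
rewrite !mxE => h; rewrite -[RHS]h; apply: eq_bigr => i _; by rewrite mxE.
Qed.

Lemma comb_neq0 n (e : 'I_n -> V) (c : 'I_n -> R[i]) :
  (forall c : 'I_n -> R[i], \sum_i c i *: e i = 0 -> forall i, c i = 0) ->
  (exists i, c i != 0) -> \sum_i c i *: e i != 0.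
Proof. by move=> he [i /eqP ci]; apply/eqP => /he/(_ i). Qed.

Lemma has_dim0 : has_dim [set 0 : V] 0.
Proof.
exists (fun=> 0); split; first by move=> c _ [].
apply/seteqP; split=> x /=; first by move->; exists (fun=> 0); rewrite big_ord0.
by move=> [c ->]; rewrite big_ord0.
Qed.

Lemma has_dim_extend L n x : has_dim L n -> ~ L x ->
  has_dim [set y | exists2 z, L z & exists d : R[i], y = z + d *: x] n.+1.
Proof.
move=> hL; have sL := has_dim_sub hL; move: (hL) => [e [ie LE]] Lx.
pose e' (i : 'I_n.+1) := if unlift ord_max i is Some j then e j else x.
have sumE (c : 'I_n.+1 -> R[i]) : \sum_i c i *: e' i =
    \sum_i c (widen_ord (leqnSn n) i) *: e i + c ord_max *: x.
  rewrite big_ord_recr /=; congr (_ + _); last by rewrite /e' unlift_none.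
  apply: eq_bigr => i _; rewrite /e'.
  have -> : widen_ord (leqnSn n) i = lift ord_max i by apply: val_inj; rewrite /= /bump leqNgt ltn_ord.
  by rewrite liftK.
exists e'; split=> [c|].
  rewrite sumE => h.
  have cm : c ord_max = 0.
    apply/eqP/negPn/negP => cm; apply: Lx.
    have -> : x = - (c ord_max)^-1 *: \sum_i c (widen_ord (leqnSn n) i) *: e i.
      by move/eqP: h; rewrite addr_eq0 => /eqP ->; rewrite scaleNr scalerN opprK scalerA mulVf // scale1r.
    apply: lsubZ => //; rewrite LE; by exists (fun i => c (widen_ord (leqnSn n) i)).
  move: h; rewrite cm scale0r addr0 => /ie h i.
  have [j ->|->] := unliftP ord_max i; last by [].
  rewrite -(h j); congr (c _); apply: val_inj; rewrite /= /bump leqNgt ltn_ord //.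
apply/seteqP; split=> y /=.
  move=> [z Lz [d ->]]; move: Lz; rewrite LE => -[c ->].
  exists (fun i => if unlift ord_max i is Some j then c j else d).
  rewrite sumE unlift_none; congr (_ + _); apply: eq_bigr => i _.
  have -> : widen_ord (leqnSn n) i = lift ord_max i by apply: val_inj; rewrite /= /bump leqNgt ltn_ord.
  by rewrite liftK.
move=> [c ->]; rewrite sumE; eexists; last by exists (c ord_max).
by rewrite LE; exists (fun i => c (widen_ord (leqnSn n) i)).
Qed.

(** [has_dim] knows finite dimensions only. Adding vectors one at a time, this alternative compares
    a possibly infinite-dimensional subspace with k. *)
Lemma dim_dichotomy L k : lin_subspace L ->
  (exists2 j, (j < k)%N & has_dim L j) \/ (exists2 L', L' `<=` L & has_dim L' k).
Proof.
move=> sL; elim: k => [|k [[j jk hj]|[L' L'L hL']]].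
- right; exists [set 0]; last exact: has_dim0.
  by move=> x /= ->; case: sL.
- by left; exists j => //; apply: ltnW.
- have [LL'|/existsNP[x /not_implyP[Lx nx]]] := pselect (forall x, L x -> L' x).
    by left; exists k => //; rewrite (_ : L = L') //; apply/seteqP.
  right; eexists; last exact: has_dim_extend hL' nx.
  by move=> y [z Lz [d ->]]; apply: lsubD => //; [apply: L'L | apply: lsubZ].
Qed.

Lemma has_dim_map (W : lmodType R[i]) (f : V -> W) L n :
  (forall (d : R[i]) x y, L x -> L y -> f (d *: x + y) = d *: f x + f y) ->
  (forall x, L x -> f x = 0 -> x = 0) -> has_dim L n -> has_dim (f @` L) n.
Proof.
move=> fl fi hL; have sL := has_dim_sub hL; move: (hL) => [e [ie LE]].
have Le i : L (e i) by have [c ->] := basis_in e i; rewrite LE; exists c.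
have f0 : f 0 = 0.
  have := fl (-1) _ _ sL.1 sL.1; rewrite scaler0 addr0 scaleN1r addrC subrr //.
have fs m (c : 'I_m -> R[i]) (g : 'I_m -> V) : (forall i, L (g i)) ->
    f (\sum_i c i *: g i) = \sum_i c i *: f (g i).
  elim: m c g => [|m IH] c g Lg; first by rewrite !big_ord0.
  rewrite !big_ord_recl fl //; first by rewrite IH.
  by apply: lsub_sum.
exists (f \o e); split=> [c|].
  rewrite -fs // => /fi h; apply: ie; apply: h.
  by rewrite LE; exists c.
apply/seteqP; split=> y /=.
  by move=> [x Lx <-]; move: Lx; rewrite LE => -[c ->]; exists c; rewrite fs.
move=> [c ->]; exists (\sum_i c i *: e i); last by rewrite fs.
by rewrite LE; exists c.
Qed.

End Dimension.

(** * Forms on finite-dimensional subspaces and comparison of dimensions *)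

Section FormsOnFiniteDim.
Variables (R : realType) (H : hilbertType R).
Implicit Types (L : set H).

Lemma sesq_sumr (t : sform R H) n (c : 'I_n -> R[i]) (e : 'I_n -> H) x :
  sesquilinear t -> fdom t x -> (forall i, fdom t (e i)) ->
  t x (\sum_i c i *: e i) = \sum_i Num.conj (c i) * t x (e i).
Proof.
move=> [sV ht] Vx Ve.
have t0 : t x 0 = 0.
  have := (ht 1 _ _ _ sV.1 sV.1 Vx).2; rewrite scale1r addr0 rmorph1 mul1r.
  by move=> /esym/eqP; rewrite -subr_eq0 addrK => /eqP.
elim: n c e Ve => [|n IH] c e Ve; first by rewrite !big_ord0.
rewrite !big_ord_recl (ht _ _ _ _ _ _ Vx).2 ?IH //; apply: lsub_sum => //.
Qed.

Lemma sesq_suml (t : sform R H) n (c : 'I_n -> R[i]) (e : 'I_n -> H) x :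
  sesquilinear t -> fdom t x -> (forall i, fdom t (e i)) ->
  t (\sum_i c i *: e i) x = \sum_i c i * t (e i) x.
Proof.
move=> [sV ht] Vx Ve.
have t0 : t 0 x = 0.
  have := (ht 1 _ _ _ sV.1 sV.1 Vx).1; rewrite scale1r addr0 mul1r.
  by move=> /esym/eqP; rewrite -subr_eq0 addrK => /eqP.
elim: n c e Ve => [|n IH] c e Ve; first by rewrite !big_ord0.
rewrite !big_ord_recl (ht _ _ _ _ _ _ Vx).1 ?IH //; apply: lsub_sum => //.
Qed.

(** A vector with coordinates killed by the Gram matrix would be isotropic, hence zero. The inverse
    matrix gives the dual vectors, conjugated because t is conjugate-linear in its second
    argument. *)
Lemma dual_basis (t : sform R H) n (e : 'I_n -> H) :
  sesquilinear t -> (forall i, fdom t (e i)) ->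
  (forall c : 'I_n -> R[i], \sum_i c i *: e i = 0 -> forall i, c i = 0) ->
  (forall c : 'I_n -> R[i], let x := \sum_i c i *: e i in t x x = 0 -> x = 0) ->
  exists d : 'I_n -> 'I_n -> R[i],
    forall i k, t (e i) (\sum_j d k j *: e j) = (i == k)%:R.
Proof.
move=> st Ve ie pt; pose G : 'M[R[i]]_n := \matrix_(i, j) t (e i) (e j).
have uG : G \in unitmx.
  rewrite -row_free_unit -kermx_eq0; apply/rowV0P => v /sub_kermxP vG.
  apply/rowP => i; rewrite mxE; apply: (ie (v 0)).
  apply: pt; rewrite sesq_suml //; last by apply: lsub_sum => //; case: st.
  under eq_bigr do rewrite sesq_sumr // mulr_sumr.
  rewrite exchange_big big1 // => j _.
  have := congr1 (fun B : 'M[R[i]]_(1, n) => B 0 j) vG; rewrite !mxE => h.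
  rewrite -[RHS](mulr0 (Num.conj (v 0 j))) -[X in _ = _ * X]h mulr_sumr.
  by apply: eq_bigr => k _; rewrite mxE mulrCA.
exists (fun k j => Num.conj ((invmx G) j k)) => i k.
rewrite sesq_sumr //; have := congr1 (fun B : 'M[R[i]]_n => B i k) (mulmxV uG); rewrite !mxE => <-.
by apply: eq_bigr => j _; rewrite mxE conjCK mulrC.
Qed.

(** Algebra replaces compactness of the unit sphere: the coordinates of x are t(x, f k) for the dual
    basis f, bounded by Cauchy-Schwarz for t itself, and they bound the norm. *)
Lemma uniform_pos (t : sform R H) L n : sesquilinear t -> Defs.symmetric_form t ->
  L `<=` fdom t -> has_dim L n -> (forall x, L x -> x != 0 -> 0 < quad t x) ->
  exists2 C : R, 0 < C & forall x, L x -> normsq x <= C * quad t x.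
Proof.
move=> st yt LV hL pL; have sL := has_dim_sub hL; move: (hL) => [e [ie LE]].
have Le i : L (e i) by have [c ->] := basis_in e i; rewrite LE; exists c.
have Ve i : fdom t (e i) by apply: LV.
have [|d hd] := dual_basis st Ve ie.
  move=> c x tx; apply/eqP/negPn/negP => x0.
  have Lx : L x by rewrite LE; exists c.
  by have := pL x Lx x0; rewrite /quad tx ltxx.
have pt : posform L (fun x y => complex.Re (t x y)).
  split=> [|r x y Lx Ly|r x y z Lx Ly Lz|x y Lx Ly|x Lx].
  - by case: sL.
  - exact: sL.2.
  - by rewrite (st.2 _ _ _ _ (LV _ Lx) (LV _ Ly) (LV _ Lz)).1 ReD ReMr.
  - by rewrite yt ?ReJ //; apply: LV.
  - have [->|x0] := eqVneq x 0; last by apply/ltW/pL.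
    have := (st.2 (-1) _ _ _ (LV _ sL.1) (LV _ sL.1) (LV _ sL.1)).1.
    by rewrite scaler0 addr0 mulN1r addNr => ->.
pose f k := \sum_j d k j *: e j.
have Lf k : L (f k) by apply: lsub_sum.
pose C := \sum_k (2 * quad t (f k)) * normsq (e k).
have cbound c k : let x := \sum_i c i *: e i in normsq (c k) <= 2 * quad t (f k) * quad t x.
  move=> x; have Lx : L x by rewrite LE; exists c.
  have tc : t x (f k) = c k.
    rewrite sesq_suml //; last exact: LV.
    rewrite (bigD1 k) //= hd eqxx mulr1 big1 ?addr0 // => i /negbTE ik.
    by rewrite hd ik mulr0.
  have h1 := pf_CS pt Lx (Lf k); rewrite tc in h1.
  have Lif : L ('i *: f k) by apply: lsubZ.
  have h2 := pf_CS pt Lx Lif.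
  (* Testing with i f_k recovers the imaginary part of the coordinate c k. *)
  have e1 : t x ('i *: f k) = Num.conj 'i * c k.
    have t0 : t x 0 = 0.
      have := (st.2 1 _ _ _ (LV _ sL.1) (LV _ sL.1) (LV _ Lx)).2.
      rewrite scale1r addr0 rmorph1 mul1r => /esym/eqP.
      by rewrite -subr_eq0 addrK => /eqP.
    by have := (st.2 'i _ _ _ (LV _ (Lf k)) (LV _ sL.1) (LV _ Lx)).2; rewrite addr0 t0 addr0 tc.
  have e2 : complex.Re (t ('i *: f k) ('i *: f k)) = quad t (f k).
    have t0 : t ('i *: f k) 0 = 0.
      have := (st.2 1 _ _ _ (LV _ sL.1) (LV _ sL.1) (LV _ Lif)).2.
      rewrite scale1r addr0 rmorph1 mul1r => /esym/eqP.
      by rewrite -subr_eq0 addrK => /eqP.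
    have t0' : t 0 (f k) = 0.
      have := (st.2 1 _ _ _ (LV _ sL.1) (LV _ sL.1) (LV _ (Lf k))).1.
      rewrite scale1r addr0 mul1r => /esym/eqP.
      by rewrite -subr_eq0 addrK => /eqP.
    have := (st.2 'i _ _ _ (LV _ (Lf k)) (LV _ sL.1) (LV _ Lif)).2; rewrite addr0 t0 addr0 => ->.
    have := (st.2 'i _ _ _ (LV _ (Lf k)) (LV _ sL.1) (LV _ (Lf k))).1; rewrite addr0 t0' addr0 => ->.
    by rewrite /quad; case: (t (f k) (f k)) => u v /=; ring.
  rewrite normsqC; move: h1 h2; rewrite e1 e2 /quad; case: (c k) => u v /=.
  set qx := complex.Re (t x x); set qf := complex.Re (t (f k) (f k)).
  have -> : 0 * u - - (1) * v = v by ring.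
  lra.
(* The factor [2 ^+ m] comes from iterating |u + v|^2 <= 2 |u|^2 + 2 |v|^2. *)
have nsum m (c : 'I_m -> R[i]) (g : 'I_m -> H) Q : (forall i, normsq (c i) <= Q i) ->
    normsq (\sum_i c i *: g i) <= 2 ^+ m * \sum_i Q i * normsq (g i).
  elim: m c g Q => [|m IH] c g Q hQ; first by rewrite !big_ord0 nsq0 mulr0.
  rewrite !big_ord_recl; apply: le_trans (nsqDle _ _) _.
  have h1 := IH (fun i => c (lift ord0 i)) (fun i => g (lift ord0 i)) (fun i => Q (lift ord0 i)) (fun i => hQ _).
  have e1 : normsq (c ord0 *: g ord0) = normsq (c ord0) * normsq (g ord0).
    by rewrite [LHS]nsqE /rip !ipE ip_nsq normsqC; case: (c ord0) => u v /=; ring.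
  have h2 : normsq (c ord0) * normsq (g ord0) <= Q ord0 * normsq (g ord0).
    by apply: ler_wpM2r; [exact: nsq_ge0 | exact: hQ].
  have q0 : 0 <= Q ord0 * normsq (g ord0).
    by apply: le_trans h2; rewrite mulr_ge0 ?nsq_ge0 // normsqC addr_ge0 ?sqr_ge0.
  have p1 : 1 <= 2 ^+ m :> R by rewrite exprn_ege1 // ler1n.
  rewrite e1 exprS; move: h1; set S := \sum_(i < m) _; set X := normsq (\sum_i _).
  set P := 2 ^+ m in p1 *; nra.
pose C' := 2 ^+ n * C + 1.
have C0 : 0 <= C.
  apply: sumr_ge0 => k _; rewrite mulr_ge0 ?nsq_ge0 // mulr_ge0 //.
  exact: pf_ge0 pt _ (Lf k).
exists C'; first by rewrite ltr_wpDl // mulr_ge0 // exprn_ge0.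
move=> x Lx; have qx : 0 <= quad t x := pf_ge0 pt Lx.
move: (Lx); rewrite LE => -[c xE].
rewrite [leLHS](_ : _ = normsq (\sum_i c i *: e i)); last by rewrite xE.
apply: le_trans (nsum _ _ _ (fun k => 2 * quad t (f k) * quad t x) _) _ => [k|].
  by have := cbound c k; rewrite -xE.
rewrite /C' mulrDl mul1r -mulrA (_ : \sum_(i < n) _ = C * quad t x); first by rewrite lerDl.
by rewrite /C mulr_suml; apply: eq_bigr => k _; rewrite mulrAC.
Qed.

Lemma fin_proj L n x : has_dim L n -> exists2 p, L p & forall z, L z -> '[x - p, z] = 0.
Proof.
move=> hL; have sL := has_dim_sub hL; move: (hL) => [e [ie LE]].
pose t : sform R H := SForm setT (fun x y => '[x, y]).
have st : sesquilinear t.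
  split=> //= d y z w _ _ _; by rewrite !ipE.
have [c y ty|d hd] := dual_basis st (fun i => I) ie.
  by apply: nsq_eq0; move: ty; rewrite /t /= ip_nsq => -[].
have Le i : L (e i) by have [c ->] := basis_in e i; rewrite LE; exists c.
pose f k := \sum_j d k j *: e j.
have hf i k : '[e i, f k] = (i == k)%:R := hd i k.
exists (\sum_k '[x, e k] *: f k).
  by apply: lsub_sum => // k; apply: lsub_sum.
move=> z; rewrite LE => -[c ->]; rewrite ip_sumr big1 // => i _.
rewrite ipZr ipBl ip_suml (bigD1 i) //= big1 => [|k /negbTE ki].
  by rewrite ipZl (ipC (f i)) hf eqxx rmorph1 mulr1 addr0 subrr mulr0.
by rewrite ipZl (ipC (f k)) hf eq_sym ki rmorph0 mulr0.
Qed.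

(** There are n coefficients against m < n linear conditions. All later comparisons of indices and
    both halves of the variational principles rest on this vector. *)
Lemma orth_vector L L' n m : has_dim L n -> has_dim L' m -> (m < n)%N ->
  exists x, [/\ L x, x != 0 & forall z, L' z -> '[x, z] = 0].
Proof.
move=> [e [ie LE]] [e' [_ LE']] mn.
have [c c0 hc] := kernel_vector (fun i j => '[e i, e' j]) mn.
exists (\sum_i c i *: e i); split; first by rewrite LE; exists c.
  exact: comb_neq0.
move=> z; rewrite LE' => -[d ->]; rewrite ip_sumr big1 // => j _.
rewrite ipZr ip_suml; under eq_bigr do rewrite ipZl.
by rewrite hc mulr0.
Qed.

Lemma has_dim_le L L' n m : has_dim L n -> has_dim L' m -> L `<=` L' -> (n <= m)%N.
Proof.
move=> hL hL' LL'; rewrite leqNgt; apply/negP => /(orth_vector hL hL')[x [Lx x0 hx]].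
by move: x0; rewrite (nsq_eq0 (x := x)) ?eqxx //; have := hx x (LL' _ Lx); rewrite ip_nsq => -[].
Qed.

Lemma has_dim_uniq L n m : has_dim L n -> has_dim L m -> n = m.
Proof. by move=> h1 h2; apply/eqP; rewrite eqn_leq !(has_dim_le h1 h2, has_dim_le h2 h1). Qed.

Lemma has_dim_shrink L n k : has_dim L n -> (k <= n)%N -> exists2 L', L' `<=` L & has_dim L' k.
Proof.
move=> hL kn; have [[j jk hj]|//] := dim_dichotomy k (has_dim_sub hL).
by rewrite (has_dim_uniq hL hj) leqNgt jk in kn.
Qed.

(** From above: n + m + 1 independent vectors of the sum would have a nonzero combination orthogonal
    to both bases, hence to itself. From below: the concatenated bases are independent by
    orthogonality. *)
Lemma has_dim_add L L' n m : has_dim L n -> has_dim L' m ->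
  (forall x y, L x -> L' y -> '[x, y] = 0) ->
  has_dim [set z | exists2 x, L x & exists2 y, L' y & z = x + y] (n + m).
Proof.
move=> hL hL' orth; have sL := has_dim_sub hL; have sL' := has_dim_sub hL'.
set W := [set z | _].
have sW : lin_subspace W.
  split; first by exists 0; [case: sL | exists 0; [case: sL' | rewrite addr0]].
  move=> d _ _ [x Lx [y Ly ->]] [x' Lx' [y' Ly' ->]].
  exists (d *: x + x'); first exact: sL.2.
  by exists (d *: y + y'); [exact: sL'.2 | rewrite scalerDr addrACA].
have up : ~ exists2 L1, L1 `<=` W & has_dim L1 (n + m).+1.
  move=> [L1 L1W [f [inf LE]]].
  have L1f i : W (f i) by apply: L1W; rewrite LE; exact: basis_in.
  move: (hL) (hL') => [e [ie LeE]] [e' [ie' LeE']].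
  have [c c0 hc] := @kernel_vector R (n + m).+1 (n + m)
    (fun i j => match fintype.split j with inl k => '[f i, e k] | inr k => '[f i, e' k] end) (ltnSn _).
  have xn0 := comb_neq0 inf c0; set x := \sum_i _ in xn0.
  have Wx : W x by apply: lsub_sum.
  have h1 k : '[x, e k] = 0.
    rewrite ip_suml; under eq_bigr do rewrite ipZl.
    by have := hc (lshift m k); case: fintype.splitP => j /=; [move=> /ord_inj <- | move=> hk; have := ltn_ord k; rewrite hk ltnNge leq_addr].
  have h2 k : '[x, e' k] = 0.
    rewrite ip_suml; under eq_bigr do rewrite ipZl.
    have := hc (rshift n k); case: fintype.splitP => j /=; last by move=> /addnI/ord_inj <-.
    by move=> hk; have := ltn_ord j; rewrite -hk ltnNge leq_addr.
  have o1 z : L z -> '[x, z] = 0.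
    rewrite LeE => -[d ->]; rewrite ip_sumr big1 // => j _; by rewrite ipZr h1 mulr0.
  have o2 z : L' z -> '[x, z] = 0.
    rewrite LeE' => -[d ->]; rewrite ip_sumr big1 // => j _; by rewrite ipZr h2 mulr0.
  have [u Lu [v Lv xE]] := Wx.
  by case/eqP: xn0; apply: nsq_eq0; rewrite nsqE /rip {2}xE ipDr o1 // o2 // addr0.
have [[j jn hj]|//] := dim_dichotomy (n + m).+1 sW.
suff : (n + m <= j)%N by move: jn; rewrite ltnS => jn /(conj jn)/andP; rewrite -eqn_leq => /eqP <-.
move: (hL) (hL') => [e [ie LE]] [e' [ie' LE']].
pose g (i : 'I_(n + m)) := match fintype.split i with inl k => e k | inr k => e' k end.
have gE (c : 'I_(n + m) -> R[i]) : \sum_i c i *: g i =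
    \sum_i c (lshift m i) *: e i + \sum_i c (rshift n i) *: e' i.
  rewrite big_split_ord /=; congr (_ + _); apply: eq_bigr => i _; congr (_ *: _); rewrite /g.
    case: fintype.splitP => k /=; first by move=> /ord_inj <-.
    by move=> hk; have := ltn_ord i; rewrite hk ltnNge leq_addr.
  case: fintype.splitP => k /=; last by move=> /addnI/ord_inj <-.
  by move=> hk; have := ltn_ord k; rewrite -hk ltnNge leq_addr.
have hg : has_dim [set x | exists c : 'I_(n + m) -> R[i], x = \sum_i c i *: g i] (n + m).
  exists g; split=> // c; rewrite gE; set u := \sum_i _; set v := \sum_i _ => uv.
  have Lu : L u by rewrite LE; exists (fun i => c (lshift m i)).
  have Lv : L' v by rewrite LE'; exists (fun i => c (rshift n i)).
  have u0 : u = 0.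
    apply: nsq_eq0; rewrite nsqE /rip; have := orth _ _ Lu Lv.
    by move/eqP: uv; rewrite addr_eq0 => /eqP {3}-> h; rewrite ipNr h oppr0.
  have v0 : v = 0 by move: uv; rewrite u0 add0r.
  move=> i; rewrite -(fintype.splitK i); case: (fintype.split i) => k /=; first exact: ie u0 k.
  exact: ie' v0 k.
apply: has_dim_le hg hj _ => x [c ->]; rewrite gE.
eexists; last eexists; last reflexivity; first by rewrite LE; eexists.
by rewrite LE'; eexists.
Qed.

End FormsOnFiniteDim.

(** * The Schur complement *)

Section Adjoint.
Variables (R : realType) (H K : hilbertType R) (B : op H K).
Hypothesis B_dense : densely_defined B.

Lemma adjointP x : dom (adjoint B) x -> forall y, dom B y -> '[B y, x] = '[y, adjoint B x].
Proof.
by move=> [f /= hf] y By; rewrite /=; case: xgetP => [g -> /= hg|/(_ f)//]; apply: hg.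
Qed.

Lemma adjoint_uniq x f : (forall y, dom B y -> '[B y, x] = '[y, f]) ->
  dom (adjoint B) x /\ adjoint B x = f.
Proof.
move=> hf; have dx : dom (adjoint B) x by exists f.
split=> //; apply: (dense_ip_eq B_dense) => y By.
by rewrite ipC -(adjointP dx) // hf // -ipC.
Qed.

Lemma adjoint_lin d x y : dom (adjoint B) x -> dom (adjoint B) y ->
  adjoint B (d *: x + y) = d *: adjoint B x + adjoint B y.
Proof.
move=> dx dy; have [] // := @adjoint_uniq (d *: x + y) (d *: adjoint B x + adjoint B y).
by move=> z Bz; rewrite !ipE !adjointP.
Qed.
End Adjoint.
Arguments adjoint : simpl never.

Section OpOf.
Variables (R : realType) (V W : normedModType R[i]).
Lemma op_of_graph (G : set (V * W)) : (forall x y y', G (x, y) -> G (x, y') -> y = y') ->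
  graph_op (op_of G) = G.
Proof.
move=> uG; apply/seteqP; split=> -[x y] /=.
  move=> [[y' Gxy']] /= <-; by case: xgetP => [z -> //|/(_ y')].
move=> Gxy; split; first by exists y.
by rewrite /=; case: xgetP => [z -> hz|/(_ y)//]; apply: uG hz Gxy.
Qed.
End OpOf.

Section SpectralLowerBound.
Variables (R : realType) (H : hilbertType R) (t : sform R H) (c delta : R).
Hypothesis ct : cform t c.
Hypothesis solve : forall r, r < delta -> exists C : R, forall v, exists2 w, fdom t w &
  (forall z, fdom t z -> rt t w z - r * rip w z = rip v z) /\ normsq w <= C * normsq v.

(** Let m <= delta be the best lower bound and suppose m < delta. If w solves (t - m)(w, .) = <y,
    .>, Cauchy-Schwarz for t - m gives |y|^4 <= <y, w> (t - m)[y]. Since |w| is bounded by |y|, m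
    can be raised, a contradiction. *)
Lemma form_lower x : fdom t x -> delta * normsq x <= quad t x.
Proof.
pose P r := forall y, fdom t y -> r * normsq y <= quad t y.
pose S := [set r | P r /\ r <= delta].
have P0 : P (Num.min (1 - c) delta).
  move=> y Vy; apply: le_trans (cf_low ct Vy); apply: ler_wpM2r; first exact: nsq_ge0.
  by rewrite ge_min lexx.
have hS : has_sup S.
  split; first by exists (Num.min (1 - c) delta); split=> //; rewrite ge_min lexx orbT.
  by exists delta => r [].
pose m := sup S.
have Pm : P m.
  move=> y Vy; apply/ler_addgt0Pr => e e0; have n0 := nsq_ge0 y.
  have d0 : 0 < e / (normsq y + 1) by rewrite divr_gt0 //; lra.
  have [r [Pr _] hr] := sup_adherent d0 hS; have := Pr _ Vy.
  have : e / (normsq y + 1) * (normsq y + 1) = e by rewrite mulfVK // gt_eqF //; lra.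
  rewrite -/m in hr; set d := e / _ in hr d0 *; nra.
suff dm : delta <= m.
  by move=> Vx; apply: le_trans (Pm _ Vx); apply: ler_wpM2r dm; apply: nsq_ge0.
rewrite leNgt; apply/negP => md; have [C hC] := solve md.
pose b y z := rt t y z - m * rip y z.
have pb : posform (fdom t) b.
  split=> [|r y z Vy Vz|r y z w Vy Vz Vw|y z Vy Vz|y Vy].
  - exact: (cf_sesq ct).1.1.
  - exact: (cf_sesq ct).1.2.
  - by rewrite /b /rt ((cf_sesq ct).2 _ _ _ _ Vy Vz Vw).1 ReD ReMr !ripE; ring.
  - by rewrite /b (rt_sym ct) // ripC.
  - by rewrite /b -nsqE; have := Pm _ Vy; rewrite /quad /rt; lra.
(* From <y, w> <= (|y|^2 + |w|^2) / 2 and |w|^2 <= C |y|^2. *)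
pose C1 := (1 + `|C|) / 2.
have C10 : 0 < C1 by rewrite /C1; have := normr_ge0 C; lra.
have key : P (m + C1^-1).
  move=> y Vy; have [w Vw [hw nw]] := hC y.
  have := pf_CS pb Vw Vy; rewrite {1 2}/b hw // hw // -nsqE.
  have hbw : rip y w <= C1 * normsq y.
    have := rip_young y w ltr01; rewrite invr1 /C1; have := ler_norm C; have := nsq_ge0 y; nra.
  have b0 := pf_ge0 pb Vy.
  have bE : b y y = quad t y - m * normsq y by rewrite /b nsqE.
  move=> h; suff : C1^-1 * normsq y <= b y y by rewrite bE; lra.
  rewrite mulrC ler_pdivrMr //; have n0 := nsq_ge0 y.
  have [n1|n1] := eqVneq (normsq y) 0; first by rewrite n1 mulr_ge0 // ltW.
  have n2 : 0 < normsq y by rewrite lt_def n1.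
  rewrite -(ler_pM2l n2); have := ler_wpM2r b0 hbw; rewrite expr2 in h; lra.
have : S (Num.min (m + C1^-1) delta).
  split; last by rewrite ge_min lexx orbT.
  move=> y Vy; apply: le_trans (key _ Vy); apply: ler_wpM2r; first exact: nsq_ge0.
  by rewrite ge_min lexx.
move=> /(ub_le_sup hS.2); rewrite -/m leNgt lt_min md andbT ltrDl invr_gt0 C10 //.
Qed.
End SpectralLowerBound.

Section SchurForm.
Variables (R : realType) (H1 H2 : hilbertType R).
Variables (B : op H2 H1) (D : op H2 H2) (fa : sform R H1) (fd : sform R H2).
Variables (ca cd dplus a b : R).
Hypothesis B_dense : densely_defined B.
Hypothesis cfa : cform fa ca.
Hypothesis cfd : cform (opp_form fd) cd.
Hypothesis fdD : graph_op (op_of_form (opp_form fd)) = graph_op (opp_op D).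
Hypothesis D_spec : forall r : R, dplus < r -> resolvent_set D r%:C.
Hypothesis fa_sub : fdom fa `<=` dom (adjoint B).
Hypothesis b_ge0 : 0 <= b.
Hypothesis ab_bound : forall x, fdom fa x ->
  normsq (adjoint B x) <= a * normsq x + b * quad fa x.

Local Notation Bs := (adjoint B : H1 -> H2).
Local Notation V := (fdom fa).

(** This is (l - D)^-1, with the sign that makes it positive for l > [dplus]. Its properties come
    from the weak equation [Rl_E]. *)
Definition Rl (l : R) (v : H2) : H2 := - inv_op (shift_op D l%:C) v.

Lemma D_form y f : dom D y /\ D y = f <->
  fdom fd y /\ forall z, fdom fd z -> rt fd y z = rip f z.
Proof.
have e : dom D y /\ D y = f <-> graph_op (opp_op D) (y, - f).
  split=> -[/= dy h]; split => //=; first by rewrite h.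
  by apply: oppr_inj.
rewrite e -fdD (form_opP cfd); split=> -[/= h1 h2]; split=> // z Vz; have := h2 _ Vz.
  by rewrite /rt ReN ripNl => /oppr_inj.
by rewrite /rt ReN ripNl => ->.
Qed.

Lemma RlP l v : dplus < l -> dom D (Rl l v) /\ l%:C *: Rl l v - D (Rl l v) = v.
Proof.
move=> /D_spec[h _]; have [x [[dx hx] ux]] := h v.
have -> : Rl l v = - x.
  rewrite /Rl; congr (- _); rewrite /inv_op /=; case: xgetP => [y -> [/= dy hy]|/(_ x) hn].
    by apply/esym/ux.
  by exfalso; apply: hn.
have /D_form[Vx rx] : dom D x /\ D x = v + l%:C *: x.
  by split=> //; rewrite -hx /shift_op /= subrK.
have [d1 d2] : dom D (- x) /\ D (- x) = - (v + l%:C *: x).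
  apply/D_form; split=> [|z Vz].
    by rewrite -scaleN1r; exact: (cf_VZ cfd (-1) Vx).
  have Vx' : fdom (opp_form fd) x := Vx.
  have := cf_Zl cfd (-1) Vx' (Vz : fdom (opp_form fd) z).
  rewrite scaleN1r /= mulN1r opprK => e; rewrite /rt ripNl -rx //.
  by rewrite -[fd (- x) z]opprK e /rt ReN.
split=> //; rewrite d2; apply: rip_ext => z; rewrite !ripE; ring.
Qed.

(* The form of l - D. *)
Definition ed (l : R) (y z : H2) : R := l * rip y z - rt fd y z.

Lemma Rl_form l v : dplus < l -> fdom fd (Rl l v) /\
  forall z, fdom fd z -> ed l (Rl l v) z = rip v z.
Proof.
move=> hl; have [dw hw] := RlP v hl.
have /D_form[Vw rw] := conj dw (erefl (D (Rl l v))).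
by split=> // z Vz; rewrite /ed rw // -{3}hw !ripE; ring.
Qed.

Lemma Rl_V l v : dplus < l -> fdom fd (Rl l v).
Proof. by move=> /(Rl_form v)[]. Qed.
Lemma Rl_E l v z : dplus < l -> fdom fd z -> ed l (Rl l v) z = rip v z.
Proof. by move=> /(Rl_form v)[_]; apply. Qed.

Lemma rt_opp y z : rt (opp_form fd) y z = - rt fd y z.
Proof. by rewrite /rt /= ReN. Qed.

(** Only the resolvent set beyond [dplus] is known; [form_lower] for the form -d turns the resolvent
    bounds into a form bound. *)
Lemma d_le y : fdom fd y -> quad fd y <= dplus * normsq y.
Proof.
move=> Vy; have := @form_lower _ _ _ _ (- dplus) cfd _ y Vy.
have -> : quad (opp_form fd) y = - quad fd y by rewrite /quad /= ReN.
move=> h; suff : - dplus * normsq y <= - quad fd y by lra.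
apply: h => r rd; have rd' : dplus < - r by lra.
have [_ [C hC]] := D_spec rd'.
exists (C ^+ 2) => v; have [dw hw] := RlP v rd'.
exists (Rl (- r) v); first exact: Rl_V.
split=> [z Vz|]; first by have := Rl_E v rd' Vz; rewrite /ed rt_opp; lra.
have := hC _ dw; have -> : shift_op D (- r)%:C (Rl (- r) v) = - v.
  by rewrite /shift_op /= -[in RHS]hw opprB.
rewrite !normE -rmorphM lecR (nsqN v) => h2.
have C0 : 0 <= C * Num.sqrt (normsq v) by apply: le_trans h2; exact: sqrtr_ge0.
rewrite -[leLHS]sqr_sqrtr ?nsq_ge0 // -[normsq v]sqr_sqrtr ?nsq_ge0 // -exprMn.
by rewrite ler_pXn2r ?nnegrE ?sqrtr_ge0.
Qed.

Lemma pf_ed l : dplus <= l -> posform (fdom fd) (ed l).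
Proof.
move=> hl; split=> [|r y z Vy Vz|r y z w Vy Vz Vw|y z Vy Vz|y Vy].
- exact: (cf_sesq cfd).1.1.
- exact: (cf_sesq cfd).1.2.
- have := congr1 (@complex.Re R) ((cf_sesq cfd).2 r%:C y z w Vy Vz Vw).1.
  by rewrite /= ReD ReMr !ReN /ed /rt !ripE; lra.
- rewrite /ed ripC; congr (_ - _); apply: oppr_inj; rewrite -!rt_opp.
  exact: (rt_sym cfd).
- by rewrite /ed -nsqE; have := d_le Vy; have := nsq_ge0 y; rewrite /quad /rt; nra.
Qed.

Lemma ed_ge l y : fdom fd y -> (l - dplus) * normsq y <= ed l y y.
Proof. by move=> Vy; rewrite /ed -nsqE; have := d_le Vy; rewrite /quad /rt; lra. Qed.

Lemma Rl_coer l v : dplus < l -> (l - dplus) * normsq (Rl l v) <= rip (Rl l v) v.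
Proof.
move=> hl; rewrite ripC -(Rl_E v hl (Rl_V v hl)); exact: ed_ge (Rl_V v hl).
Qed.
Lemma Rl_ge0 l v : dplus < l -> 0 <= rip (Rl l v) v.
Proof.
move=> hl; apply: le_trans (Rl_coer v hl); rewrite mulr_ge0 ?nsq_ge0 //; lra.
Qed.
Lemma Rl_nsq l v : dplus < l -> (l - dplus) ^+ 2 * normsq (Rl l v) <= normsq v.
Proof.
move=> hl; have := Rl_coer v hl; have hl' : 0 < l - dplus by lra.
have := rip_young (Rl l v) v hl'; set q := (_ - _) in hl' *; set n := normsq (Rl l v).
move=> h1 h2; have h3 : q * n <= q^-1 * normsq v by lra.
by move: h3; rewrite -(ler_pM2l hl') mulrA -expr2 mulrA mulfV ?mul1r // gt_eqF.
Qed.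
Lemma Rl_rip_le l v : dplus < l -> (l - dplus) * rip (Rl l v) v <= normsq v.
Proof.
move=> hl; have hl' : 0 < l - dplus by lra.
have := rip_young (Rl l v) v hl'; have := Rl_nsq v hl; set q := (_ - _) in hl' *; set n := normsq (Rl l v).
move=> h1 h2; have e : q * q^-1 = 1 by rewrite mulfV // gt_eqF.
have : q * (2 * rip (Rl l v) v) <= q * (q * n + q^-1 * normsq v) by rewrite ler_pM2l.
rewrite mulrDr !mulrA e mul1r -expr2; lra.
Qed.

Lemma Rl_uniq l v w : dplus < l -> fdom fd w ->
  (forall z, fdom fd z -> ed l w z = rip v z) -> Rl l v = w.
Proof.
move=> hl Vw hw; have pe := pf_ed (ltW hl); have Vd := pf_VB pe (Rl_V v hl) Vw.
apply/eqP; rewrite -subr_eq0; apply/eqP/nsq_eq0.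
have := ed_ge l Vd; rewrite (pf_Bl pe) ?Rl_E ?hw ?subrr //; try exact: Rl_V.
have := nsq_ge0 (Rl l v - w); move=> h1 h2.
by apply/eqP; rewrite eq_le h1 andbT; nra.
Qed.

Lemma Rl_lin l d u v : dplus < l -> Rl l (d *: u + v) = d *: Rl l u + Rl l v.
Proof.
move=> hl; have pe := pf_ed (ltW hl).
have rD x y : Rl l (x + y) = Rl l x + Rl l y.
  apply: Rl_uniq => // [|z Vz]; first by apply: (pf_VD pe); apply: Rl_V.
  by rewrite (pf_Dl pe) ?Rl_E ?ripDl //; apply: Rl_V.
have rZ r x : Rl l (r%:C *: x) = r%:C *: Rl l x.
  apply: Rl_uniq => // [|z Vz]; first by apply: (pf_VZ pe); apply: Rl_V.
  by rewrite (pf_Zl pe) ?Rl_E ?ripZl //; apply: Rl_V.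
have ri x : Rl l ('i *: x) = 'i *: Rl l x.
  have Vx := Rl_V x hl; have Vix : fdom fd ('i *: Rl l x) := cf_VZ cfd 'i Vx.
  apply: Rl_uniq => // z Vz; have Viz : fdom fd ('i *: z) := cf_VZ cfd 'i Vz.
  have := Rl_E x hl Viz; rewrite /ed !rip_iC.
  have := rt_il cfd (Vx : fdom (opp_form fd) _) (Vz : fdom (opp_form fd) z); rewrite !rt_opp.
  lra.
by rewrite rD scaleriE rD !rZ ri -scaleriE.
Qed.

Lemma Rl_sym l u v : dplus < l -> rip (Rl l u) v = rip u (Rl l v).
Proof.
move=> hl; rewrite ripC -(Rl_E v hl (Rl_V u hl)) -(Rl_E u hl (Rl_V v hl)).
by rewrite (pf_sym (pf_ed (ltW hl))) //; apply: Rl_V.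
Qed.

(** The first resolvent identity, read off from two forms that differ by l' - l times the inner
    product. *)
Lemma Rl_diff l l' v : dplus < l -> dplus < l' ->
  rip (Rl l v) v - rip (Rl l' v) v = (l' - l) * rip (Rl l v) (Rl l' v).
Proof.
move=> hl hl'; have Vw := Rl_V v hl; have Vw' := Rl_V v hl'.
rewrite (ripC _ v) (ripC _ v) -(Rl_E v hl Vw') -(Rl_E v hl' Vw).
rewrite (pf_sym (pf_ed (ltW hl))) // /ed (ripC (Rl l v)); ring.
Qed.

(** With w = R_l' v, evaluating the form of l' - D at w and R_l w shows that the product equals
    |w|^2 + (l' - l) <w, R_l w>. *)
Lemma Rl_pos2 l l' v : dplus < l -> l <= l' -> 0 <= rip (Rl l v) (Rl l' v).
Proof.
move=> hl ll'; have hl' : dplus < l' by lra.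
rewrite Rl_sym // -(Rl_E v hl' (Rl_V _ hl)); set w := Rl l' v.
have := Rl_E w hl (Rl_V v hl'); rewrite -/w => _.
have e : ed l' w (Rl l w) = ed l w (Rl l w) + (l' - l) * rip w (Rl l w).
  by rewrite /ed; ring.
rewrite e (pf_sym (pf_ed (ltW hl))) ?Rl_E //; try exact: Rl_V.
rewrite -nsqE addr_ge0 ?nsq_ge0 // mulr_ge0 ?subr_ge0 // ripC; exact: Rl_ge0.
Qed.

Lemma Bs_lin d x y : V x -> V y -> Bs (d *: x + y) = d *: Bs x + Bs y.
Proof. by move=> Vx Vy; apply: adjoint_lin => //; apply: fa_sub. Qed.

Lemma schur_val l x y : schur_form B D fa l x y =
  fa x y - l%:C * '[x, y] - '[Rl l (Bs x), Bs y].
Proof. by rewrite /= /Rl ipNl opprK. Qed.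

Lemma schur_quad l x : quad (schur_form B D fa l) x =
  quad fa x - l * normsq x - rip (Rl l (Bs x)) (Bs x).
Proof. by rewrite /quad schur_val !ReD !ReN ReMr ip_nsq. Qed.

Lemma schur_rt l x y : rt (schur_form B D fa l) x y =
  rt fa x y - l * rip x y - rip (Rl l (Bs x)) (Bs y).
Proof. by rewrite /rt schur_val !ReD !ReN ReMr. Qed.

Lemma schur_sesq l : dplus < l -> sesquilinear (schur_form B D fa l).
Proof.
move=> hl; split=> [|d x y z Vx Vy Vz]; first exact: (cf_sesq cfa).1.
have [e1 e2] := (cf_sesq cfa).2 d _ _ _ Vx Vy Vz.
rewrite !schur_val e1 e2 Bs_lin // Rl_lin // !ipE; split; ring.
Qed.

Lemma schur_sym l : dplus < l -> Defs.symmetric_form (schur_form B D fa l).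
Proof.
move=> hl x y Vx Vy; rewrite !schur_val (cf_sym cfa Vx Vy) !rmorphB rmorphM /=.
rewrite -!ipC conjr; congr (_ - _ - _).
apply: ip_rip; first exact: Rl_sym.
have := Rl_lin 'i (Bs y) 0 hl; have := Rl_lin 1 0 0 hl.
rewrite scaler0 addr0 scale1r -[LHS]addr0 => /addrI/esym ->; rewrite !addr0.
by rewrite Rl_sym // => ->.
Qed.

Lemma schur_le l x : dplus < l -> quad (schur_form B D fa l) x <= quad fa x - l * normsq x.
Proof. by move=> hl; rewrite schur_quad; have := Rl_ge0 (Bs x) hl; lra. Qed.

(** By <R_l v, v> <= |v|^2 / (l - [dplus]), the term subtracted from a - l has relative form bound b
    / (l - [dplus]), less than one exactly when l > [dplus] + b. Hence that summand of [mu]. *)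
Lemma schur_ge l x : dplus + b < l -> V x ->
  (1 - b / (l - dplus)) * quad fa x - (l + `|a| / (l - dplus)) * normsq x <=
  quad (schur_form B D fa l) x.
Proof.
move=> hl Vx; have hl' : dplus < l by apply: le_lt_trans hl; rewrite lerDl.
rewrite schur_quad; have := Rl_rip_le (Bs x) hl'; have := ab_bound Vx.
have q0 : 0 < l - dplus by lra.
set q := l - dplus in q0 *; set r := rip _ _ => h1 h2.
have h3 : r <= (a * normsq x + b * quad fa x) / q.
  by rewrite ler_pdivlMr //; lra.
have h4 : a * normsq x / q <= `|a| / q * normsq x.
  rewrite mulrAC; apply: ler_wpM2r; first exact: nsq_ge0.
  by rewrite ler_pM2r ?invr_gt0 // ler_norm.
move: h3; rewrite mulrDl; have -> : b * quad fa x / q = b / q * quad fa x by ring.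
lra.
Qed.

(** The forms a and s_l bound each other up to multiples of the squared norm, so closedness carries
    over in both of its clauses. *)
Lemma schur_cform l : dplus + b < l -> exists c, cform (schur_form B D fa l) c.
Proof.
move=> hl; have hl' : dplus < l by apply: le_lt_trans hl; rewrite lerDl.
have q0 : 0 < l - dplus by lra.
pose k := 1 - b / (l - dplus); pose m := l + `|a| / (l - dplus).
have k0 : 0 < k by rewrite subr_gt0 ltr_pdivrMr //; lra.
have lo x : V x -> k * quad fa x - m * normsq x <= quad (schur_form B D fa l) x.
  exact: schur_ge.
have sV : lin_subspace V := (cf_sesq cfa).1.
(* s_l >= k a - m >= k (1 - ca) - m, put into the shape 1 - c of [cf_low]. *)
exists (1 - (k * (1 - ca) - m)); split.
- exact: schur_sesq.
- exact: schur_sym.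
- move=> x Vx; have := lo _ Vx; have := cf_low cfa Vx; nra.
- move=> u x Vu ux hu; have cx := (cvsP _ _).1 ux.
  have VB i j : V (u i - u j) := lin_subspaceB sV (Vu i) (Vu j).
  have [] := cf_closed cfa Vu ux.
    move=> e e0; pose M := `|m| + `|l| + `|1 - ca| + 1.
    have M1 : 1 <= M by rewrite /M lerDr !addr_ge0.
    have d1 : 0 < e * k / 4 by rewrite divr_gt0 // mulr_gt0.
    have d2 : 0 < e * Num.min k 1 / (4 * M).
      by rewrite divr_gt0 ?mulr_gt0 ?lt_min ?k0 ?ltr01 //; lra.
    have [N1 hN1] := hu _ d1; have [N2 hN2] := cvs_cauchys cx d2.
    exists (maxn N1 N2) => i j; rewrite !geq_max => /andP[i1 i2] /andP[j1 j2].
    have := hN1 _ _ i1 j1; have := hN2 _ _ i2 j2.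
    have h3 := lo _ (VB i j); have h4 := cf_low cfa (VB i j).
    set w := u i - u j in h3 h4 *; have n0 := nsq_ge0 w.
    rewrite ltr_pdivlMr; last lra.
    have mk : Num.min k 1 <= k by rewrite ge_min lexx.
    have m1 : Num.min k 1 <= 1 by rewrite ge_min lexx orbT.
    have am := ler_norm m; have aca := ler_norm (- (1 - ca)); rewrite normrN in aca.
    have a1 := normr_ge0 m; have a2 := normr_ge0 l; have a3 := normr_ge0 (1 - ca).
    rewrite !ltr_norml => g1 /andP[g2 g3].
    have nM : normsq w * (4 * `|m|) <= normsq w * (4 * M).
      by apply: ler_wpM2l => //; rewrite /M; lra.
    have nM2 : normsq w * (4 * `|1 - ca|) <= normsq w * (4 * M).
      by apply: ler_wpM2l => //; rewrite /M; lra.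
    have ek : e * Num.min k 1 <= e * k by rewrite ler_pM2l.
    have ek1 : e * Num.min k 1 <= e by rewrite ler_piMr // ltW.
    have mn : m * normsq w <= `|m| * normsq w by apply: ler_wpM2r.
    have cn : - (1 - ca) * normsq w <= `|1 - ca| * normsq w by apply: ler_wpM2r.
    have up : k * quad fa w < k * e by lra.
    rewrite ltr_pM2l // in up; apply/andP; split; lra.
  move=> Vx /(@cvgrPdist_lt _ R) hq; split=> //.
  have VBx j : V (u j - x) := lin_subspaceB sV (Vu j) Vx.
  apply/(@cvgrPdist_lt _ R) => e e0.
  pose M := `|m| + `|l| + `|k| + 1.
  have Mk : 1 <= M by rewrite /M lerDr !addr_ge0.
  have d0 : 0 < e / (4 * M) by rewrite divr_gt0 //; lra.
  have [N1 _ hN1] := hq _ d0; have [N2 hN2] := cx _ d0.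
  exists (maxn N1 N2) => // j; rewrite /= geq_max => /andP[/hN1 /= g1 /hN2 g2].
  have h3 := lo _ (VBx j); have h4 := schur_le (u j - x) hl'.
  move: g1 g2 h3 h4; set w := u j - x; have n0 := nsq_ge0 w.
  rewrite !sub0r !normrN; set qa := quad fa w; set qs := quad _ w.
  rewrite !ltr_pdivlMr; try lra.
  move=> g1 g2 h3 h4.
  have a1 := normr_ge0 m; have a2 := normr_ge0 l; have a3 := normr_ge0 k.
  have am := ler_norm m; have al := ler_norm (- l); rewrite normrN in al.
  have ak := ler_norm k; have aq := ler_norm qa; have aq' := ler_norm (- qa); rewrite normrN in aq'.
  have aq0 := normr_ge0 qa.
  have p1 : `|m| * normsq w <= M * normsq w by apply: ler_wpM2r => //; rewrite /M; lra.
  have p2 : `|l| * normsq w <= M * normsq w by apply: ler_wpM2r => //; rewrite /M; lra.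
  have p3 : `|k| * `|qa| <= M * `|qa| by apply: ler_wpM2r => //; rewrite /M; lra.
  have p4 : 1 * `|qa| <= M * `|qa| by apply: ler_wpM2r.
  have p5 : m * normsq w <= `|m| * normsq w by apply: ler_wpM2r.
  have p6 : - l * normsq w <= `|l| * normsq w by apply: ler_wpM2r.
  have p7 : k * - qa <= `|k| * `|qa|.
    by apply: le_trans (_ : k * `|qa| <= _); [rewrite ler_pM2l | apply: ler_wpM2r].
  rewrite ltr_norml; apply/andP; split; lra.
- exact: cf_dense cfa.
Qed.

End SchurForm.

(** * Dependence of the Schur form on l, and its relation to lambda_+ *)

Section SchurMonotone.
Variables (R : realType) (H1 H2 : hilbertType R).
Variables (B : op H2 H1) (D : op H2 H2) (fa : sform R H1) (fd : sform R H2).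
Variables (ca cd dplus a b : R).
Hypothesis B_dense : densely_defined B.
Hypothesis cfa : cform fa ca.
Hypothesis cfd : cform (opp_form fd) cd.
Hypothesis fdD : graph_op (op_of_form (opp_form fd)) = graph_op (opp_op D).
Hypothesis D_spec : forall r : R, dplus < r -> resolvent_set D r%:C.
Hypothesis fa_sub : fdom fa `<=` dom (adjoint B).
Hypothesis b_ge0 : 0 <= b.
Hypothesis ab_bound : forall x, fdom fa x ->
  normsq (adjoint B x) <= a * normsq x + b * quad fa x.

Local Notation Bs := (adjoint B : H1 -> H2).
Local Notation V := (fdom fa).
Local Notation s l := (schur_form B D fa l).
Local Notation Rl := (Rl D).
Local Notation mu := (dplus + b + Num.sqrt (Num.max (b * dplus + b ^+ 2 + a) 0)).

(** Removes the square root and the maximum: [mu] acts below only through these polynomial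
    inequalities. *)
Lemma mu_dist l : mu < l -> dplus + b < l /\ b * dplus + b ^+ 2 + a < (l - dplus - b) ^+ 2.
Proof.
move=> hl; set Q := _ + a in hl *; have s0 := sqrtr_ge0 (Num.max Q 0).
have h : Num.sqrt (Num.max Q 0) < l - dplus - b by lra.
split; first lra.
apply: le_lt_trans (_ : Num.max Q 0 < _); first by rewrite le_max lexx.
rewrite -[ltLHS]sqr_sqrtr ?le_max ?lexx ?orbT //.
by rewrite ltr_pXn2r ?nnegrE //; lra.
Qed.

Lemma mu_dplus l : mu < l -> dplus < l.
Proof. by move=> /mu_dist[h _]; apply: le_lt_trans h; rewrite lerDl. Qed.

Lemma mu_cform l : mu < l -> exists c, cform (s l) c.
Proof.
move=> /mu_dist[h _].
exact: (schur_cform B_dense cfa cfd fdD D_spec fa_sub b_ge0 ab_bound h).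
Qed.

(** The assumption bounds a[x] by (l + e) |x|^2 + <R_l v, v> for v = B^* x, and <R_l v, v> <= |v|^2
    / (l - [dplus]). Inserted into [ab_bound], the |v|^2 on the right is absorbed because l -
    [dplus] > b. *)
Lemma Bs_small l (e : R) x : mu < l -> V x -> quad (s l) x <= e * normsq x ->
  (l - dplus - b) * normsq (Bs x) <= (l - dplus) * (a + b * l + b * e) * normsq x.
Proof.
move=> hl Vx; have [hl1 _] := mu_dist hl; have hl2 := mu_dplus hl.
rewrite schur_quad => h; have := Rl_rip_le cfd fdD D_spec (Bs x) hl2; have := ab_bound Vx.
set m := normsq (Bs x); set r := rip _ _ in h *; set q := l - dplus in hl1 *.
move=> h1 h2; have q0 : 0 < q by rewrite /q; lra.
have h3 : q * m <= q * (a * normsq x + b * quad fa x) by rewrite ler_pM2l.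
have h4 : b * quad fa x <= b * ((l + e) * normsq x + r) by apply: ler_wpM2l => //; lra.
have h5 : q * (b * quad fa x) <= q * (b * ((l + e) * normsq x + r)) by rewrite ler_pM2l.
have h6 : b * (q * r) <= b * m by apply: ler_wpM2l.
lra.
Qed.

Lemma schur_step l l' x : dplus < l -> dplus < l' -> quad (s l') x =
  quad (s l) x - (l' - l) * (normsq x - rip (Rl l (Bs x)) (Rl l' (Bs x))).
Proof.
move=> hl hl'; have := Rl_diff cfd fdD D_spec (Bs x) hl hl'.
by rewrite !schur_quad; lra.
Qed.

(** The decrease is |x|^2 - <R_l v, R_l' v> per unit of l with a nonnegative product, hence at most
    |x|^2. *)
Lemma schur_up l l' x : dplus < l -> l <= l' ->
  quad (s l) x <= quad (s l') x + (l' - l) * normsq x.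
Proof.
move=> hl ll'; have hl' : dplus < l' by lra.
have := Rl_pos2 cfd fdD D_spec (Bs x) hl ll'; rewrite (schur_step x hl hl').
set r := rip _ _ => r0; have : 0 <= (l' - l) * r by apply: mulr_ge0 => //; lra.
lra.
Qed.

(** The rate of decrease is |x|^2 - <R_l v, R_l' v>, and the product is at most |v|^2 / q^2 with q =
    l - [dplus], whatever l' >= l. [Bs_small] makes this less than (1 - k) |x|^2. *)
Lemma schur_decr l : mu < l -> exists2 e : R, 0 < e & exists2 k : R, 0 < k &
  forall x l', V x -> quad (s l) x <= e * normsq x -> l <= l' ->
    quad (s l') x <= quad (s l) x - k * (l' - l) * normsq x.
Proof.
move=> hl; have [hl1 hl2] := mu_dist hl; have hl3 := mu_dplus hl.
pose q := l - dplus; pose g := (q - b) ^+ 2 - (b * dplus + b ^+ 2 + a).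
have qb : 0 < q - b by rewrite /q; lra.
have q0 : 0 < q by rewrite /q; lra.
have g0 : 0 < g by rewrite subr_gt0.
have qq : 0 < q * (q - b) by apply: mulr_gt0.
(* g is also q (q - b) - (a + b l), the margin provided by l > [mu]. One half of it pays for b e,
   the other becomes k q (q - b). *)
pose e := g / (2 * (b + 1)); pose k := g / (2 * (q * (q - b))).
have b0 : (0 : R) <= b := b_ge0.
have e0 : 0 < e by rewrite divr_gt0 //; lra.
have k0 : 0 < k by rewrite divr_gt0 //; lra.
have be : b * e <= g / 2.
  have : e * (2 * (b + 1)) = g by rewrite /e mulfVK // gt_eqF //; lra.
  lra.
have kq : k * (q * (q - b)) = g / 2.
  by rewrite /k; field; rewrite !gt_eqF.
exists e => //; exists k => // x l' Vx hx ll'; have hl' : dplus < l' by lra.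
have h1 := Bs_small hl Vx hx; rewrite -/q in h1.
rewrite (schur_step x hl3 hl').
set m := normsq (Bs x) in h1; set n := normsq x in h1 *; have n0 : 0 <= n := nsq_ge0 x.
have r1 := Rl_nsq cfd fdD D_spec (Bs x) hl3; rewrite -/q -/m in r1.
have r2 := Rl_nsq cfd fdD D_spec (Bs x) hl'; rewrite -/m in r2.
have r3 := rip_young (Rl l (Bs x)) (Rl l' (Bs x)) ltr01; rewrite invr1 in r3.
set w1 := normsq (Rl l _) in r1 r3; set w2 := normsq (Rl l' _) in r2 r3.
set r := rip _ _ in r3 *.
have w20 : 0 <= w2 := nsq_ge0 _.
have r2' : q ^+ 2 * w2 <= m.
  apply: le_trans r2; apply: ler_wpM2r => //.
  by rewrite ler_pXn2r ?nnegrE /q //; lra.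
have r4 : q ^+ 2 * r <= m.
  have q2 : 0 < q ^+ 2 by apply: exprn_gt0.
  have : q ^+ 2 * (2 * r) <= q ^+ 2 * (w1 + w2) by rewrite ler_pM2l //; lra.
  lra.
have r5 : (q - b) * (q ^+ 2 * r) <= q * ((1 - k) * (q * (q - b))) * n.
  apply: le_trans (_ : (q - b) * m <= _); first by rewrite ler_pM2l.
  apply: le_trans h1 _; apply: ler_wpM2r => //; rewrite ler_pM2l //.
  move: be kq; rewrite /g /q; lra.
have r6 : r <= (1 - k) * n.
  have p0 : 0 < q * (q * (q - b)) by apply: mulr_gt0.
  rewrite -(ler_pM2l p0).
  move: r5; rewrite [leLHS](_ : _ = q * (q * (q - b)) * r); last by ring.
  by rewrite [leRHS](_ : _ = q * (q * (q - b)) * ((1 - k) * n)); last by ring.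
have : (l' - l) * r <= (l' - l) * ((1 - k) * n) by apply: ler_wpM2l => //; lra.
lra.
Qed.

Lemma ed_scale l c y : fdom fd y -> ed fd l (c *: y) (c *: y) = normsq c * ed fd l y y.
Proof.
move=> Vy; have Vy' : fdom (opp_form fd) y := Vy.
have Vcy : fdom (opp_form fd) (c *: y) := cf_VZ cfd c Vy'.
have := cf_Zr cfd c Vy' Vcy; rewrite (cf_Zl cfd c Vy' Vy') /= => /(congr1 (@complex.Re R)).
rewrite ReN /ed /rt => e; have -> : complex.Re (fd (c *: y) (c *: y)) = normsq c * complex.Re (fd y y).
  move: e; rewrite normsqC; case: (fd y y) => u v; case: (c) => u' v' /=; lra.
have -> : rip (c *: y) (c *: y) = normsq c * rip y y.
  by rewrite /rip !ipE ip_nsq normsqC; case: (c) => u v /=; ring.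
ring.
Qed.

(** Cauchy-Schwarz for the form of l - D between R_l v and z y; the scalar z = <v, y> turns the real
    part into the modulus. *)
Lemma Rl_CS l v y : dplus < l -> fdom fd y ->
  normsq '[y, v] <= rip (Rl l v) v * ed fd l y y.
Proof.
move=> hl Vy; have pe := pf_ed cfd fdD D_spec (ltW hl).
have VR := Rl_V cfd fdD D_spec v hl.
have nC : normsq '[y, v] = normsq '[v, y].
  by rewrite ipC !normsqC ReJ ImJ sqrrN.
rewrite nC; set z := '[v, y].
have Vzy : fdom fd (z *: y) := cf_VZ cfd z Vy.
have := pf_CS pe VR Vzy; rewrite !(Rl_E cfd fdD D_spec) // (ripC v (Rl l v)) ed_scale //.
have -> : rip v (z *: y) = normsq z.
  by rewrite /rip ipZr normsqC -/z; case: (z) => u w /=; ring.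
have [->|z0] := eqVneq (normsq z) 0.
  by move=> _; rewrite mulr_ge0 ?(pf_ge0 pe) // (Rl_ge0 cfd fdD D_spec).
have zp : 0 < normsq z by rewrite lt_def z0 normsqC addr_ge0 ?sqr_ge0.
by rewrite mulrCA expr2 ler_pM2l.
Qed.

(** For a negative discriminant the root is purely imaginary, and [Num.sqrt] is 0 on negative
    numbers, so one real formula covers both cases. *)
Lemma Re_lambda_plus x y : complex.Re (lambda_plus B fa fd x y) =
  (quad fa x / normsq x + quad fd y / normsq y +
   Num.sqrt ((quad fa x / normsq x - quad fd y / normsq y) ^+ 2 -
     4 * (normsq '[y, Bs x] / (normsq x * normsq y)))) / 2.
Proof.
rewrite /lambda_plus /=; set p := _ / _; set q := _ / _; set dd := _ - 4 * _.
have -> : (2^-1 : R[i]) = (2^-1 : R)%:C by rewrite fmorphV /= rmorph_nat.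
rewrite ReMr ReD /= mulrC; congr ((_ + _) / 2).
rewrite /csqrt; case: lerP => //= h; by rewrite ler0_sqrtr // ltW.
Qed.

Lemma sqrt_lt (u w : R) : (Num.sqrt u < w) = (0 < w) && (u < w ^+ 2).
Proof.
have [w0|w0] := ltrP 0 w; last by rewrite ltNge (le_trans w0 (sqrtr_ge0 _)).
have [u0|u0] := lerP 0 u; first by rewrite -[u in RHS]sqr_sqrtr // ltr_pXn2r ?nnegrE ?sqrtr_ge0 // ltW.
by rewrite ler0_sqrtr ?ltW // w0 (lt_trans u0) // exprn_gt0.
Qed.

(** With p, q the two quotients, the claim is that the root is below 2 l - p - q. Squaring is
    allowed when this is positive, and (p - q)^2 - (2 l - p - q)^2 = 4 (p - l)(l - q). *)
Lemma lambda_plus_lt l x y : dplus < l -> x != 0 -> y != 0 -> fdom fd y ->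
  (complex.Re (lambda_plus B fa fd x y) < l) =
  (quad fa x / normsq x + quad fd y / normsq y < 2 * l) &&
  ((quad fa x - l * normsq x) * ed fd l y y < normsq '[y, Bs x]).
Proof.
move=> hl x0 y0 Vy; rewrite Re_lambda_plus ltr_pdivrMr //.
have nx := nsq_gt0 x0; have ny := nsq_gt0 y0.
set p := quad fa x / _; set q := quad fd y / _; set m := normsq '[_, _].
have pE : quad fa x = p * normsq x by rewrite /p mulfVK // gt_eqF.
have qE : ed fd l y y = (l - q) * normsq y.
  by rewrite /ed -nsqE mulrBl /q mulfVK // gt_eqF.
have nn : 0 < normsq x * normsq y by apply: mulr_gt0.
rewrite -ltrBrDl sqrt_lt subr_gt0 (mulrC l 2); congr (_ && _).
rewrite qE pE; set r := m / _.
have mE : m = r * (normsq x * normsq y) by rewrite /r mulfVK // gt_eqF.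
have -> : (p * normsq x - l * normsq x) * ((l - q) * normsq y) =
  (p - l) * (l - q) * (normsq x * normsq y) by ring.
rewrite mE ltr_pM2r //.
apply/idP/idP; lra.
Qed.

(** One direction is [Rl_CS]. For the other, the test vector gives the determinant condition at
    once, and the trace condition p + q < 2 l is where l > [mu] enters. *)
Lemma inf_lambda_lt l x : mu < l -> V x -> x != 0 -> (exists y : H2, y != 0) ->
  (inf_lambda_plus B fa fd x < l%:E)%E <-> quad (s l) x < 0.
Proof.
move=> hl Vx x0 H20; have hd := mu_dplus hl; have [hb hQ] := mu_dist hl.
have nx := nsq_gt0 x0.
rewrite /inf_lambda_plus; split=> [/ereal_inf_lt[_ [y [Vy /eqP y0] <-]]|hs].
  rewrite lte_fin lambda_plus_lt // => /andP[_ h].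
  have := Rl_CS (Bs x) hd Vy => h2; rewrite schur_quad.
  have ny := nsq_gt0 y0; have := ed_ge cfd fdD D_spec l Vy => h3.
  have e0 : 0 < ed fd l y y by apply: lt_le_trans h3; rewrite mulr_gt0 // subr_gt0.
  have := lt_le_trans h h2; rewrite ltr_pM2r //; lra.
suff [y Vy [y0 hy]] : exists2 y, fdom fd y & y != 0 /\ complex.Re (lambda_plus B fa fd x y) < l.
  apply: le_lt_trans (_ : ((complex.Re (lambda_plus B fa fd x y))%:E < l%:E)%E); last by rewrite lte_fin.
  by apply: ereal_inf_lbound; exists y => //; split=> //; apply/eqP.
have q_lt y : fdom fd y -> y != 0 -> quad fd y / normsq y <= dplus.
  by move=> Vy y0; rewrite ler_pdivrMr ?nsq_gt0 //; apply: (d_le cfd fdD D_spec).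
(* If B^* x = 0, the canonical test vector vanishes. Then any nonzero y in dom d serves, and one
   exists because the second space is nonzero. *)
move: hs; rewrite schur_quad; have [v0|v0] := eqVneq (Bs x) 0.
  rewrite v0 rip0r subr0 => hs.
  have [y Vy y0] : exists2 y, fdom fd y & y != 0.
    have [z z0] := H20; have [u Vu hu] := (dense_nsq _).1 (cf_dense cfd) z _ (nsq_gt0 z0).
    exists u => //; apply: contraTneq hu => ->; by rewrite subr0 ltxx.
  exists y => //; split=> //; rewrite lambda_plus_lt //; apply/andP; split.
    have := q_lt _ Vy y0; have : quad fa x / normsq x < l by rewrite ltr_pdivrMr //; lra.
    lra.
  rewrite v0 ip0r; apply: lt_le_trans (_ : 0 <= _); last by rewrite normsqC addr_ge0 ?sqr_ge0.
  have ny := nsq_gt0 y0; have := ed_ge cfd fdD D_spec l Vy => h3.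
  have e0 : 0 < ed fd l y y by apply: lt_le_trans h3; rewrite mulr_gt0 // subr_gt0.
  by rewrite pmulr_llt0 //; lra.
move=> hs; set y := Rl l (Bs x).
have Vy : fdom fd y := Rl_V cfd fdD D_spec _ hd.
have y0 : y != 0.
  apply: contra v0 => /eqP y0; apply/eqP; apply: (dense_ip_eq (cf_dense cfd)) => z Vz.
  have pe := pf_ed cfd fdD D_spec (ltW hd).
  have e w : fdom fd w -> rip (Bs x) w = 0.
    by move=> Vw; rewrite -(Rl_E cfd fdD D_spec _ hd Vw) -/y y0 (pf_0l pe).
  rewrite ip0l -(ip0l z); apply: ip_rip; rewrite rip0l e //; exact: (cf_VZ cfd 'i (Vz : fdom (opp_form fd) z)).
have ny := nsq_gt0 y0.
have eE : ed fd l y y = rip y (Bs x) by rewrite (Rl_E cfd fdD D_spec _ hd) // ripC.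
have rho0 : 0 < rip y (Bs x).
  apply: lt_le_trans (Rl_coer cfd fdD D_spec (Bs x) hd); rewrite mulr_gt0 // subr_gt0 //.
exists y => //; split=> //; rewrite lambda_plus_lt //; apply/andP; split; last first.
  rewrite eE; apply: lt_le_trans (_ : rip y (Bs x) * rip y (Bs x) <= _).
    by rewrite ltr_pM2r //; rewrite -/y in hs; lra.
  by rewrite -expr2 normsqC /rip lerDl sqr_ge0.
(* The trace condition: [Bs_small] with e = 0 yields <y, v> < (l - [dplus]) |x|^2, hence p < l + (l
   - [dplus]), while q <= [dplus]. *)
have hs0 : quad (s l) x <= 0 * normsq x by rewrite schur_quad mul0r ltW.
have h1 := Bs_small hl Vx hs0; rewrite mulr0 addr0 in h1.
have h2 := Rl_rip_le cfd fdD D_spec (Bs x) hd; rewrite -/y in h2 hs.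
have h3 := q_lt _ Vy y0.
set qq := l - dplus in h1 h2 *; have qb : 0 < qq - b by rewrite /qq; lra.
have q0 : 0 < qq by rewrite /qq subr_gt0.
have h4 : (qq - b) * (qq * rip y (Bs x)) < qq * (qq * (qq - b)) * normsq x.
  apply: le_lt_trans (_ : (qq - b) * normsq (Bs x) < _); first by rewrite ler_pM2l.
  apply: le_lt_trans h1 _; rewrite ltr_pM2r // ltr_pM2l //; move: hQ; rewrite /qq; lra.
have h5 : rip y (Bs x) < qq * normsq x.
  have p0 : 0 < qq * (qq - b) by apply: mulr_gt0.
  by rewrite -(ltr_pM2l p0); lra.
have : quad fa x / normsq x < l + qq.
  by rewrite ltr_pdivrMr //; lra.
by rewrite /qq; lra.
Qed.

End SchurMonotone.

(** * The block operator *)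

Section ProductClosure.
Variables (R : realType) (H K : hilbertType R).

Lemma closure_nsq4 (A : set ((H * K) * (H * K))) p :
  closure A p <-> forall e : R, 0 < e -> exists2 q, A q &
    [/\ normsq (p.1.1 - q.1.1) < e, normsq (p.1.2 - q.1.2) < e,
        normsq (p.2.1 - q.2.1) < e & normsq (p.2.2 - q.2.2) < e].
Proof.
split=> [h e /sqr_small[r r0 re]|h B /nbhs_ballP[e /= /pos_real_complex[r r0 ->] hB]].
  have [|y [Ay [[y1 y2] [y3 y4]]]] := h (ball p r%:C).
    by apply: nbhsx_ballx; rewrite ltcR.
  by exists y => //; split; apply: lt_trans re; apply/ballE.
have [|y Ay [y1 y2 y3 y4]] := h (r ^+ 2); first exact: exprn_gt0.
by exists y; split=> //; apply: hB; split; split; apply/ballE.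
Qed.

Lemma closure_seq4 (A : set ((H * K) * (H * K))) p : closure A p ->
  exists q : nat -> (H * K) * (H * K), (forall n, A (q n)) /\
    [/\ cvs (fun n => (q n).1.1) p.1.1, cvs (fun n => (q n).1.2) p.1.2,
        cvs (fun n => (q n).2.1) p.2.1 & cvs (fun n => (q n).2.2) p.2.2].
Proof.
move=> /closure_nsq4 h; have pn n : 0 < n.+1%:R^-1 :> R by rewrite invr_gt0.
pose q n := s2val (cid2 (h _ (pn n))).
exists q; split=> [n|]; first exact: s2valP.
by split=> e e0; have [N hN] := inv_small e0; exists N => n /hN;
  rewrite nsqBC; apply: lt_trans; have [] := s2valP' (cid2 (h _ (pn n))).
Qed.

End ProductClosure.

Section BlockOperator.
Variables (R : realType) (H1 H2 : hilbertType R).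
Variables (A : op H1 H1) (B : op H2 H1) (D : op H2 H2) (fa : sform R H1) (fd : sform R H2).
Variables (ca cd dplus a b : R).
Hypothesis B_dense : densely_defined B.
Hypothesis cfa : cform fa ca.
Hypothesis faA : graph_op (op_of_form fa) = graph_op A.
Hypothesis cfd : cform (opp_form fd) cd.
Hypothesis fdD : graph_op (op_of_form (opp_form fd)) = graph_op (opp_op D).
Hypothesis D_spec : forall r : R, dplus < r -> resolvent_set D r%:C.
Hypothesis fa_sub : fdom fa `<=` dom (adjoint B).
Hypothesis cases : (dom B `<=` dom D /\ is_core D (dom B)) \/ fdom fd `<=` dom B.
Hypothesis b_ge0 : 0 <= b.
Hypothesis ab_bound : forall x, fdom fa x ->
  normsq (adjoint B x) <= a * normsq x + b * quad fa x.

Local Notation Bs := (adjoint B : H1 -> H2).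
Local Notation V := (fdom fa).
Local Notation s l := (schur_form B D fa l).
Local Notation Rl := (Rl D).
Local Notation M := (closure_op (block_op A B D)).
Local Notation bta := (bt fa ca).

Definition weak_block : set ((H1 * H2) * (H1 * H2)) :=
  [set p | [/\ V p.1.1, dom D p.1.2, p.2.2 = - Bs p.1.1 + D p.1.2 &
    forall z, V z -> rt fa p.1.1 z + rip p.1.2 (Bs z) = rip p.2.1 z]].

Let Bs0 x y : V x -> V y -> Bs (x - y) = Bs x - Bs y.
Proof.
move=> Vx Vy; have sV := (cf_sesq cfa).1.
have := Bs_lin B_dense fa_sub (-1) Vy Vx; rewrite !scaleN1r addrC => ->.
by rewrite addrC.
Qed.

(** Continuity of B^* in the form norm of a lets the first row control convergence in the second. *)
Lemma Bs_bt : exists2 C : R, 0 < C & forall u, V u -> normsq (Bs u) <= C * bta u u.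
Proof.
exists (`|a| + b + b * `|ca| + 1).
  by have := b_ge0 => b0; rewrite ltr_wpDl // !addr_ge0 // mulr_ge0.
move=> u Vu; have := ab_bound Vu; have := bt_ge cfa Vu; rewrite (quad_bt fa ca).
have n0 := nsq_ge0 u; set n := normsq u in n0 *; set q := bta u u => nq h.
have q0 : 0 <= q by lra.
apply: le_trans h _; have b0 : 0 <= b := b_ge0.
have h1 : a * n <= `|a| * q.
  apply: le_trans (_ : `|a| * n <= _); first by apply: ler_wpM2r => //; apply: ler_norm.
  exact: ler_wpM2l.
have h2 : - ca * n <= `|ca| * q.
  apply: le_trans (_ : `|ca| * n <= _); last exact: ler_wpM2l.
  by apply: ler_wpM2r => //; rewrite -normrN; apply: ler_norm.
have : b * (- ca * n) <= b * (`|ca| * q) by apply: ler_wpM2l.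
lra.
Qed.

Lemma rip_adj y z : dom B y -> V z -> rip y (Bs z) = rip (B y) z.
Proof. by move=> By Vz; rewrite /rip adjointP //; apply: fa_sub. Qed.

Lemma A_form x f : dom A x /\ A x = f <-> V x /\ forall z, V z -> rt fa x z = rip f z.
Proof.
have -> : (dom A x /\ A x = f) <-> graph_op A (x, f) by [].
by rewrite -faA (form_opP cfa).
Qed.

Lemma block_weak p : graph_op (block_op A B D) p -> weak_block p.
Proof.
case: p => [[x y] [f h]] [/= [dA dBs dB dD] [<- <-]].
have /A_form[Vx hA] : dom A x /\ A x = A x by [].
by split=> // z Vz; rewrite /= hA // ripDl rip_adj.
Qed.

(** Testing the first row with x_m - x_n shows that x_n is Cauchy in the form norm, so B^* x_n
    converges. The second row, rewritten as y_n = R_l (l y_n - h_n - B^* x_n), then passes to the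
    limit with bounded operators. *)
Lemma weak_closed : closure weak_block `<=` weak_block.
Proof.
move=> [[x y] [f h]] /closure_seq4[q [Wq /= [cx cy cf ch]]].
pose xn n := (q n).1.1; pose yn n := (q n).1.2.
pose fn n := (q n).2.1; pose hn n := (q n).2.2.
have Vx n : V (xn n) by have [] := Wq n.
have pb := pf_bt cfa; have VB m n : V (xn m - xn n) by apply: (pf_VB pb).
have [C C0 hC] := Bs_bt.
have E n z : V z -> bta (xn n) z = rip (fn n) z - rip (yn n) (Bs z) + ca * rip (xn n) z.
  by move=> Vz; have [_ _ _ /(_ _ Vz)] := Wq n; rewrite /bt -/(xn n) -/(yn n) -/(fn n); lra.
have key m n : bta (xn m - xn n) (xn m - xn n) <= 2 * normsq (fn m - fn n) +
    C * normsq (yn m - yn n) + (2 + 2 * `|ca|) * normsq (xn m - xn n).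
  have Vu := VB m n; rewrite {1}(pf_Bl pb) // !E //.
  have hu := hC _ Vu; set u := xn m - xn n in Vu hu *.
  have C1 : 0 < C^-1 by rewrite invr_gt0.
  have y1 := rip_young (- (yn m - yn n)) (Bs u) C0; rewrite nsqN ripNl ripBl in y1.
  have y2 := rip_young (fn m - fn n) u ltr01; rewrite invr1 ripBl in y2.
  have h3 : C^-1 * normsq (Bs u) <= bta u u.
    by rewrite -(ler_pM2l C0) mulrA mulfV ?gt_eqF // mul1r.
  have h4 : ca * normsq u <= `|ca| * normsq u.
    by apply: ler_wpM2r (ler_norm _); apply: nsq_ge0.
  have e5 : rip (xn m) u - rip (xn n) u = normsq u by rewrite nsqE -ripBl.
  have hh : bta u u = rip (fn m) u - rip (yn m) (Bs u) + ca * rip (xn m) u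
     - (rip (fn n) u - rip (yn n) (Bs u) + ca * rip (xn n) u).
    by rewrite {1}/u (pf_Bl pb) // !E.
  have n0 := nsq_ge0 (fn m - fn n); have n1 := nsq_ge0 u.
  have e6 : ca * (rip (xn m) u - rip (xn n) u) = ca * normsq u by rewrite e5.
  lra.
have [|x' Vx' hx'] := bt_complete cfa Vx.
  move=> e e0; pose k := 6 * (2 + C + 2 * `|ca|).
  have k0 : 0 < k by rewrite /k; have := normr_ge0 ca; lra.
  have d0 : 0 < e / k by rewrite divr_gt0.
  have [N1 g1] := cvs_cauchys cx d0; have [N2 g2] := cvs_cauchys cy d0.
  have [N3 g3] := cvs_cauchys cf d0.
  exists (maxn N1 (maxn N2 N3)) => m n; rewrite !geq_max.
  move=> /and3P[m1 m2 m3] /and3P[n1 n2 n3].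
  have := g1 _ _ m1 n1; have := g2 _ _ m2 n2; have := g3 _ _ m3 n3; have := key m n.
  rewrite !ltr_pdivlMr // -/(xn m) -/(xn n) -/(yn m) -/(yn n) -/(fn m) -/(fn n).
  set u := normsq (xn m - xn n); set v := normsq (yn m - yn n); set w := normsq (fn m - fn n).
  move=> h1 h2 h3 h4; apply: le_lt_trans h1 _.
  have u0 : 0 <= u := nsq_ge0 _; have v0 : 0 <= v := nsq_ge0 _; have w0 : 0 <= w := nsq_ge0 _.
  have c1 := normr_ge0 ca; rewrite /k in h2 h3 h4.
  have p1 : 0 <= `|ca| * u by apply: mulr_ge0.
  have p2 : 0 <= `|ca| * v by apply: mulr_ge0.
  have p3 : 0 <= `|ca| * w by apply: mulr_ge0.
  have p4 : 0 <= C * u by apply: mulr_ge0 => //; apply: ltW.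
  have p5 : 0 <= C * v by apply: mulr_ge0 => //; apply: ltW.
  have p6 : 0 <= C * w by apply: mulr_ge0 => //; apply: ltW.
  lra.
have VBx n : V (xn n - x') by apply: (pf_VB pb).
have cx' : cvs xn x'.
  by move=> e /hx'[N hN]; exists N => n /hN; apply: le_lt_trans; apply: bt_ge.
have ex : x = x' := cvs_unique cx cx'; rewrite -ex in Vx' hx' VBx.
have cB : cvs (fun n => Bs (xn n)) (Bs x).
  move=> e e0; have d0 : 0 < e / C by rewrite divr_gt0.
  have [N hN] := hx' _ d0; exists N => n /hN; rewrite ltr_pdivlMr // mulrC => h1.
  by rewrite -Bs0 //; apply: le_lt_trans h1; apply: hC.
(* Closedness of D is used through one bounded resolvent; at distance 1 from [dplus] its norm is at
   most 1. *)
pose l := dplus + 1; have hl : dplus < l by rewrite ltrDl.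
have hR : rlin (Rl l) by move=> r u v; apply: (Rl_lin cfd fdD D_spec).
have bR : rbnd (Rl l).
  exists 1 => v; have := Rl_nsq cfd fdD D_spec v hl.
  by rewrite /l addrC addKr expr1n !mul1r.
have yR n : yn n = Rl l (l%:C *: yn n - (hn n + Bs (xn n))).
  have [_ dy hy _] := Wq n; apply/esym.
  have [Vy fy] := (D_form cfd fdD _ _).1 (conj dy erefl).
  apply: (Rl_uniq cfd fdD D_spec) => // z Vz.
  rewrite -/(yn n) in dy hy Vy fy *; rewrite /hn hy /ed fy // -/(xn n).
  by rewrite !ripE; ring.
have cy' : cvs yn (Rl l (l%:C *: y - (h + Bs x))).
  have := cvs_rbnd hR bR (cvsB (cvsZ l cy) (cvsD ch cB)).
  by under eq_fun do rewrite -yR.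
have ey := cvs_unique cy cy'.
have [dy hy] := RlP cfd fdD D_spec (l%:C *: y - (h + Bs x)) hl.
rewrite -ey in dy hy.
have Dy : D y = h + Bs x.
  apply: rip_ext => z; have := congr1 (fun w => rip w z) hy; rewrite !ripE; lra.
split=> //=; first by rewrite Dy addrCA addNr addr0.
move=> z Vz.
have lb : bta x z = rip f z - rip y (Bs z) + ca * rip x z.
  apply: (@lim_eq R (fun n => bta (xn n) z)) => e e0.
    have z0 := pf_ge0 pb Vz; have d0 : 0 < e ^+ 2 / (bta z z + 1).
      by rewrite divr_gt0 ?exprn_gt0 //; lra.
    have [N hN] := hx' _ d0; exists N => n /hN; rewrite ltr_pdivlMr; last lra.
    have := pf_CS pb (VBx n) Vz; rewrite {1}(pf_Bl pb) // => h1 h2.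
    rewrite -(@ltr_pXn2r _ 2) ?nnegrE ?normr_ge0 ?ltW // real_normK ?num_real //.
    apply: le_lt_trans h1 _; have := pf_ge0 pb (VBx n); lra.
  pose M1 := 3 * (1 + `|ca|); have M0 : 0 < M1 by rewrite mulr_gt0 // ltr_wpDr.
  have d0 : 0 < e / M1 by rewrite divr_gt0.
  have [N1 g1] := cvs_rip z cf d0; have [N2 g2] := cvs_rip (Bs z) cy d0.
  have [N3 g3] := cvs_rip z cx d0.
  exists (maxn N1 (maxn N2 N3)) => n; rewrite !geq_max => /and3P[/g1 k1 /g2 k2 /g3 k3].
  rewrite E // /fn /yn /xn.
  set A1 := rip (q n).2.1 z in k1 *; set A2 := rip (q n).1.2 _ in k2 *.
  set A3 := rip (q n).1.1 z in k3 *.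
  have -> : A1 - A2 + ca * A3 - (rip f z - rip y (Bs z) + ca * rip x z) =
    (A1 - rip f z) - (A2 - rip y (Bs z)) + ca * (A3 - rip x z) by ring.
  apply: le_lt_trans (ler_normD _ _) _; rewrite normrM.
  have t1 := ler_normB (A1 - rip f z) (A2 - rip y (Bs z)).
  move: k1 k2 k3 t1; set a1 := `|A1 - _|; set a2 := `|A2 - _|; set a3 := `|A3 - _|.
  have a30 : 0 <= a3 := normr_ge0 _; have c0 := normr_ge0 ca.
  have a10 : 0 <= a1 := normr_ge0 _; have a20 : 0 <= a2 := normr_ge0 _.
  rewrite !ltr_pdivlMr // /M1 => k1 k2 k3 t1.
  have w1 : 0 <= a1 * `|ca| by apply: mulr_ge0.
  have w2 : 0 <= a2 * `|ca| by apply: mulr_ge0.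
  have w3 : 0 <= a3 * `|ca| by apply: mulr_ge0.
  lra.
by move: lb; rewrite /bt; lra.
Qed.

(** If dom d lies in dom B, then B y may be subtracted in the first row and the pair is already in
    the graph. Otherwise y is approximated from the core, and x has to be corrected accordingly. *)
Lemma weak_sub_closure : weak_block `<=` closure (graph_op (block_op A B D)).
Proof.
move=> [[x y] [f h]] [/= Vx dy hh hf].
have [Vy fy] := (D_form cfd fdD _ _).1 (conj dy erefl).
case: cases => [[BD [_ core]]|dB]; last first.
  have By := dB _ Vy; apply: subset_closure.
  have [|dA Ax] := (A_form x (f - B y)).2.
    by split=> // z Vz; rewrite ripBl -rip_adj // -hf // addrK.
  split=> /=; first by split=> //; apply: fa_sub.
  by rewrite Ax subrK hh.
have [C C0 hC] := Bs_bt; have pb := pf_bt cfa.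
apply/closure_nsq4 => e e0 /=.
pose k := 4 * (1 + ca ^+ 2) * (1 + C) ^+ 2.
have k1 : 1 <= k.
  rewrite /k; have p1 : 1 <= 1 + ca ^+ 2 by rewrite lerDl sqr_ge0.
  have p2 : 1 <= (1 + C) ^+ 2 by rewrite exprn_ege1 // lerDl ltW.
  have := ler_pM ler01 ler01 p1 p2; rewrite mulr1; lra.
have d0 : 0 < e / k by rewrite divr_gt0 //; lra.
have : graph_op D (y, D y) by [].
rewrite -core => /closure_nsq2/(_ _ d0)[[y' Dy'] [/= [dDy' dBy'] <-] [ny nD]].
(* x itself may lie outside dom A. The vector x' solves (A + ca) x' = f + ca x - B y', and u = x' -
   x satisfies [bta u u] = <y - y', B^* u>, so it is small together with y - y'. *)
pose x' := res fa ca (f + ca%:C *: x - B y').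
have Vx' : V x' := resV cfa _.
have [dA Ax'] : dom A x' /\ A x' = f + ca%:C *: x - B y' - ca%:C *: x'.
  have := form_op_resK cfa (f + ca%:C *: x - B y'); rewrite faA; exact.
have [u uE] : exists u, u = x' - x by eexists.
have Vu : V u by rewrite uE; apply: (pf_VB pb).
have bu : bta u u = rip (y - y') (Bs u).
  rewrite {1}uE (pf_Bl pb) // (resE cfa) // /bt !ripE (rip_adj dBy' Vu).
  by have := hf _ Vu; lra.
have bu2 : bta u u <= C * normsq (y - y').
  have := rip_young (y - y') (Bs u) C0; rewrite -bu => h1.
  have : C^-1 * normsq (Bs u) <= bta u u.
    by rewrite -(ler_pM2l C0) mulrA mulfV ?gt_eqF // mul1r; apply: hC.
  lra.
have nu : normsq u <= C * normsq (y - y') := le_trans (bt_ge cfa Vu) bu2.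
have nB : normsq (Bs u) <= C * (C * normsq (y - y')).
  by apply: le_trans (hC _ Vu) _; rewrite ler_pM2l.
have n0 := nsq_ge0 (y - y'); have n1 := nsq_ge0 (D y - D y').
move: ny nD; rewrite !ltr_pdivlMr; try lra.
set n := normsq (y - y') in nu nB n0 bu2 *; set nD := normsq (D y - D y') => ny nD'.
have nk : n * (4 * (1 + C) ^+ 2) <= n * k.
  apply: ler_wpM2l => //; rewrite /k -mulrA ler_pM2l // ler_peMl ?sqr_ge0 //.
  by rewrite lerDl sqr_ge0.
have nk2 : n * (ca ^+ 2 * (1 + C) ^+ 2) <= n * k.
  apply: ler_wpM2l => //; rewrite /k; have c2 := sqr_ge0 ca; have C2 := sqr_ge0 (1 + C).
  have := mulr_ge0 c2 C2; lra.
have Cn : 0 <= C * n by rewrite mulr_ge0 // ltW.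
have CCn : 0 <= C * (C * n) by rewrite mulr_ge0 // ltW.
exists ((x', y'), block_op A B D (x', y')); first by split=> //; split=> //; apply: fa_sub.
rewrite /= Ax'; split.
- by rewrite nsqBC -uE; apply: le_lt_trans nu _; lra.
- by apply: le_lt_trans ny; rewrite ler_peMr.
- have -> : f - (f + ca%:C *: x - B y' - ca%:C *: x' + B y') = ca%:C *: u.
    by apply: rip_ext => z; rewrite uE !ripE; ring.
  rewrite nsqZ; have : ca ^+ 2 * normsq u <= ca ^+ 2 * (C * n) by apply: ler_wpM2l (sqr_ge0 _) _ _ nu.
  have c2 := sqr_ge0 ca; have w1 := mulr_ge0 c2 n0; have w2 := mulr_ge0 c2 CCn.
  have w3 := mulr_ge0 c2 Cn; rewrite !sqrrD in nk2; lra.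
- have -> : h - (- Bs x' + D y') = Bs u + (D y - D y').
    by rewrite hh uE Bs0 //; apply: rip_ext => z; rewrite !ripE; ring.
  apply: le_lt_trans (nsqDle _ _) _; rewrite -/nD.
  have k4 : 4 * nD <= nD * k.
    rewrite mulrC; apply: ler_wpM2l => //; rewrite /k.
    have p1 : 1 <= 1 + ca ^+ 2 by rewrite lerDl sqr_ge0.
    have p2 : 1 <= (1 + C) ^+ 2 by rewrite exprn_ege1 // lerDl ltW.
    have := ler_pM ler01 ler01 p1 p2; rewrite mulr1; lra.
  lra.
Qed.

Lemma closure_block : closure (graph_op (block_op A B D)) = weak_block.
Proof.
apply/seteqP; split; last exact: weak_sub_closure.
move=> p hp; apply: weak_closed; apply: closure_subset hp; exact: block_weak.
Qed.

Lemma graph_M : graph_op M = weak_block.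
Proof.
rewrite /closure_op op_of_graph closure_block // => -[x y] [f h] [f' h'] [/= _ _ -> h1] [/= _ _ -> h2].
congr (_, _); apply: (dense_ip_eq (cf_dense cfa)) => z Vz.
have e w : V w -> rip f w = rip f' w by move=> Vw; rewrite -h1 // -h2.
by apply: ip_rip; apply: e => //; apply: (cf_VZ cfa).
Qed.

Variable l : R.
Hypothesis hl : dplus < l.

(** The second row is solved for y; insertion into the first leaves an equation for s_l alone.
    Kernel, range and Fredholm properties all follow from this elimination. *)
Lemma shift_M x y f g : graph_op (shift_op M l%:C) ((x, y), (f, g)) <->
  [/\ V x, y = - Rl l (g + Bs x) &
    forall z, V z -> rt (s l) x z = rip f z + rip (Rl l g) (Bs z)].
Proof.
have -> : graph_op (shift_op M l%:C) ((x, y), (f, g)) <->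
    weak_block ((x, y), (f + l%:C *: x, g + l%:C *: y)).
  rewrite -graph_M; split=> -[/= dM hM]; split=> //=.
    have -> : (f + l%:C *: x, g + l%:C *: y) = (f, g) + l%:C *: (x, y) by [].
    by rewrite -hM subrK.
  by rewrite hM; congr (_, _); rewrite /= addrK.
have RlD u v : Rl l (u + v) = Rl l u + Rl l v.
  by have := Rl_lin cfd fdD D_spec 1 u v hl; rewrite !scale1r.
have yE : y = - Rl l (g + Bs x) <-> dom D y /\ g + l%:C *: y = - Bs x + D y.
  split=> [->|[dy hy]].
    have [d1 d2] := RlP cfd fdD D_spec (g + Bs x) hl.
    have [d3 d4] : dom D (- Rl l (g + Bs x)) /\ D (- Rl l (g + Bs x)) = - D (Rl l (g + Bs x)).
      have [Vw rw] := (D_form cfd fdD _ _).1 (conj d1 erefl).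
      have Vw' : fdom (opp_form fd) (Rl l (g + Bs x)) := Vw.
      apply/(D_form cfd fdD); split=> [|z Vz].
        by rewrite -scaleN1r; exact: (cf_VZ cfd (-1) Vw').
      have := cf_Zl cfd (-1) Vw' (Vz : fdom (opp_form fd) z).
      rewrite scaleN1r /= mulN1r => /(congr1 (@complex.Re R)); rewrite !ReN ripNl -rw // /rt.
      lra.
    split=> //; rewrite d4; apply: rip_ext => z.
    have := congr1 (fun w => rip w z) d2; rewrite !ripE; lra.
  have [Vy fy] := (D_form cfd fdD _ _).1 (conj dy erefl).
  have Vy' : fdom (opp_form fd) y := Vy.
  have -> : Rl l (g + Bs x) = - y; last by rewrite opprK.
  apply: (Rl_uniq cfd fdD D_spec) => // [|z Vz].
    by rewrite -scaleN1r; exact: (cf_VZ cfd (-1) Vy').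
  have := cf_Zl cfd (-1) Vy' (Vz : fdom (opp_form fd) z).
  rewrite scaleN1r /= mulN1r => /(congr1 (@complex.Re R)); rewrite !ReN => e.
  have := congr1 (fun w => rip w z) hy; rewrite !ripE /ed; have := fy _ Vz; rewrite /rt !ripE; lra.
split=> [[/= Vx dy hy hf]|[Vx ye hz]].
  have ye := yE.2 (conj dy hy).
  split=> // z Vz; rewrite schur_rt; have := hf _ Vz; rewrite ye RlD !ripE; lra.
have [dy hy] := yE.1 ye; split=> //= z Vz.
by have := hz _ Vz; rewrite schur_rt ye RlD !ripE; lra.
Qed.

Definition schur_ker : set H1 := [set x | V x /\ forall z, V z -> rt (s l) x z = 0].

Lemma Rl0 : Rl l 0 = 0.
Proof.
have := Rl_lin cfd fdD D_spec 1 0 0 hl; rewrite scaler0 addr0 scale1r.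
by rewrite -[LHS]addr0 => /addrI/esym.
Qed.

Lemma ker_M : ker_op (shift_op M l%:C) = [set (x, - Rl l (Bs x)) | x in schur_ker].
Proof.
apply/seteqP; split=> [[x y] hk|_ [x [Vx hx] <-]].
  have /shift_M[Vx ye hz] : graph_op (shift_op M l%:C) ((x, y), (0, 0)) := hk.
  exists x; last by rewrite ye add0r.
  by split=> // z Vz; rewrite hz // Rl0 !rip0l addr0.
have : graph_op (shift_op M l%:C) ((x, - Rl l (Bs x)), (0, 0)); last by [].
by apply/shift_M; split=> // [|z Vz]; rewrite ?add0r // hx // Rl0 !rip0l addr0.
Qed.

Lemma ker_dim k : has_dim (ker_op (shift_op M l%:C)) k <-> has_dim schur_ker k.
Proof.
rewrite ker_M; split=> h.
  have -> : schur_ker = fst @` [set (x, - Rl l (Bs x)) | x in schur_ker].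
    apply/seteqP; split=> [x hx|_ [_ [x hx <-] <-]] //.
    by exists (x, - Rl l (Bs x)) => //; exists x.
  apply: has_dim_map h => [d u v _ _ //|_ [x hx <-] x0].
  have {}x0 : x = 0 := x0; rewrite x0; have V0 := pf_0 (pf_bt cfa).
  by have := Bs0 V0 V0; rewrite !subrr => ->; rewrite Rl0 oppr0.
apply: has_dim_map h => [d u v [Vu _] [Vv _]|x _ [] //].
by rewrite (Bs_lin B_dense fa_sub) // (Rl_lin cfd fdD D_spec) // opprD -scalerN.
Qed.

Lemma range_MP f g : range_op (shift_op M l%:C) (f, g) <->
  exists2 x, V x & forall z, V z -> rt (s l) x z = rip f z + rip (Rl l g) (Bs z).
Proof.
split=> [[[x y] dxy hxy]|[x Vx hx]].
  have /shift_M[Vx _ hz] : graph_op (shift_op M l%:C) ((x, y), (f, g)) by split.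
  by exists x.
have [dM hM] : graph_op (shift_op M l%:C) ((x, - Rl l (g + Bs x)), (f, g)) by apply/shift_M.
by exists (x, - Rl l (g + Bs x)).
Qed.

(** For data (f, 0) the right-hand side of the reduced equation is f, so the range of S(l) is a
    slice of the closed range of M - l. *)
Lemma fredholm_schur : fredholm (shift_op M l%:C) ->
  finite_dim schur_ker /\ forall (fn : nat -> H1) f,
    (forall n, exists2 x, V x & forall z, V z -> rt (s l) x z = rip (fn n) z) ->
    cvs fn f -> exists2 x, V x & forall z, V z -> rt (s l) x z = rip f z.
Proof.
move=> [_ [k hk] cR _]; split; first by exists k; apply/ker_dim.
move=> fn f hf cf.
have fg0 f' : (exists2 x, V x & forall z, V z -> rt (s l) x z = rip f' z) <->
    range_op (shift_op M l%:C) (f', 0).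
  rewrite range_MP; split=> -[x Vx hx]; exists x => // z Vz; rewrite hx //;
    by rewrite Rl0 rip0l addr0.
apply/fg0; apply: cR; apply/closure_nsq2 => e /cf[N hN].
exists (fn N, 0); first by apply/fg0.
by rewrite /= subrr nsq0; split; [rewrite nsqBC; apply: hN|exact: le_lt_trans (nsq_ge0 _) (hN N _)].
Qed.

Variable c : R.
Hypothesis cs : cform (s l) c.

Hypothesis hlb : dplus + b < l.

(** The functional <f + B R_l g, z>, meaningful also when R_l g is outside dom B. *)
Let ell f g z := rip f z + rip (Rl l g) (Bs z).

Let RlB u v : Rl l (u - v) = Rl l u - Rl l v.
Proof.
have := Rl_lin cfd fdD D_spec (-1) v u hl; rewrite !scaleN1r addrC => ->.
by rewrite addrC.
Qed.

Lemma Bs_bts : exists2 C : R, 0 < C & forall z, V z -> normsq (Bs z) <= C * bt (s l) c z z.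
Proof.
pose q := l - dplus; pose k := 1 - b / q; pose m := l + `|a| / q.
have b0 : 0 <= b := b_ge0; have hlb' : dplus + b < l := hlb.
have q0 : 0 < q by rewrite /q; lra.
have k0 : 0 < k by rewrite subr_gt0 ltr_pdivrMr // /q; lra.
exists (`|a| + b / k * (1 + `|c| + `|m|) + 1).
  have bk : 0 <= b / k by rewrite divr_ge0 // ltW.
  have cm : 0 <= 1 + `|c| + `|m| by rewrite !addr_ge0.
  have := mulr_ge0 bk cm; have := normr_ge0 a; lra.
move=> z Vz; have := ab_bound Vz.
have := schur_ge cfd fdD D_spec b_ge0 ab_bound hlb Vz; rewrite -/q -/k -/m.
have := bt_ge cs Vz; rewrite (quad_bt (s l) c); have n0 := nsq_ge0 z.
set n := normsq z in n0 *; set t := bt _ _ z z; set qa := quad fa z.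
move=> nt h1 h2; have t0 : 0 <= t by lra.
have bk0 : 0 <= b / k by rewrite divr_ge0 // ltW.
have e1 : b * qa = b / k * (k * qa) by rewrite mulrA mulfVK // gt_eqF.
have h3 : b / k * (k * qa) <= b / k * (t - c * n + m * n) by apply: ler_wpM2l => //; lra.
have lem r : r * n <= `|r| * t.
  apply: le_trans (_ : `|r| * n <= _); first by apply: ler_wpM2r (ler_norm _).
  by apply: ler_wpM2l.
have h4 : b / k * (t - c * n + m * n) <= b / k * ((1 + `|c| + `|m|) * t).
  apply: ler_wpM2l => //; have := lem m; have := lem (- c); rewrite normrN; lra.
have := lem a; lra.
Qed.

Lemma ell_bound f g z : ell f g z ^+ 2 <=
  2 * (normsq f * normsq z) + 2 * (normsq (Rl l g) * normsq (Bs z)).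
Proof.
have h1 := rip_CS f z; have h2 := rip_CS (Rl l g) (Bs z).
have h3 := sqr_ge0 (rip f z - rip (Rl l g) (Bs z)); rewrite /ell; lra.
Qed.

Lemma ell_riesz f g : exists2 u, V u & forall z, V z -> bt (s l) c u z = ell f g z.
Proof.
have [C C0 hC] := Bs_bts.
apply: (form_riesz cs (M := 2 * normsq f + 2 * (normsq (Rl l g) * C))) => [r x y Vx Vy|x Vx].
  by rewrite /ell (Bs_lin B_dense fa_sub) // !ripE; ring.
apply: le_trans (ell_bound f g x) _.
have h1 := bt_ge cs Vx; have h2 := hC _ Vx.
have h3 := ler_wpM2l (nsq_ge0 f) h1; have h4 := ler_wpM2l (nsq_ge0 (Rl l g)) h2.
lra.
Qed.

Hypothesis solve : forall f, (forall x, schur_ker x -> rip f x = 0) ->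
  exists2 x, V x & forall z, V z -> rt (s l) x z = rip f z.

(** [ell] need not be given by a vector of H1, so [solve] does not apply to it directly. First u
    represents it for s_l + c; then s_l(w, .) = c <u, .> is solvable, since c u inherits
    orthogonality to the kernel, and u + w is the solution. *)
Lemma rangeP f g : range_op (shift_op M l%:C) (f, g) <->
  forall x, schur_ker x -> ell f g x = 0.
Proof.
rewrite range_MP; split=> [[x Vx hx] k [Vk hk]|hk].
  by rewrite /ell -hx // (rt_sym cs) // hk.
have [u Vu hu] := ell_riesz f g.
have [k Kk|w Vw hw] := solve (f := c%:C *: u).
  rewrite ripZl; have [Vk hk'] := Kk.
  by have := hu _ Vk; rewrite hk // /bt (rt_sym cs) // hk' // add0r.
exists (u + w); first by apply: (pf_VD (pf_bt cs)).
move=> z Vz; have := hu _ Vz; rewrite /bt /ell.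
have -> : rt (s l) (u + w) z = rt (s l) u z + rt (s l) w z.
  by rewrite /rt (cf_Dl cs) // ReD.
by rewrite hw // ripZl.
Qed.

Lemma schur_fredholm : finite_dim schur_ker -> fredholm (shift_op M l%:C).
Proof.
move=> [k hk]; split.
- move=> [[x y] [f g]] hc.
  apply/shift_M.
  have {}hc : closure weak_block ((x, y), (f + l%:C *: x, g + l%:C *: y)).
    apply/closure_nsq4 => e e0.
    pose K := 4 * (1 + l ^+ 2); have K1 : 4 <= K.
      by rewrite /K ler_pMr // lerDl sqr_ge0.
    have d0 : 0 < e / K by rewrite divr_gt0 //; lra.
    have [[[x' y'] [f' g']] hG [/= h1 h2 h3 h4]] := (closure_nsq4 _ _).1 hc _ d0.
    have hG' : graph_op M ((x', y'), (f' + l%:C *: x', g' + l%:C *: y')).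
      have [/= dM hM] := hG; split => //=.
      have -> : (f' + l%:C *: x', g' + l%:C *: y') = (f', g') + l%:C *: (x', y') by [].
      by rewrite -hM subrK.
    rewrite graph_M in hG'; exists ((x', y'), (f' + l%:C *: x', g' + l%:C *: y')) => //=.
    move: h1 h2 h3 h4; rewrite !ltr_pdivlMr; try lra.
    have l2 := sqr_ge0 l.
    have tail (G : hilbertType R) (u v u' v' : G) : normsq (u - u') * K < e ->
        normsq (v - v') * K < e -> normsq (v + l%:C *: u - (v' + l%:C *: u')) < e.
      move=> g1 g2; have -> : v + l%:C *: u - (v' + l%:C *: u') = (v - v') + l%:C *: (u - u').
        by apply: rip_ext => z; rewrite !ripE; ring.
      apply: le_lt_trans (nsqDle _ _) _; rewrite nsqZ; move: g1 g2; rewrite /K.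
      have := nsq_ge0 (u - u'); have := nsq_ge0 (v - v').
      set p := normsq _; set p' := normsq (u - u') => p0 p0' g1 g2.
      have := mulr_ge0 l2 p0; have := mulr_ge0 l2 p0'; lra.
    have small r : 0 <= r -> r * K < e -> r < e.
      by move=> r0; apply: le_lt_trans; rewrite ler_peMr //; lra.
    move=> h1 h2 h3 h4; split; [exact: small (nsq_ge0 _) h1|exact: small (nsq_ge0 _) h2| |]; exact: tail.
  apply/shift_M; move: (weak_closed hc); rewrite -graph_M => -[/= dM hM]; split=> //=.
  by rewrite hM; congr (_, _); rewrite /= addrK.
- by exists k; apply/ker_dim.
(* By [rangeP] the range is the common null space of the functionals (f, g) |-> ell f g x, each of
   which is continuous. *)
- move=> [f g] hc; apply/rangeP => x Kx.
  apply/eqP; rewrite -sqrf_eq0 eq_le sqr_ge0 andbT; apply/ler_addgt0Pr => e e0; rewrite add0r.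
  have hC := Rl_nsq cfd fdD D_spec _ hl; set q := (l - dplus) ^+ 2 in hC.
  have q0 : 0 < q by rewrite exprn_gt0 // subr_gt0.
  pose K := 2 * normsq x + 2 * q^-1 * normsq (Bs x) + 1.
  have K0 : 0 < K.
    rewrite /K ltr_wpDl // addr_ge0 // mulr_ge0 ?nsq_ge0 // mulr_ge0 // invr_ge0; exact: ltW.
  have d0 : 0 < e / K by rewrite divr_gt0.
  have [[f' g'] /rangeP hr [/= h1 h2]] := (closure_nsq2 _ _).1 hc _ d0.
  have -> : ell f g x = ell (f - f') (g - g') x.
    by rewrite /ell RlB !ripBl; have := hr _ Kx; rewrite /ell; lra.
  apply: le_trans (ell_bound _ _ _) _.
  have h3 : normsq (Rl l (g - g')) <= q^-1 * normsq (g - g').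
    by rewrite -(ler_pM2l q0) mulrA mulfV ?gt_eqF // mul1r.
  move: h1 h2; rewrite !ltr_pdivlMr // => h1 h2.
  have n1 := nsq_ge0 x; have n2 := nsq_ge0 (Bs x); have n3 := nsq_ge0 (f - f').
  have n4 := nsq_ge0 (g - g').
  have qi : 0 < q^-1 by rewrite invr_gt0.
  set F := normsq (f - f') in h1 n3 *; set G := normsq (g - g') in h2 h3 n4 *.
  have h5 : normsq (Rl l (g - g')) * normsq (Bs x) <= q^-1 * G * normsq (Bs x) by apply: ler_wpM2r.
  pose W := Num.max F G; have FW : F <= W by rewrite le_max lexx.
  have GW : G <= W by rewrite le_max lexx orbT.
  have WK : W * K < e by rewrite /W; case: (leP F G).
  have p1 : F * normsq x <= W * normsq x by apply: ler_wpM2r.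
  have p2 : q^-1 * G * normsq (Bs x) <= q^-1 * W * normsq (Bs x).
    by apply: ler_wpM2r => //; rewrite ler_pM2l.
  have W0 : 0 <= W by apply: le_trans FW.
  rewrite /K in WK; lra.
(* A complement of the range: with u representing [ell] for s_l + c, subtracting from f the
   projection of c u onto the kernel makes [ell] vanish there. *)
- exists [set (x, 0 : H2) | x in schur_ker].
    exists k; apply: has_dim_map hk => [d x y _ _|x _ [] //].
    by congr (_, _); rewrite /= scaler0 addr0.
  move=> [f g]; have [u Vu hu] := ell_riesz f g.
  have [p Kp hp] := fin_proj (c%:C *: u) hk.
  exists (f - p, g), (p, 0); split; last first.
  + by congr (_, _); rewrite /= ?subrK ?addr0.
  + by exists p.
  apply/rangeP => x Kx; have [Vx hx] := Kx.
  have := hu _ Vx; rewrite /bt (rt_sym cs) // hx // add0r => e.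
  have := congr1 (@complex.Re R) (hp _ Kx); rewrite -/(rip _ _) ripBl ripZl e /ell ripBl /=; lra.
Qed.

End BlockOperator.

(** * Spectral gaps *)

Section UniformBoundedness.
Variables (R : realType) (H : hilbertType R).

Definition hnorm (x : H) : R := Num.sqrt (normsq x).

Lemma hnorm_ge0 x : 0 <= hnorm x. Proof. exact: sqrtr_ge0. Qed.
Lemma hnorm_sqr x : hnorm x ^+ 2 = normsq x.
Proof. by rewrite sqr_sqrtr // nsq_ge0. Qed.
Lemma hnormD x y : hnorm (x + y) <= hnorm x + hnorm y.
Proof. by have := ler_normD x y; rewrite !normE -rmorphD lecR. Qed.
Lemma hnormN x : hnorm (- x) = hnorm x.
Proof. by rewrite /hnorm nsqN. Qed.
Lemma rip_hnorm x y : `|rip x y| <= hnorm x * hnorm y.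
Proof.
rewrite -(@ler_pXn2r _ 2) ?nnegrE ?normr_ge0 ?mulr_ge0 ?hnorm_ge0 //.
by rewrite real_normK ?num_real // exprMn !hnorm_sqr rip_CS.
Qed.

(* Sokal's proof: perturb by +- 3^-k x_k / |x_k| with |x_k| >= 4^k. *)
Lemma uniform_bounded (x : nat -> H) :
  (forall f, exists M, forall n, `|rip f (x n)| <= M) -> exists C, forall n, normsq (x n) <= C.
Proof.
move=> hx; apply: contrapT => hC.
have big (r : R) : exists n, r < normsq (x n).
  apply: contrapT => hn; apply: hC; exists r => n.
  by rewrite leNgt; apply/negP => h; apply: hn; exists n.
pose nk k := sval (cid (big ((4 ^+ k) ^+ 2))).
pose u k := x (nk k).
have hu k : 4 ^+ k < hnorm (u k).
  rewrite -(@ltr_pXn2r _ 2) ?nnegrE ?hnorm_ge0 ?exprn_ge0 // hnorm_sqr.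
  exact: svalP (cid (big ((4 ^+ k) ^+ 2))).
have u0 k : 0 < hnorm (u k) by apply: le_lt_trans (hu k); rewrite exprn_ge0.
pose t k : R := 3^-1 ^+ k.
have t0 k : 0 < t k by rewrite exprn_gt0 // invr_gt0.
pose z k := (t k / hnorm (u k))%:C *: u k.
have zn k : hnorm (z k) = t k.
  apply/eqP; rewrite -(@eqrXn2 _ 2) ?hnorm_ge0 //; last exact: ltW.
  by rewrite hnorm_sqr /z nsqZ -hnorm_sqr -exprMn mulfVK // gt_eqF.
have zu k : rip (z k) (u k) = t k * hnorm (u k).
  by rewrite /z ripZl -nsqE -hnorm_sqr; field; rewrite gt_eqF.
(* The two candidates for the product with u k differ by 2 <z k, u k> = 2 t_k |u k|, so one of them
   has modulus at least t_k |u k|. *)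
pose step k y := if t k * hnorm (u k) <= `|rip (y + z k) (u k)| then y + z k else y - z k.
pose y := fix y k := if k is j.+1 then step j (y j) else 0.
have hy k : t k * hnorm (u k) <= `|rip (y k.+1) (u k)|.
  rewrite /= /step; case: ifP => // /negbT; rewrite -ltNge => h.
  have := ler_normB (rip (y k + z k) (u k)) (rip (y k - z k) (u k)).
  have -> : rip (y k + z k) (u k) - rip (y k - z k) (u k) = 2 * rip (z k) (u k).
    by rewrite !ripE; ring.
  have p0 : 0 < 2 * (t k * hnorm (u k)) by rewrite mulr_gt0 // mulr_gt0.
  rewrite zu (gtr0_norm p0); lra.
have dy k : hnorm (y k.+1 - y k) = t k.
  rewrite /= /step; case: ifP => _; rewrite addrC addKr ?hnormN //.
have tS k : t k.+1 = t k / 3 by rewrite /t exprSr.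
have far k n : hnorm (y (k + n)%N - y k) <= (t k - t (k + n)%N) * (3 / 2).
  elim: n => [|n IH]; first by rewrite addn0 !subrr mul0r /hnorm nsq0 sqrtr0.
  have := hnormD (y (k + n).+1 - y (k + n)%N) (y (k + n)%N - y k).
  rewrite subrKA dy addnS tS; lra.
have [|l hl] := @cauchys_cvs _ _ y.
  move=> e e0; have e1 : 0 < Num.min 1 e / 4 by rewrite divr_gt0 // lt_min ltr01 e0.
  have [N hN] : exists N, t N < Num.min 1 e / 4.
    have [N hN] := inv_small e1; exists N; apply: le_lt_trans (hN N (leqnn N)).
    rewrite /t exprVn lef_pV2 ?posrE ?exprn_gt0 ?ltr0n // -natrX ler_nat.
    exact: ltn_expl.
  have near k : (N <= k)%N -> hnorm (y k - y N) < Num.min 1 e / 4 * (3 / 2).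
    move=> /subnKC <-; apply: le_lt_trans (far _ _) _; rewrite ltr_pM2r //.
    have := t0 (N + (k - N))%N; lra.
  exists N => m n /near hm /near hn.
  have hmn : hnorm (y m - y n) < Num.min 1 e.
    have := hnormD (y m - y N) (y N - y n); rewrite subrKA -(hnormN (y N - _)) opprB.
    have : 0 < Num.min 1 e by lra.
    lra.
  rewrite -hnorm_sqr; have h0 := hnorm_ge0 (y m - y n).
  have m1 : Num.min 1 e <= 1 by rewrite ge_min lexx.
  have m2 : Num.min 1 e <= e by rewrite ge_min lexx orbT.
  rewrite expr2; nra.
have close k : hnorm (l - y k) <= t k * (3 / 2).
  apply/ler_addgt0Pr => e e0; have e2 : 0 < e ^+ 2 by rewrite exprn_gt0.
  have [N hN] := hl _ e2; pose m := maxn N k.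
  have h1 := hN m (leq_maxl _ _); rewrite nsqBC -hnorm_sqr ltr_pXn2r ?nnegrE ?hnorm_ge0 ?ltW // in h1.
  have := hnormD (l - y m) (y m - y k); rewrite subrKA.
  have := far k (m - k)%N; rewrite subnKC ?leq_maxr //.
  have := t0 m; lra.
have [M hM] := hx l.
(* All later perturbations together have norm at most (3/2) t_{k+1} = t_k / 2, which spoils only
   half of the bound. *)
have low k : t k * hnorm (u k) / 2 <= M.
  have := hM (nk k); rewrite -/(u k) => hMk.
  have h1 := hy k; have h2 := rip_hnorm (l - y k.+1) (u k).
  have h3 : hnorm (l - y k.+1) * hnorm (u k) <= t k / 2 * hnorm (u k).
    apply: ler_wpM2r; first exact: hnorm_ge0.
    by apply: le_trans (close k.+1) _; rewrite tS; lra.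
  have h4 : `|rip (y k.+1) (u k)| <= `|rip l (u k)| + `|rip (l - y k.+1) (u k)|.
    by rewrite (_ : rip (y k.+1) _ = rip l (u k) - rip (l - y k.+1) (u k)) ?ler_normB // ripBl; ring.
  lra.
have [k hk] : exists k : nat, 2 * M < k%:R by exists (Num.truncn (2 * M)).+1; apply: truncnS_gt.
(* The index 3 k is used because (4/3)^3 >= 2, so (4/3)^(3 k) >= 2^k > k. *)
have := low (3 * k)%N; have := hu (3 * k)%N => h1 h2.
have h3 : t (3 * k)%N * 4 ^+ (3 * k) < t (3 * k)%N * hnorm (u (3 * k)%N) by rewrite ltr_pM2l.
have h4 : k%:R <= t (3 * k)%N * 4 ^+ (3 * k).
  rewrite /t -exprMn exprM; apply: le_trans (_ : 2 ^+ k <= _).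
    by rewrite -natrX ler_nat ltnW // ltn_expl.
  by apply: lerXn2r; rewrite ?nnegrE //; lra.
lra.
Qed.

End UniformBoundedness.

(** * Closed range, the spectral gap around zero, and finite codimension *)

Section Gap.
Variables (R : realType) (H : hilbertType R) (s : sform R H) (c : R).
Hypothesis cs : cform s c.
Local Notation V := (fdom s).
Let K := res s c.

Definition form_ker : set H := [set x | V x /\ forall z, V z -> rt s x z = 0].
Definition form_eq (x f : H) := V x /\ forall z, V z -> rt s x z = rip f z.

Lemma form_ker_eq x : form_ker x <-> form_eq x 0.
Proof. by split=> -[Vx h]; split=> // z Vz; rewrite h // rip0l. Qed.

Lemma form_eq_res u : form_eq (K u) (u - c%:C *: K u).
Proof.
split=> [|z Vz]; first exact: resV.
by have := @resE _ _ _ _ cs u _ Vz; rewrite /bt !ripE -/K; lra.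
Qed.

Lemma form_eq_lin d x y f g : form_eq x f -> form_eq y g -> form_eq (d *: x + y) (d *: f + g).
Proof.
move=> [Vx hx] [Vy hy]; split=> [|z Vz]; first exact: (cf_sesq cs).1.2.
have Viz : V ('i *: z) by apply: (cf_VZ cs).
have ix : rt s x ('i *: z) = rip f ('i *: z) by apply: hx.
have e : s x z = '[f, z].
  apply: complex_ext; first exact: hx.
  by rewrite -(rt_i cs) // ix Im_ip.
rewrite /rt ((cf_sesq cs).2 d x y z Vx Vy Vz).1 e ReD -/(rt _ y z) hy //.
by rewrite ripDl /rip ipZl.
Qed.

Lemma form_ker_sub : lin_subspace form_ker.
Proof.
split=> [|d x y /form_ker_eq hx /form_ker_eq hy]; apply/form_ker_eq.
  split=> [|z Vz]; first exact: (pf_0 (pf_bt cs)).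
  by rewrite /rt (cf_0l cs) // rip0l.
have := form_eq_lin d hx hy; rewrite scaler0 addr0; exact.
Qed.

Lemma form_eq_sym x f y g : form_eq x f -> form_eq y g -> rip f y = rip x g.
Proof. by move=> [Vx hx] [Vy hy]; rewrite -hx // (rt_sym cs) // hy // ripC. Qed.

(** The vectors u - c K u are values of the operator ([form_eq_res]), so this says that the
    orthogonal complement of the range lies in the kernel. *)
Lemma ker_of_orth x : (forall u, rip x (u - c%:C *: K u) = 0) -> form_ker x.
Proof.
move=> h; have e : x = c%:C *: K x.
  apply: rip_ext => u; have := h u; rewrite ripBr !ripZr ripZl (res_sym cs); lra.
apply/form_ker_eq; have := form_eq_res (c%:C *: x).
have -> : K (c%:C *: x) = x.
  by rewrite /K (rlinZ _ _ (res_rlin cs)) -/K -e.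
by rewrite subrr.
Qed.

Section ClosedRange.
Variable k : nat.
Hypothesis ker_fin : has_dim form_ker k.
Hypothesis range_closed : forall (fn : nat -> H) f,
  (forall n, exists x, form_eq x (fn n)) -> cvs fn f -> exists x, form_eq x f.

(** Project f onto the closed range. The remainder lies in the kernel, to which both f and its
    projection are orthogonal, so it is zero. *)
Lemma range_perp f : (forall x, form_ker x -> rip f x = 0) -> exists x, form_eq x f.
Proof.
move=> hf; pose L : set H := [set g | exists x, form_eq x g].
have sL : lin_subspace L.
  split=> [|d g g' [x hx] [x' hx']]; last by exists (d *: x + x'); apply: form_eq_lin.
  by exists 0; apply/form_ker_eq; case: form_ker_sub.
have [p [x hx] hp] := projection f sL (fun u y hu cu => range_closed hu cu).
have kr : form_ker (f - p).
  by apply: ker_of_orth => u; rewrite /rip hp //; exists (K u); apply: form_eq_res.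
have : normsq (f - p) = 0.
  have hk := (form_ker_eq _).1 kr.
  by rewrite nsqE (ripBl f p) hf // (form_eq_sym hx hk) rip0r subrr.
by move/nsq_eq0/subr0_eq => ->; exists x.
Qed.

(** Otherwise there are x_n orthogonal to the kernel with |S x_n| = 1 and |x_n|^2 > n. They are
    weakly bounded: modulo the kernel every g equals S y, and <g, x_n> = <y, S x_n>. This
    contradicts uniform boundedness. *)
Lemma gap_bound : exists2 C : R, 0 < C & forall x f, form_eq x f ->
  (forall y, form_ker y -> rip x y = 0) -> normsq x <= C * normsq f.
Proof.
apply: contrapT => hC.
have bad (n : nat) : exists p : H * H, [/\ form_eq p.1 p.2,
    forall y, form_ker y -> rip p.1 y = 0, normsq p.2 = 1 & n%:R < normsq p.1].
  apply: contrapT => hn; apply: hC; exists n.+1%:R; first by rewrite ltr0n.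
  move=> x f hx px; rewrite leNgt; apply/negP => lt; apply: hn.
  have [f0|f0] := eqVneq f 0.
    have kx : form_ker x by apply/form_ker_eq; rewrite -f0.
    have x0 : normsq x = 0 by rewrite nsqE px.
    by move: lt; rewrite x0 f0 nsq0 mulr0 ltxx.
  have n0 := nsq_gt0 f0; pose r := (hnorm f)^-1.
  have r2 : r ^+ 2 = (normsq f)^-1 by rewrite /r exprVn hnorm_sqr.
  exists (r%:C *: x, r%:C *: f); split=> /=.
  - have := form_eq_lin r%:C hx ((form_ker_eq 0).1 form_ker_sub.1).
    by rewrite !addr0.
  - by move=> y ky; rewrite ripZl px // mulr0.
  - by rewrite nsqZ r2 mulVf // gt_eqF.
  - rewrite nsqZ r2 mulrC ltr_pdivlMr //; apply: le_lt_trans lt.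
    by rewrite ler_pM2r // ler_nat.
pose p n := sval (cid (bad n)).
have hp n : [/\ form_eq (p n).1 (p n).2, forall y, form_ker y -> rip (p n).1 y = 0,
    normsq (p n).2 = 1 & n%:R < normsq (p n).1] := svalP (cid (bad n)).
have [g|C hCn] := @uniform_bounded _ _ (fun n => (p n).1).
  have [q kq hq] := fin_proj g ker_fin.
  have [y hy] : exists y, form_eq y (g - q).
    by apply: range_perp => x kx; rewrite /rip hq.
  exists (hnorm y) => n; have [h1 h2 h3 _] := hp n.
  have -> : rip g (p n).1 = rip y (p n).2.
    rewrite -(form_eq_sym hy h1) ripBl (ripC q) h2 // subr0 //.
  apply: le_trans (rip_hnorm _ _) _.
  by rewrite /hnorm h3 sqrtr1 mulr1.
have [n hn] : exists n : nat, C < n%:R by exists (Num.truncn C).+1; apply: truncnS_gt.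
have [_ _ _ h] := hp n; have := hCn n; lra.
Qed.

Lemma level_ker r F x : level s c r F -> form_ker x -> form_ker (F x).
Proof.
move=> hF [Vx hx]; have xE : x = c%:C *: K x.
  have := res_uniq cs (f := c%:C *: x) Vx.
  rewrite (rlinZ _ _ (res_rlin cs)) => h; apply/esym/h => z Vz.
  by rewrite /bt hx // add0r ripZl.
have e : F x = c%:C *: K (F x).
  by rewrite {1}xE (rlinZ _ _ (op_lin (lv_proj hF))) (lvK cs hF).
apply/form_ker_eq; have := form_eq_res (c%:C *: F x).
by rewrite /K (rlinZ _ _ (res_rlin cs)) -/K -e subrr.
Qed.

Lemma form_ker_quad x : form_ker x -> quad s x = 0.
Proof. by move=> [Vx hx]; rewrite quad_rt hx. Qed.

(* The kernel lies between two levels r < 0 < r'. *)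
Lemma level_ker_fix r F x : level s c r F -> 0 < r -> form_ker x -> F x = x.
Proof.
move=> hF r0 kx; have kF := level_ker hF kx.
have kd : form_ker (x - F x) by apply: lin_subspaceB => //; apply: form_ker_sub.
have F0 : F (x - F x) = 0 by rewrite (lvB hF) (lv_idem hF) subrr.
have := lv_ge hF kd.1 F0; rewrite form_ker_quad // => h.
have := nsq_ge0 (x - F x) => n0; apply/esym/subr0_eq/nsq_eq0.
by apply/eqP; rewrite eq_le n0 andbT; nra.
Qed.
Lemma level_ker_0 r F x : level s c r F -> r <= 0 -> form_ker x -> F x = 0.
Proof.
move=> hF r0 kx; have kF := level_ker hF kx.
apply/eqP/negPn/negP => Fx0; have := lv_lt hF (lv_idem hF x) Fx0.
by rewrite form_ker_quad //; have := nsq_ge0 (F x); nra.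
Qed.

Lemma level_comm r r' F F' x : level s c r F -> level s c r' F' -> F (F' x) = F' (F x).
Proof.
move=> hF hF'; apply: (lv_comm hF'); [exact: op_lin (lv_proj hF) | exact: oproj_bnd (lv_proj hF)|].
by move=> y; rewrite (lvK cs hF).
Qed.

Lemma level_mono r r' F F' x : level s c r F -> level s c r' F' -> r <= r' ->
  F' (F x) = F x.
Proof.
move=> hF hF' rr; apply/esym/subr0_eq; set z := _ - _.
have Fz : F z = z by rewrite /z (lvB hF) (level_comm _ hF hF') (lv_idem hF).
have F'z : F' z = 0 by rewrite /z (lvB hF') (lv_idem hF') subrr.
have Vz : V z by rewrite -Fz; apply: (lvV cs hF).
apply/eqP/negPn/negP => z0; have := lv_lt hF Fz z0; have := lv_ge hF' Vz F'z.
have := nsq_ge0 z; nra.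
Qed.

(** Between the levels |s[y]| <= r |y|^2. Polarising with x and g = f / r, where f = S x, gives 4
    |f|^2 / r <= r (2 |x|^2 + 2 |g|^2), which is |f| <= r |x|. *)
Lemma middle_norm r F F' x : 0 < r -> level s c (- r) F -> level s c r F' ->
  F x = 0 -> F' x = x -> exists2 f, form_eq x f &
  [/\ F f = 0, F' f = f & normsq f <= r ^+ 2 * normsq x].
Proof.
move=> r0 hF hF' Fx F'x; have [u Fu xE] := lv_dom hF' F'x.
have Fu0 : F u = 0.
  by apply: (res_inj cs); rewrite -(lvK cs hF) xE.
exists (u - c%:C *: x); first by rewrite -xE; apply: form_eq_res.
set f := u - _; have Ff : F f = 0.
  by rewrite /f (lvB hF) (rlinZ _ _ (op_lin (lv_proj hF))) Fx Fu0 scaler0 subrr.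
have F'f : F' f = f.
  by rewrite /f (lvB hF') (rlinZ _ _ (op_lin (lv_proj hF'))) F'x Fu.
split=> //; have pb := pf_bt cs.
have Y y : F y = 0 -> F' y = y -> V y /\ `|quad s y| <= r * normsq y.
  move=> h1 h2; have Vy : V y by rewrite -h2; apply: (lvV cs hF').
  split=> //; rewrite ler_norml -mulNr (lv_ge hF) //=.
  have [->|y0] := eqVneq y 0; last by apply/ltW/(lv_lt hF').
  by rewrite nsq0 mulr0 /quad (cf_0l cs) //; exact: (pf_0 pb).
have [Vx _] := Y x Fx F'x.
pose g := r^-1%:C *: f.
have Fg : F g = 0 by rewrite /g (rlinZ _ _ (op_lin (lv_proj hF))) Ff scaler0.
have F'g : F' g = g by rewrite /g (rlinZ _ _ (op_lin (lv_proj hF'))) F'f.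
have [Vg _] := Y g Fg F'g.
have F1 : F (x + g) = 0 by rewrite (rlinD _ _ (op_lin (lv_proj hF))) Fx Fg addr0.
have F2 : F' (x + g) = x + g by rewrite (rlinD _ _ (op_lin (lv_proj hF'))) F'x F'g.
have F3 : F (x - g) = 0 by rewrite (lvB hF) Fx Fg subr0.
have F4 : F' (x - g) = x - g by rewrite (lvB hF') F'x F'g.
have [_ b1] := Y _ F1 F2; have [_ b2] := Y _ F3 F4.
have xf : rt s x g = rip f g.
  by have [_ h] : form_eq x f by [rewrite /f -xE; apply: form_eq_res]; apply: h.
have qD : quad s (x + g) - quad s (x - g) = 4 * rt s x g.
  rewrite !(quad_bt s c) (pf_qD pb) // (pf_qB pb) // nsqD nsqB /bt; ring.
move: b1 b2; rewrite !ler_norml => /andP[_ b1] /andP[b2 _].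
have e1 : rip f g = r^-1 * normsq f by rewrite /g ripZr nsqE.
have e2 : normsq g = r^-1 ^+ 2 * normsq f by rewrite /g nsqZ.
have h : 4 * (r^-1 * normsq f) <= r * (2 * normsq x + 2 * (r^-1 ^+ 2 * normsq f)).
  rewrite -e1 -xf -qD -e2; rewrite nsqD in b1; rewrite nsqB in b2; lra.
have ri : r * r^-1 = 1 by rewrite mulfV // gt_eqF.
have h2 : r * (4 * (r^-1 * normsq f)) <= r * (r * (2 * normsq x + 2 * (r^-1 ^+ 2 * normsq f))).
  by rewrite ler_pM2l.
have e3 : r * (4 * (r^-1 * normsq f)) = 4 * normsq f.
  by rewrite mulrCA [r * (_ * _)]mulrA ri mul1r.
have e4 : r * (r * (2 * normsq x + 2 * (r^-1 ^+ 2 * normsq f))) =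
   2 * (r ^+ 2 * normsq x) + 2 * ((r * r^-1) ^+ 2 * normsq f) by ring.
rewrite e3 e4 ri expr1n mul1r in h2; lra.
Qed.

(** For small e the spectral subspace between -e and e is just the kernel, by comparing [gap_bound]
    with [middle_norm]. *)
Lemma spectral_gap F : level s c 0 F -> exists2 e : R, 0 < e &
  (forall x, F x = x -> quad s x <= - e * normsq x) /\
  (forall x, V x -> F x = 0 -> (forall y, form_ker y -> rip x y = 0) ->
     e * normsq x <= quad s x).
Proof.
move=> hF; have [C C0 hC] := gap_bound.
(* With C e^2 = 1/2, a vector x between the levels and orthogonal to the kernel has |x|^2 <= C |S
   x|^2 <= |x|^2 / 2, so it is zero. *)
pose e := Num.sqrt ((2 * C)^-1).
have e0 : 0 < e by rewrite sqrtr_gt0 invr_gt0 mulr_gt0.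
have eC : C * e ^+ 2 = 1 / 2.
  by rewrite sqr_sqrtr ?invr_ge0 ?mulr_ge0 ?ltW //; field; rewrite gt_eqF.
have [Fn hn] := level_exists cs (- e); have [Fp hp] := level_exists cs e.
have mid x : Fn x = 0 -> Fp x = x -> form_ker x.
  move=> h1 h2; have [q kq hq] := fin_proj x ker_fin.
  have kn : Fn q = 0 by apply: level_ker_0 hn _ kq; lra.
  have kp : Fp q = q by apply: level_ker_fix hp _ kq.
  have [] := @middle_norm e Fn Fp (x - q) e0 hn hp.
  - by rewrite (lvB hn) h1 kn subrr.
  - by rewrite (lvB hp) h2 kp.
  move=> f hf [_ _ nf].
  have := hC _ _ hf => /(_ _) hh.
  have {}hh : normsq (x - q) <= C * normsq f.
    by apply: hh => y ky; rewrite /rip hq.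
  have : normsq (x - q) <= C * (e ^+ 2 * normsq (x - q)).
    by apply: le_trans hh _; rewrite ler_pM2l.
  rewrite mulrA eC => h3; have : normsq (x - q) = 0.
    by apply/eqP; rewrite eq_le nsq_ge0 andbT; lra.
  by move=> /nsq_eq0/subr0_eq ->.
have F_Fn x : F x = x -> Fn x = x.
  move=> Fx; apply/esym/subr0_eq; set z := _ - _.
  have z1 : Fn z = 0 by rewrite /z (lvB hn) (lv_idem hn) subrr.
  have z2 : F z = z by rewrite /z (lvB hF) (level_comm _ hF hn) Fx.
  have z3 : Fp z = z by rewrite -z2 (level_mono _ hF hp) // ltW.
  have kz := mid _ z1 z3.
  by rewrite -z2; apply: level_ker_0 hF _ kz.
exists e => //; split=> [x /F_Fn Fx|x Vx Fx px].
  have [->|x0] := eqVneq x 0; last exact/ltW/(lv_lt hn).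
  by rewrite nsq0 mulr0 /quad (cf_0l cs) //; exact: (pf_0 (pf_bt cs)).
apply: (lv_ge hp) => //.
have Fnx : Fn x = 0.
  have h : F (Fn x) = Fn x by apply: level_mono hn hF _; lra.
  by rewrite -h (level_comm _ hF hn) Fx (rlin0 (op_lin (lv_proj hn))).
have ky : form_ker (Fp x).
  apply: mid; last exact: lv_idem hp _.
  by rewrite (level_comm _ hn hp) Fnx (rlin0 (op_lin (lv_proj hp))).
apply: nsq_eq0; rewrite nsqE (op_sym (lv_proj hp)) (lv_idem hp).
exact: px.
Qed.

End ClosedRange.

Section FiniteCodim.
Variables (L : set H) (k : nat) (e : R).
Hypothesis L_fin : has_dim L k.
Hypothesis e_gt0 : 0 < e.
Hypothesis s_pos : forall x, V x -> (forall y, L y -> '[x, y] = 0) -> e * normsq x <= quad s x.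

Lemma sub_fin (L1 L2 : set H) n : lin_subspace L1 -> L1 `<=` L2 -> has_dim L2 n -> finite_dim L1.
Proof.
move=> s1 L12 h2; have [[j _ hj]|[L3 L31 h3]] := dim_dichotomy n.+1 s1; first by exists j.
have := has_dim_le h3 h2 (subset_trans L31 L12); by rewrite ltnn.
Qed.

Lemma level_ran_sub r F : level s c r F -> lin_subspace [set x | F x = x].
Proof.
move=> hF; split=> [|d x y /= hx hy]; first exact: rlin0 (op_lin (lv_proj hF)).
by rewrite (lvE cs hF) hx hy.
Qed.

Lemma level_fin r F : r <= e -> level s c r F -> finite_dim [set x | F x = x].
Proof.
move=> re hF; have [[j _ hj]|[L' L'F h']] := dim_dichotomy k.+1 (level_ran_sub hF).
  by exists j.
have [x [Lx x0 px]] := orth_vector h' L_fin (ltnSn k).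
have Fx : F x = x := L'F _ Lx; have Vx : V x by rewrite -Fx; apply: (lvV cs hF).
have := lv_lt hF Fx x0; have := s_pos Vx px; have := nsq_ge0 x; nra.
Qed.

Lemma fin_codim_ker : finite_dim form_ker.
Proof.
have [F hF] := level_exists cs e; have [n hn] := level_fin (lexx e) hF.
apply: sub_fin hn; first exact: form_ker_sub.
by move=> x kx; apply: level_ker_fix hF _ kx.
Qed.

Lemma bt_orth r F y w : level s c r F -> F y = y -> V w -> F w = 0 -> bt s c y w = 0.
Proof.
move=> hF Fy Vw Fw; have [u Fu <-] := lv_dom hF Fy.
by rewrite (resE cs) // -Fu (op_sym (lv_proj hF)) Fw rip0r.
Qed.

(** The level projection F at e splits the problem: its range is finite-dimensional, and on its
    kernel s >= e, where Riesz applies. *)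
Lemma fin_codim_solve f : (forall x, form_ker x -> rip f x = 0) -> exists x, form_eq x f.
Proof.
move=> hf; have [F hF] := level_exists cs e; have [n hn] := level_fin (lexx e) hF.
have pb := pf_bt cs; have lF := op_lin (lv_proj hF); have e0 : 0 < e := e_gt0.
have rt_orth y w : F y = y -> V w -> F w = 0 -> rt s y w = 0.
  move=> Fy Vw Fw; have := bt_orth hF Fy Vw Fw.
  by rewrite /bt -{2}Fy (op_sym (lv_proj hF)) Fw rip0r mulr0 addr0.
have [y hy] : exists y, form_eq y (F f).
  (* Z is the image of the range of F under S. The part r of F f orthogonal to Z lies in the kernel
     of s, hence is orthogonal to f and vanishes. *)
  pose Z : set H := [set g | exists2 y, F y = y & form_eq y g].
  have sZ : lin_subspace Z.
    split=> [|d g g' [y Fy hy] [y' Fy' hy']].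
      by exists 0; [exact: rlin0 lF | apply/form_ker_eq; case: form_ker_sub].
    by exists (d *: y + y'); [rewrite (lvE cs hF) Fy Fy' | apply: form_eq_lin].
  have eqU y g g' : form_eq y g -> form_eq y g' -> g = g'.
    move=> [_ h1] [_ h2]; apply: (dense_ip_eq (cf_dense cs)) => z Vz.
    have h w : V w -> rip g w = rip g' w by move=> Vw; rewrite -h1 // -h2.
    by apply: ip_rip; apply: h => //; apply: (cf_VZ cs).
  have ZF : Z `<=` [set x | F x = x].
    move=> g [y Fy hy]; have [u Fu yE] := lv_dom hF Fy.
    have hy' := form_eq_res u; rewrite /K yE in hy'.
    by rewrite /= (eqU _ _ _ hy hy') (lvB hF) (rlinZ _ _ lF) Fy Fu.
  have [m hm] := sub_fin sZ ZF hn.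
  have [g [y Fy hy] hr] := fin_proj (F f) hm.
  set r := F f - g in hr.
  have Fr : F r = r.
    rewrite /r (lvB hF) (lv_idem hF); congr (_ - _); apply: ZF; by exists y.
  have Vr : V r by rewrite -Fr; apply: (lvV cs hF).
  have kr : form_ker r.
    split=> // z Vz; have VF := lvV cs hF z; have Vd := pf_VB pb Vz VF.
    have -> : rt s r z = rt s r (F z) + rt s r (z - F z).
      have ez : z = F z + (z - F z) by rewrite addrC subrK.
    by rewrite {1}ez /rt (cf_Dr cs) // ReD.
    rewrite (rt_orth r (z - F z)) // ?addr0; last by rewrite (lvB hF) (lv_idem hF) subrr.
    have [u Fu uE] := lv_dom hF (lv_idem hF z).
    have hu := form_eq_res u; rewrite /K uE in hu.
    rewrite (rt_sym cs) // hu.2 // ripC /rip hr //.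
    by exists (F z) => //; apply: (lv_idem hF).
  have r0 : normsq r = 0.
    rewrite nsqE {1}/r ripBl (op_sym (lv_proj hF)) Fr hf // ripC /rip hr ?subrr //.
    by exists y.
  by exists y; move/nsq_eq0/subr0_eq : r0 => ->.
(* On V' the form s itself is equivalent to the shifted form, hence complete, and represents the
   remaining part f - F f. *)
pose V' : set H := [set x | V x /\ F x = 0].
have lo x : V' x -> e * normsq x <= rt s x x by move=> [Vx Fx]; apply: (lv_ge hF).
have pV : posform V' (rt s).
  split=> [|r x z [Vx Fx] [Vz Fz]|r x z w [Vx _] [Vz _] [Vw _]|x z [Vx _] [Vz _]|x V'x].
  - by split; [exact: (pf_0 pb) | exact: rlin0 lF].
  - by split; [exact: (pf_V pb) | rewrite lF Fx Fz scaler0 addr0].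
  - by rewrite /rt ((cf_sesq cs).2 _ _ _ _ Vx Vz Vw).1 ReD ReMr.
  - exact: (rt_sym cs).
  - by apply: le_trans (lo _ V'x); rewrite mulr_ge0 ?nsq_ge0 // ltW.
have [u Vu hu|r x z _ _|x V'x|x [Vx Fx] hx] := @riesz _ _ _ _ pV _ (rip (f - F f)) (normsq (f - F f) / e).
- have c1 : 0 < 1 + `|c| / e by rewrite ltr_wpDr // divr_ge0 // ltW.
  have VuB i j : V' (u i - u j) by apply: (pf_VB pV).
  have bt_le w : V' w -> bt s c w w <= (1 + `|c| / e) * rt s w w.
    move=> V'w; rewrite /bt -nsqE; have h1 := lo _ V'w.
    have h2 : c * normsq w <= `|c| * normsq w by apply: ler_wpM2r (ler_norm _); apply: nsq_ge0.
    have h3 : `|c| * normsq w <= `|c| / e * rt s w w.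
      by rewrite -mulrA; apply: ler_wpM2l => //; rewrite mulrC ler_pdivlMr // mulrC.
    lra.
  have [|x Vx hx] := bt_complete cs (u := u) (fun n => (Vu n).1).
    move=> d d0; have d1 : 0 < d / (1 + `|c| / e) by rewrite divr_gt0.
    have [N hN] := hu _ d1; exists N => i j Ni Nj.
    by apply: le_lt_trans (bt_le _ (VuB i j)) _; rewrite mulrC -ltr_pdivlMr //; apply: hN.
  have cx : cvs u x.
    move=> d /hx[N hN]; exists N => m /hN; apply: le_lt_trans.
    by apply: (bt_ge cs); apply: (pf_VB pb) => //; apply: (Vu m).1.
  have Fx : F x = 0.
    apply: cvs_unique (cvs_cst 0).
    have := cvs_rbnd lF (oproj_bnd (lv_proj hF)) cx.
    by under eq_fun do rewrite (Vu _).2.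
  exists x => // d d0; have c2 : 0 < 1 + `|c| by rewrite ltr_wpDr.
  have d1 : 0 < d / (1 + `|c|) by rewrite divr_gt0.
  have [N hN] := hx _ d1; exists N => m /hN; rewrite ltr_pdivlMr // mulrC => h.
  have := quad_le_bt cs (pf_VB pb (Vu m).1 Vx); rewrite quad_rt => h2.
  by apply: le_lt_trans (ler_norm _) (le_lt_trans h2 h).
- by rewrite !ripE; ring.
- apply: le_trans (rip_CS _ _) _; rewrite -mulrA; apply: ler_wpM2l; first exact: nsq_ge0.
  by rewrite mulrC ler_pdivlMr // mulrC; apply: lo.
exists (y + x); have [Vy hy'] := hy; split; first exact: (pf_VD pb).
move=> z Vz; have VF := lvV cs hF z; have Vd := pf_VB pb Vz VF.
have Fd : F (z - F z) = 0 by rewrite (lvB hF) (lv_idem hF) subrr.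
rewrite /rt (cf_Dl cs) // ReD -/(rt s y z) -/(rt s x z) hy' //.
have -> : rt s x z = rt s x (F z) + rt s x (z - F z).
  have ez : z = F z + (z - F z) by rewrite addrC subrK.
    by rewrite {1}ez /rt (cf_Dr cs) // ReD.
rewrite (rt_sym cs Vx VF) rt_orth // ?(lv_idem hF) // add0r hx //.
have -> : rip (f - F f) (z - F z) = rip (f - F f) z.
  rewrite [LHS]ripBr -(op_sym (lv_proj hF)) (lvB hF) (lv_idem hF) subrr rip0l subr0 //.
by rewrite -ripDl addrC subrK.
Qed.

End FiniteCodim.
End Gap.

Import HBNNSimple.

(** * Spectral measures *)

Section IntegralCongruence.
Variables (d : measure_display) (T : measurableType d) (R : realType).

(** [spectral_measure] integrates against a bare set function. Simple functions see it on measurable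
    sets only, so a genuine measure can be substituted. *)
Lemma eq_setfun_integral (m1 m2 : set T -> \bar R) (f : T -> \bar R) :
  (forall A, measurable A -> m1 A = m2 A) -> integral m1 setT f = integral m2 setT f.
Proof.
move=> h; rewrite /integral.
have e (k : {nnsfun T >-> R}) : sintegral m1 k = sintegral m2 k.
  by rewrite /sintegral; apply: eq_fsbigr => r _; rewrite h.
congr (ereal_sup _ - ereal_sup _)%E; apply: eq_imagel => k _; exact: e.
Qed.

End IntegralCongruence.

Section ProjectionValuedMeasures.
Variables (R : realType) (H : hilbertType R) (E : set R -> H -> H).

Record pvm : Prop := {
  pv_idem : forall W x, measurable W -> E W (E W x) = E W x ;
  pv_sym : forall W x y, measurable W -> '[E W x, y] = '[x, E W y] ;
  pv_setT : forall x, E setT x = x ;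
  pv_sigma : forall (F : (set R)^nat) x,
    (forall n, measurable (F n)) -> trivIset setT F ->
    cvs (series (fun n => E (F n) x)) (E (\bigcup_n F n) x) }.

Hypothesis pE : pvm.

Lemma pvm_lin W d x y : measurable W -> E W (d *: x + y) = d *: E W x + E W y.
Proof. by move=> mW; apply: ip_ext => z; rewrite !(pv_sym pE) // !ipE !(pv_sym pE). Qed.

Lemma pvm_oproj W : measurable W -> oproj (E W).
Proof.
move=> mW; split=> [r x y|x y|x]; first exact: pvm_lin.
  by rewrite /rip (pv_sym pE).
exact: pv_idem pE _ _ mW.
Qed.

(** A convergent series with constant terms has zero terms. *)
Lemma pvm_set0 x : E set0 x = 0.
Proof.
have := @pv_sigma pE (fun=> set0) x (fun=> measurable0) (@trivIset_set0 _ _ setT).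
move=> /cvs_cauchys h; apply: nsq_eq0; apply/eqP; rewrite eq_le nsq_ge0 andbT.
apply/ler_addgt0Pr => e e0; rewrite add0r; have [N hN] := h _ e0.
have := hN N.+1 N (leqnSn N) (leqnn N).
by rewrite /series /= big_nat_recr //= addrAC subrr add0r => /ltW.
Qed.

Lemma pvm_add A B x : measurable A -> measurable B -> A `&` B = set0 ->
  E (A `|` B) x = E A x + E B x.
Proof.
move=> mA mB AB; apply: cvs_unique (_ : cvs (series (fun n => E (bigcup2 A B n) x)) _) _.
  rewrite -bigcup2E; apply: (pv_sigma pE) => [n|]; last by rewrite -trivIset_bigcup2.
  by rewrite /bigcup2; case: ifP => // _; case: ifP => // _; apply: measurable0.
move=> e e0; exists 2%N => n /subnKC <-; set m := (n - 2)%N.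
suff -> : series (fun n => E (bigcup2 A B n) x) (2 + m)%N = E A x + E B x.
  by rewrite subrr nsq0.
elim: m => [|m IH].
  by rewrite addn0 /series /= !big_nat_recr //= big_geq // add0r.
by rewrite addnS seriesSr IH /bigcup2 /= pvm_set0 addr0.
Qed.

(** For y = E(B) x, contractivity of the projection of the union reads |E(A) y|^2 + |y|^2 <=
    |y|^2. *)
Lemma pvm_disj A B x : measurable A -> measurable B -> A `&` B = set0 -> E A (E B x) = 0.
Proof.
move=> mA mB AB; have mAB : measurable (A `|` B) by apply: measurableU.
have hA := pvm_oproj mA; have hB := pvm_oproj mB; have hAB := pvm_oproj mAB.
have := oproj_le (E B x) hAB; rewrite (oproj_nsq _ hAB) pvm_add // ripDl.
rewrite -(oproj_nsq _ hA) -(oproj_nsq _ hB) (op_idem hB) => h.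
apply: nsq_eq0; apply/eqP; rewrite eq_le nsq_ge0 andbT; lra.
Qed.

Lemma pvm_setI A B x : measurable A -> measurable B -> E A (E B x) = E (A `&` B) x.
Proof.
move=> mA mB; have mI := measurableI _ _ mA mB.
have mD1 := measurableD mA mB; have mD2 := measurableD mB mA.
have eA y : E A y = E (A `&` B) y + E (A `\` B) y.
  rewrite -{1}(setUIDK A B); apply: pvm_add => //.
  by apply/seteqP; split=> // z [[_ zB] [_ /(_ zB)]].
have eB y : E B y = E (A `&` B) y + E (B `\` A) y.
  rewrite -{1}(setUIDK B A) [B `&` A]setIC; apply: pvm_add => //.
  by apply/seteqP; split=> // z [[zA _] [_ /(_ zA)]].
have lA := op_lin (pvm_oproj mA).
rewrite eB (rlinD _ _ lA) [E A (E (B `\` A) x)]pvm_disj //; last first.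
  by apply/seteqP; split=> // z [zA [_ /(_ zA)]].
rewrite addr0 eA (pv_idem pE) // [E (A `\` B) _]pvm_disj ?addr0 //.
by apply/seteqP; split=> // z [[_ zB] [_ zB']]; apply: zB.
Qed.

Lemma pvm_series_nsq (F : (set R)^nat) x n : (forall n, measurable (F n)) -> trivIset setT F ->
  normsq (series (fun n => E (F n) x) n) = \sum_(0 <= i < n) normsq (E (F i) x) /\
  (forall m, (n <= m)%N -> rip (E (F m) x) (series (fun n => E (F n) x) n) = 0).
Proof.
move=> mF tF; have dj i j : i != j -> rip (E (F i) x) (E (F j) x) = 0.
  move=> ij; rewrite (op_sym (pvm_oproj (mF i))) pvm_disj ?rip0r //.
  by move/trivIsetP : tF; apply.
elim: n => [|n [IH1 IH2]].
  by rewrite /series /= !big_geq // nsq0; split=> // m _; rewrite rip0r.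
have e : series (fun n => E (F n) x) n.+1 = series (fun n => E (F n) x) n + E (F n) x.
  exact: seriesSr.
rewrite e; split=> [|m nm].
  by rewrite nsqD ripC IH2 // mulr0 addr0 IH1 big_nat_recr.
by rewrite ripDr IH2 1?ltnW // add0r dj // gtn_eqF.
Qed.

Definition pvm_fun x (W : set R) : \bar R :=
  if pselect (measurable W) then (normsq (E W x))%:E else 0%E.

Lemma pvm_funE x W : measurable W -> pvm_fun x W = (normsq (E W x))%:E.
Proof. by move=> mW; rewrite /pvm_fun; case: pselect. Qed.

Lemma pvm_measure_subproof x : exists mu : {measure set R -> \bar R},
  forall W, measurable W -> mu W = (normsq (E W x))%:E.
Proof.
have h0 : pvm_fun x set0 = 0%E by rewrite pvm_funE // pvm_set0 nsq0.
have h1 W : (0 <= pvm_fun x W)%E by rewrite /pvm_fun; case: pselect => // mW; rewrite lee_fin nsq_ge0.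
have h2 : semi_sigma_additive (pvm_fun x).
  move=> F mF tF mU; rewrite pvm_funE //.
  under eq_fun => n.
    under eq_bigr do rewrite pvm_funE //.
    rewrite sumEFin; over.
  apply: cvg_EFin; first by apply: nearW.
  apply/(@cvgrPdist_lt _ R) => e e0.
  have [N hN] := cvs_nsq (pv_sigma pE x mF tF) e0; exists N => // n /hN /=.
  by rewrite (pvm_series_nsq x n mF tF).1 distrC.
pose mu : {measure set R -> \bar R} :=
  HB.pack (pvm_fun x) (isMeasure.Build _ _ _ (pvm_fun x) h0 h1 h2).
by exists mu => W mW; apply: pvm_funE.
Qed.

Definition pm x := sval (cid (pvm_measure_subproof x)).
Lemma pmE x W : measurable W -> pm x W = (normsq (E W x))%:E.
Proof. exact: svalP (cid (pvm_measure_subproof x)) W. Qed.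

Lemma pvm_integral x (f : R -> \bar R) :
  integral (fun W => (complex.Re '[E W x, x])%:E) setT f = integral (pm x) setT f.
Proof.
apply: eq_setfun_integral => A mA; rewrite pmE // (oproj_nsq _ (pvm_oproj mA)) //.
Qed.

End ProjectionValuedMeasures.

Section Projections.
Variables (R : realType) (H : hilbertType R).

Lemma oproj_lim (Q : nat -> H -> H) (L : H -> H) : (forall n, oproj (Q n)) ->
  (forall m n x, (m <= n)%N -> Q m (Q n x) = Q m x) ->
  (forall x, cvs (fun n => Q n x) (L x)) -> oproj L.
Proof.
move=> hQ mQ hL; have QL m x : Q m (L x) = Q m x.
  apply: cvs_unique (cvs_rbnd (op_lin (hQ m)) (oproj_bnd (hQ m)) (hL x)) _.
  by move=> e e0; exists m => n mn; rewrite mQ // subrr nsq0.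
split=> [r x y|x y|x].
- apply: cvs_unique (hL _) _; have := cvsD (cvsZ r (hL x)) (hL y).
  by under eq_fun do rewrite -(op_lin (hQ _)).
- apply: lim_eq (cvs_rip y (hL x)) _ => e /(cvs_rip x (hL y))[N hN].
  by exists N => n /hN; rewrite (op_sym (hQ n)) [rip y _]ripC [rip (L y) x]ripC.
- by apply: cvs_unique (hL _) _; have := hL x; under eq_fun do rewrite -QL.
Qed.

Lemma oproj_leP (P Q : H -> H) : oproj P -> oproj Q ->
  (forall x, normsq (P x) <= normsq (Q x)) -> forall x, P (Q x) = P x.
Proof.
move=> hP hQ h x; apply/eqP; rewrite eq_sym -subr_eq0 -(rlinB _ _ (op_lin hP)); apply/eqP/nsq_eq0.
apply/eqP; rewrite eq_le nsq_ge0 andbT; apply: le_trans (h _) _.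
by rewrite (rlinB _ _ (op_lin hQ)) (op_idem hQ) subrr nsq0.
Qed.

(** On the range of either projection the norm bound leaves no room for the other one, so they are
    orthogonal. *)
Lemma oproj_add (P Q : H -> H) : oproj P -> oproj Q ->
  (forall x, normsq (P x) + normsq (Q x) <= normsq x) -> oproj (fun x => P x + Q x).
Proof.
move=> hP hQ h.
have QP x : Q (P x) = 0.
  apply: nsq_eq0; have := h (P x); rewrite (op_idem hP); have := nsq_ge0 (Q (P x)); lra.
have PQ x : P (Q x) = 0.
  apply: nsq_eq0; have := h (Q x); rewrite (op_idem hQ); have := nsq_ge0 (P (Q x)); lra.
split=> [r x y|x y|x].
- by rewrite (op_lin hP) (op_lin hQ) scalerDr addrACA.
- by rewrite ripDl ripDr (op_sym hP) (op_sym hQ).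
- by rewrite (rlinD _ _ (op_lin hP)) (rlinD _ _ (op_lin hQ)) (op_idem hP) (op_idem hQ) QP PQ addr0 add0r.
Qed.

(** A projection is determined by its quadratic form, so scalar measures determine the spectral
    projections. *)
Lemma oproj_eq (P Q : H -> H) : oproj P -> oproj Q ->
  (forall x, normsq (P x) = normsq (Q x)) -> forall x, P x = Q x.
Proof.
move=> hP hQ h x.
have PQ : forall y, P (Q y) = P y by apply: oproj_leP => // y; rewrite h.
have QP : forall y, Q (P y) = Q y by apply: oproj_leP => // y; rewrite h.
by rewrite -QP; apply/esym/oproj_ker_le.
Qed.

End Projections.

(** * From the resolution of the identity to projections for Borel sets *)

Section SpectralFamily.
Variables (R : realType) (H : hilbertType R) (K : H -> H) (c : R).
Hypothesis K_lin : rlin K.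
Hypothesis K_sym : forall x y, rip (K x) y = rip x (K y).
Hypothesis K_coer : forall x, normsq (K x) <= rip (K x) x.
Hypothesis K_inj : forall x, K x = 0 -> x = 0.
Local Notation Es := (Et c K_lin K_sym K_coer).

Let Fx x t := normsq (Es t x).

Lemma Fx_nd x : nondecreasing (Fx x).
Proof. by move=> s t; apply: Et_nondecr. Qed.

Lemma Fx_rc x : right_continuous (Fx x).
Proof.
move=> t; apply/(@cvgrPdist_lt _ R) => e e0; have [d d0 hd] := Et_right c K_lin K_sym K_coer t x e0.
have td : t < t + d by lra.
near=> u; have tu : t <= u by near: u; apply: nbhs_right_ge.
have ud : u <= t + d by near: u; apply: nbhs_right_le.
have h1 := Fx_nd x tu; have h2 := Fx_nd x ud; rewrite distrC ger0_norm /Fx; move: h1 h2; rewrite /Fx; lra.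
Unshelve. all: by end_near.
Qed.

Definition Fcum x : cumulative R R :=
  HB.pack (Fx x) (isCumulative.Build R _ R (Fx x) (@Fx_nd x) (@Fx_rc x)).
Definition mF x (W : set R) : \bar R := lebesgue_stieltjes_measure (Fcum x) W.

Lemma mF_itv x a b : a <= b -> mF x `]a, b] = (normsq (Es b x) - normsq (Es a x))%:E.
Proof.
move=> ab; rewrite /mF /lebesgue_stieltjes_measure /measure_extension.
rewrite measurable_mu_extE /=; last exact: is_ocitv.
by rewrite wlength_itv_bnd.
Qed.

Lemma mF_bigcup x (F : (set R)^nat) : (forall n, measurable (F n)) -> trivIset setT F ->
  (\sum_(0 <= i < n) mF x (F i))%E @[n --> \oo] --> mF x (\bigcup_n F n).
Proof.
move=> mF' tF.
exact: (@measure_sigma_additive _ _ _ (lebesgue_stieltjes_measure (Fcum x)) F mF' tF).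
Qed.

Lemma mF_ge0 x W : (0 <= mF x W)%E.
Proof. exact: measure_ge0 (lebesgue_stieltjes_measure (Fcum x)) W. Qed.

(** Exhaustion by ]-c - n, -c + n]: the family vanishes at the left ends and tends to the identity
    at the right ends. *)
Lemma mF_setT x : mF x setT = (normsq x)%:E.
Proof.
pose F n : set R := [set` `]- c - n%:R, - c + n%:R]].
have F_nd : nondecreasing_seq F.
  move=> m n mn; rewrite subsetEset => z; rewrite /F /= !in_itv /=.
  have mn' : m%:R <= n%:R :> R by rewrite ler_nat.
  by move=> /andP[h1 h2]; apply/andP; split; lra.
have FT : \bigcup_n F n = setT.
  apply/seteqP; split=> // z _; exists (Num.truncn `|z + c|).+1 => //=.
  rewrite /F /= in_itv /=; have := truncnS_gt `|z + c|; have := ler_norm (z + c).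
  have := ler_norm (- (z + c)); rewrite normrN => h1 h2 h3; apply/andP; split; lra.
have FE n : mF x (F n) = (normsq (Es (- c + n%:R) x))%:E.
  rewrite mF_itv; last by have := ler0n R n; lra.
  rewrite [Es (- c - _) x]Et_0 ?nsq0 ?subr0 //.
  have := ler0n R n; lra.
have h := @nondecreasing_cvg_mu _ _ _ (lebesgue_stieltjes_measure (Fcum x)) F
  (fun n => @measurable_itv _ _) (@bigcup_measurable _ _ F setT (fun n _ => @measurable_itv _ _)) F_nd.
rewrite FT in h; apply: cvg_unique h _ => //.
rewrite (_ : _ \o F = EFin \o (fun n => normsq (Es (- c + n%:R) x))); last exact/funext.
apply: cvg_EFin; first exact: nearW.
apply/(@cvgrPdist_lt _ R) => e e0; have [t0 ht0] := Et_top c K_lin K_sym K_coer K_inj x e0.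
exists (Num.truncn `|t0 + c|).+1 => // n /= hn.
rewrite (oproj_split x (Et_proj c K_lin K_sym K_coer (- c + n%:R))) addrAC subrr add0r.
rewrite ger0_norm ?nsq_ge0 //; apply: ht0.
have := truncnS_gt `|t0 + c|; have := ler_norm (t0 + c).
have : (Num.truncn `|t0 + c|).+1%:R <= n%:R :> R by rewrite ler_nat.
lra.
Qed.

Lemma mF_setU x A B : measurable A -> measurable B -> A `&` B = set0 ->
  mF x (A `|` B) = (mF x A + mF x B)%E.
Proof.
move=> mA mB AB.
exact: (@measureU _ _ _ (lebesgue_stieltjes_measure (Fcum x)) A B mA mB AB).
Qed.

Lemma mF_le x A : measurable A -> (mF x A <= (normsq x)%:E)%E.
Proof.
by move=> mA; rewrite -mF_setT -(setUv A) mF_setU ?setICr //; [exact: leeDl (mF_ge0 _ _) | exact: measurableC].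
Qed.

(** The property carried through the Dynkin argument: a single projection produces the mass of W for
    all x simultaneously. *)
Definition has_proj (W : set R) := exists P,
  [/\ oproj P, commutes K P & forall x, (normsq (P x))%:E = mF x W].

Lemma has_proj_setT : has_proj setT.
Proof.
by exists id; split=> [|//|x]; [split | rewrite mF_setT].
Qed.

Lemma has_proj_ocitv W : ocitv W -> has_proj W.
Proof.
case/ocitvP => [->|[[a b] /= ab ->]].
  exists (fun=> 0); split=> [|C lC _ _ x|x].
  - exact: oproj_0.
  - exact: rlin0 lC.
  - by rewrite nsq0; apply/esym; exact: (@measure0 _ _ _ (lebesgue_stieltjes_measure (Fcum x))).
have hE := Et_proj c K_lin K_sym K_coer; have hab := ltW ab.
have ab' x : Es a (Es b x) = Es a x by apply: Et_mono.
have ba' x : Es b (Es a x) = Es a x by apply: Et_mono'.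
exists (fun x => Es b x - Es a x); split.
- split=> [r x y|x y|x].
  + by rewrite !(op_lin (hE _)) scalerBr opprD addrACA.
  + by rewrite ripBl ripBr !(op_sym (hE _)).
  + by rewrite !(rlinB _ _ (op_lin (hE _))) ab' ba' !(op_idem (hE _)) subrr subr0.
- by move=> C lC bC hC x; rewrite (rlinB _ _ lC) !(Et_comm _ _ _ _ _ lC bC hC).
- by move=> x; rewrite mF_itv // (oproj_diff _ (hE a) (hE b)).
Qed.

Lemma has_proj_setC W : measurable W -> has_proj W -> has_proj (~` W).
Proof.
move=> mW [P [hP cP mP]]; exists (fun x => x - P x); split.
- exact: oprojC.
- by move=> C lC bC hC x; rewrite (rlinB _ _ lC) (cP _ lC bC hC).
- move=> x; have := mF_setT x; rewrite -(setUv W) mF_setU ?setICr //; last exact: measurableC.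
  rewrite -mP (oproj_split x hP); case: (mF x (~` W)) => [r| |] //.
  by rewrite -EFinD => -[] /addrI ->.
Qed.

(** The partial masses never exceed |x|^2, which forces each new projection to be orthogonal to the
    sum of the earlier ones ([oproj_add]). The partial sums are then increasing projections and
    converge strongly. *)
Lemma proj_bigcup (F : (set R)^nat) (P : nat -> H -> H) :
  (forall n, measurable (F n)) -> trivIset setT F ->
  (forall n, [/\ oproj (P n), commutes K (P n) & forall x, (normsq (P n x))%:E = mF x (F n)]) ->
  exists2 L, [/\ oproj L, commutes K L & forall x, (normsq (L x))%:E = mF x (\bigcup_n F n)] &
    forall x, cvs (series (fun n => P n x)) (L x).
Proof.
move=> mF' tF hP; have mU : measurable (\bigcup_n F n) by apply: bigcup_measurable.
pose s x n := \sum_(0 <= i < n) normsq (P i x).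
have sE x : (EFin \o s x) n @[n --> \oo] --> mF x (\bigcup_n F n).
  rewrite (_ : EFin \o _ = fun n => (\sum_(0 <= i < n) mF x (F i))%E).
    exact: mF_bigcup.
  apply/funext => n; rewrite /= -sumEFin; apply: eq_bigr => i _.
  by case: (hP i).
have s_incr x m n : (m <= n)%N -> s x m <= s x n.
  move=> /subnKC <-; elim: (n - m)%N => [|k IH]; first by rewrite addn0.
  by rewrite addnS /s big_nat_recr //=; apply: le_trans IH _; rewrite lerDl nsq_ge0.
have [l lE] : exists l : H -> R, forall x, mF x (\bigcup_n F n) = (l x)%:E.
  exists (fun x => fine (mF x (\bigcup_n F n))) => x; rewrite fineK // ge0_fin_numE ?mF_ge0 //.
  by apply: le_lt_trans (mF_le x mU) _; apply: ltry.
have sl x (e : R) : 0 < e -> exists N, forall n, (N <= n)%N -> `|s x n - l x| < e.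
  move=> e0; have := sE x; rewrite lE => /fine_cvgP[_ /(@cvgrPdist_lt _ R) /(_ _ e0)].
  by case=> N _ hN; exists N => n /hN /=; rewrite distrC.
have l_le x : l x <= normsq x by rewrite -lee_fin -lE mF_le.
have s_le x n : s x n <= normsq x.
  apply: le_trans (l_le x); apply: lim_ge (sl x) _; exists n => m; exact: s_incr.
pose Q n x := \sum_(0 <= i < n) P i x.
have QS n : Q n.+1 = fun x => Q n x + P n x by apply/funext => x; rewrite /Q big_nat_recr.
have hQ n : [/\ oproj (Q n), commutes K (Q n) & forall x, normsq (Q n x) = s x n].
  elim: n => [|n [IH1 IH2 IH3]].
    have -> : Q 0%N = fun=> 0 by apply/funext => x; rewrite /Q big_geq.
    split=> [|C lC _ _ x|x]; [exact: oproj_0 | exact: rlin0 lC | by rewrite nsq0 /s big_geq].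
  have [hPn cPn _] := hP n.
  have h x : normsq (Q n x) + normsq (P n x) <= normsq x.
    by have := s_le x n.+1; rewrite /s big_nat_recr //= IH3.
  have hQ1 := oproj_add IH1 hPn h.
  have QP x : rip (Q n x) (P n x) = 0.
    rewrite ripC (op_sym hPn).
    suff -> : P n (Q n x) = 0 by rewrite rip0r.
    apply: nsq_eq0; have := h (Q n x); rewrite (op_idem IH1); have := nsq_ge0 (P n (Q n x)); lra.
  rewrite QS; split=> // [C lC bC hC x|x].
    by rewrite (rlinD _ _ lC) (IH2 _ lC bC hC) (cPn _ lC bC hC).
  by rewrite nsqD QP mulr0 addr0 IH3 /s big_nat_recr.
have mQ m n x : (m <= n)%N -> Q m (Q n x) = Q m x.
  have [pm _ em] := hQ m; have [pn _ en] := hQ n.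
  by move=> mn; apply: oproj_leP => // y; rewrite em en s_incr.
have /choice[L hL] x : exists y, cvs (fun n => Q n x) y.
  by apply: incr_proj => [n|m n z mn]; [case: (hQ n) | apply: mQ].
have oQ n : oproj (Q n) by case: (hQ n).
exists L; last exact: hL.
split.
- exact: oproj_lim oQ mQ hL.
- move=> C lC bC hC x; apply: cvs_unique (hL _).
  have := cvs_rbnd lC bC (hL x); congr cvs; apply/funext => n.
  by have [_ cQ _] := hQ n; rewrite cQ.
- move=> x; rewrite lE; congr EFin; apply: lim_eq (sl x).
  move=> e /(cvs_nsq (hL x))[N hN]; exists N => n /hN.
  by have [_ _ ->] := hQ n.
Qed.

Lemma has_proj_bigcup (F : (set R)^nat) : (forall n, measurable (F n)) -> trivIset setT F ->
  (forall n, has_proj (F n)) -> has_proj (\bigcup_n F n).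
Proof.
by move=> mF' tF /choice[P hP]; have [L hL _] := proj_bigcup mF' tF hP; exists L.
Qed.

Lemma has_projP W : measurable W -> has_proj W.
Proof.
apply: (@dynkin_induction _ R (@ocitv R)) => //.
- exact: ocitvI.
- exact: has_proj_setT.
- exact: has_proj_ocitv.
- exact: has_proj_setC.
- exact: has_proj_bigcup.
Qed.

Definition spm (W : set R) : H -> H :=
  if pselect (measurable W) is left h then sval (cid (has_projP h)) else fun=> 0.

Lemma spmP W : measurable W ->
  [/\ oproj (spm W), commutes K (spm W) & forall x, (normsq (spm W x))%:E = mF x W].
Proof. by move=> mW; rewrite /spm; case: pselect => // h; case: cid. Qed.

Lemma spm_proj W : measurable W -> oproj (spm W).
Proof. by case/spmP. Qed.
Lemma spm_uniq W P : measurable W -> oproj P ->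
  (forall x, (normsq (P x))%:E = mF x W) -> forall x, spm W x = P x.
Proof.
move=> mW hP h; have [hS _ hS'] := spmP mW; apply: oproj_eq => // y.
by have := hS' y; rewrite -h => -[].
Qed.

Lemma spm_setT x : spm setT x = x.
Proof.
by apply: (@spm_uniq _ id) => // y; rewrite mF_setT.
Qed.

Lemma spm_sigma (F : (set R)^nat) x : (forall n, measurable (F n)) -> trivIset setT F ->
  cvs (series (fun n => spm (F n) x)) (spm (\bigcup_n F n) x).
Proof.
move=> mF' tF; have [L [hL _ hL'] h] := proj_bigcup mF' tF (fun n => spmP (mF' n)).
by rewrite (@spm_uniq _ L) //; apply: bigcup_measurable.
Qed.

Lemma spm_itv x a b : a <= b -> normsq (spm `]a, b] x) = normsq (Es b x) - normsq (Es a x).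
Proof.
move=> ab; have [_ _ h] := @spmP [set` `]a, b]] (measurable_itv _).
by have := h x; rewrite mF_itv // => -[].
Qed.

End SpectralFamily.

(** * Evaluation of Stieltjes integrals by squeezed increments *)

Section StieltjesIntegral.
Variables (R : realType) (m : {measure set R -> \bar R}) (f F G : R -> R) (s0 : R).
Hypothesis m_itv : forall s t, s0 <= s -> s <= t -> m [set` `]s, t]] = (F t - F s)%:E.
Hypothesis m_low : m [set` `]-oo, s0]] = 0%E.
Hypothesis f_meas : measurable_fun setT f.
Hypothesis f_ge0 : 0 <= f s0.
Hypothesis f_mono : forall s t, s0 <= s -> s <= t -> f s <= f t.
Hypothesis f_lip : forall T, exists C, forall s t, s0 <= s -> s <= t -> t <= T -> f t - f s <= C * (t - s).
Hypothesis G0 : G s0 = 0.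
Hypothesis FG : forall s t, s0 <= s -> s <= t ->
  f s * (F t - F s) <= G t - G s <= f t * (F t - F s).

Let J s t := (\int[m]_(u in `]s, t]) (f u)%:E)%E.

Let mEf (D : set R) : measurable_fun D (EFin \o f).
Proof. by apply/measurable_EFinP; apply: measurable_funTS. Qed.

Let f_pos s t u : s0 <= s -> [set` `]s, t]] u -> (0 <= (f u)%:E)%E.
Proof.
move=> hs; rewrite /= in_itv /= => /andP[su _]; rewrite lee_fin.
by apply: le_trans f_ge0 (f_mono _ _) => //; lra.
Qed.

Let J_bounds s t : s0 <= s -> s <= t ->
  [/\ J s t \is a fin_num, f s * (F t - F s) <= fine (J s t) & fine (J s t) <= f t * (F t - F s)].
Proof.
move=> hs st; have cE r : (\int[m]_(u in `]s, t]) r%:E = (r * (F t - F s))%:E)%E.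
  by rewrite integral_cst ?m_itv // EFinM.
have h1 : ((f s * (F t - F s))%:E <= J s t)%E.
  rewrite -cE; apply: ge0_le_integral => // u => [_|].
  - by rewrite lee_fin; apply: le_trans f_ge0 (f_mono _ _).
  - by move=> /=; rewrite in_itv /= => /andP[su _]; rewrite lee_fin f_mono // ltW.
have h2 : (J s t <= (f t * (F t - F s))%:E)%E.
  rewrite -cE; apply: ge0_le_integral => // u; first exact: f_pos.
  rewrite /= in_itv /= => /andP[su ut]; rewrite lee_fin f_mono //; lra.
have h3 : J s t \is a fin_num.
  by apply: fin_real; rewrite (lt_le_trans (ltNyr _) h1) (le_lt_trans h2 (ltry _)).
by split=> //; rewrite -lee_fin fineK.
Qed.

Let J_add s t : s0 <= s -> s <= t -> (J s0 t = J s0 s + J s t)%E.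
Proof.
move=> hs st; rewrite /J -ge0_integral_setU //.
- congr integral; apply/seteqP; split=> z /=; rewrite !in_itv /=.
    by move=> /andP[h1 h2]; case: (lerP z s) => h; [left | right]; apply/andP.
  by move=> [|] /andP[h1 h2]; apply/andP; split; lra.
- move=> u; rewrite /= !in_itv /= => -[|] /andP[h1 h2]; rewrite lee_fin;
  apply: le_trans f_ge0 (f_mono _ _) => //; lra.
- apply/disj_set2P/seteqP; split=> // z; rewrite /= !in_itv /= => -[/andP[_ h1] /andP[h2 _]]; lra.
Qed.

Let Phi t := fine (J s0 t) - G t.

Let Phi_step T : exists C, forall s t, s0 <= s -> s <= t -> t <= T ->
  `|Phi t - Phi s| <= C * (t - s) * (F t - F s).
Proof.
have [C hC] := f_lip T; exists C => s t hs st tT.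
have [f1 _ _] := J_bounds (lexx _) hs; have [f2 h1 h2] := J_bounds hs st.
have e : fine (J s0 t) = fine (J s0 s) + fine (J s t) by rewrite (J_add hs st) fineD.
have /andP[h3 h4] := FG hs st; have h5 := hC _ _ hs st tT.
have F0 : 0 <= F t - F s by rewrite -lee_fin -m_itv.
have h6 := ler_wpM2r F0 h5; rewrite /Phi e ler_norml; apply/andP; split; lra.
Qed.

(** Over one step the integral and G differ by at most C times the step length times the increment
    of F. Over n + 1 equal steps this telescopes to O(1 / n). *)
Let Phi_0 T : s0 <= T -> Phi T = 0.
Proof.
move=> hT; have [C hC] := Phi_step T.
have P0 : Phi s0 = 0.
  have [_ h1 h2] := J_bounds (lexx s0) (lexx s0); rewrite /Phi G0; lra.
have key n : `|Phi T| <= C * ((T - s0) * n.+1%:R^-1) * (F T - F s0).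
  set p := n.+1%:R^-1.
  have pn : n.+1%:R * p = 1 by rewrite /p divff.
  have p0 : 0 <= p by rewrite /p.
  pose q i := s0 + (T - s0) * p * i%:R.
  have q0 : q 0%N = s0 by rewrite /q mulr0 addr0.
  have qn : q n.+1 = T by rewrite /q -mulrA [p * _]mulrC pn mulr1; ring.
  have qS i : q i.+1 = q i + (T - s0) * p by rewrite /q -natr1; ring.
  have qm i : q i <= q i.+1 by rewrite qS lerDl mulr_ge0 // subr_ge0.
  have ql i : s0 <= q i by elim: i => [|i IH]; [rewrite q0 | apply: le_trans IH (qm i)].
  have qT i : (i <= n.+1)%N -> q i <= T.
    rewrite -qn => /subnKC <-; elim: (n.+1 - i)%N => [|k IH]; first by rewrite addn0.
    by rewrite addnS; apply: le_trans IH (qm _).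
  suff h i : (i <= n.+1)%N -> `|Phi (q i)| <= C * ((T - s0) * p) * (F (q i) - F s0).
    by have := h n.+1 (leqnn _); rewrite qn.
  elim: i => [|i IH] hi; first by rewrite q0 P0 normr0 subrr mulr0.
  have := hC _ _ (ql i) (qm i) (qT _ hi); have := IH (ltnW hi).
  have -> : q i.+1 - q i = (T - s0) * p by rewrite qS addrC addKr.
  have := ler_normD (Phi (q i)) (Phi (q i.+1) - Phi (q i)).
  rewrite addrC subrK; set u := `|Phi (q i.+1)|; set v := `|Phi (q i)|; lra.
apply/eqP; rewrite -normr_eq0 eq_le normr_ge0 andbT; apply/ler_addgt0Pr => e e0; rewrite add0r.
set c := C * (T - s0) * (F T - F s0).
have [n hn] : exists n, `|c| * n.+1%:R^-1 <= e.
  exists (Num.truncn (`|c| / e)); rewrite ler_pdivrMr // mulrC -ler_pdivrMr //.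
  exact/ltW/truncnS_gt.
apply: le_trans (key n) _; apply: le_trans hn; set p := _^-1.
have p0 : 0 <= p by rewrite /p.
have -> : C * ((T - s0) * p) * (F T - F s0) = c * p by rewrite /c; ring.
by apply: ler_wpM2r => //; apply: ler_norm.
Qed.

(** On bounded intervals G is the integral by [Phi_0], and nothing lies below s0. Convergence is in
    the extended reals, so the integral may be infinite. *)
Lemma stieltjes_cvg : (G (s0 + n%:R))%:E @[n --> \oo] --> (\int[m]_u (f u)%:E)%E.
Proof.
have -> : (\int[m]_u (f u)%:E = \int[m]_(u in `]s0, +oo[) (f u)%:E)%E.
  have -> : [set: R] = `]-oo, s0] `|` `]s0, +oo[.
    by apply/seteqP; split=> // z _ /=; rewrite !in_itv /= andbT; case: (lerP z s0); [left | right].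
  rewrite integral_setU //; last first.
    by apply/disj_set2P/seteqP; split=> // z; rewrite /= !in_itv /= andbT => -[h1 h2]; lra.
  by rewrite null_set_integral // add0e.
pose D n : set R := [set` `]s0, s0 + n%:R]].
have -> : [set` `]s0, +oo[] = \bigcup_n D n.
  apply/seteqP; split=> z; rewrite /= in_itv /= andbT.
    move=> h; exists (Num.truncn `|z - s0|).+1 => //=; rewrite /D /= in_itv /=.
    have := truncnS_gt `|z - s0|; have := ler_norm (z - s0) => h1 h2; apply/andP; split; lra.
  by move=> [n _]; rewrite /D /= in_itv /= => /andP[].
have GE n : (G (s0 + n%:R))%:E = (\int[m]_(u in D n) (f u)%:E)%E.
  have hn : s0 <= s0 + n%:R by rewrite lerDl.
  have [fn _ _] := J_bounds (lexx s0) hn.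
  by rewrite -[RHS]fineK //; congr EFin; apply/esym/eqP; rewrite -subr_eq0; apply/eqP/(Phi_0 hn).
rewrite (funext GE); apply: ge0_nondecreasing_set_cvg_integral => //.
- move=> i j ij; rewrite subsetEset => z; rewrite /D /= !in_itv /= => /andP[h1 h2].
  have : i%:R <= j%:R :> R by rewrite ler_nat.
  by move=> h3; apply/andP; split; lra.
- by move=> i; apply: measurable_itv.
- by move=> i u; apply: f_pos.
Qed.

End StieltjesIntegral.

Lemma EFin_lim (R : realType) (s : nat -> R) (l : R) :
  (forall e, 0 < e -> exists N, forall n, (N <= n)%N -> `|s n - l| < e) ->
  (s n)%:E @[n --> \oo] --> l%:E.
Proof.
move=> h; apply: cvg_EFin; first exact: nearW.
apply/(@cvgrPdist_lt _ R) => e /h[N hN]; exists N => // n /hN /=.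
by rewrite distrC.
Qed.

Lemma measurable_shift (R : realType) (c : R) : measurable_fun setT (fun u : R => u + c).
Proof.
exact: (@measurable_funD _ R R setT id (cst c) (@measurable_id _ _ _) (@measurable_cst _ _ _ _ _ _)).
Qed.

Section FiniteIntegral.
Variables (R : realType) (mu : {measure set R -> \bar R}).
Hypothesis mu_fin : (mu setT < +oo)%E.

Let intc (r : R) : (\int[mu]_u r%:E = r%:E * mu setT)%E.
Proof. exact: integral_cst. Qed.

Lemma fin_integral_le (f g : R -> R) (a b : R) : measurable_fun setT f -> measurable_fun setT g ->
  0 <= a -> 0 <= b -> (forall u, 0 <= g u) -> (forall u, 0 <= f u <= a * g u + b) ->
  (\int[mu]_u (g u)%:E < +oo)%E -> (\int[mu]_u (f u)%:E < +oo)%E.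
Proof.
move=> mf mg a0 b0 g0 fg hg.
have mEf : measurable_fun setT (EFin \o f) by apply/measurable_EFinP.
have mEg : measurable_fun setT (EFin \o g) by apply/measurable_EFinP.
have mag : measurable_fun setT (EFin \o (fun u => a * g u)).
  by apply/measurable_EFinP; apply: measurable_funM.
apply: (@le_lt_trans _ _ (\int[mu]_u ((a * g u)%:E + b%:E))%E).
  apply: ge0_le_integral => // [u _||u _].
  - by rewrite lee_fin; have /andP[] := fg u.
  - exact: emeasurable_funD.
  - by rewrite -EFinD lee_fin; have /andP[] := fg u.
rewrite ge0_integralD //; last by move=> u _; rewrite lee_fin mulr_ge0.
under eq_integral do rewrite EFinM.
rewrite ge0_integralZl_EFin //; last by move=> u _; rewrite lee_fin.
apply: lte_add_pinfty; first by rewrite lte_mul_pinfty.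
by rewrite [X in (X < _)%E](intc b) lte_mul_pinfty.
Qed.

(** Subtraction needs integrability of u + c, which |v| <= v^2 + 1 provides on a finite measure. *)
Lemma integral_shift (c : R) : (\int[mu]_u ((u + c) ^+ 2)%:E < +oo)%E ->
  (\int[mu]_u u%:E = \int[mu]_u (u + c)%:E - c%:E * mu setT)%E.
Proof.
move=> h; have ms := @measurable_shift R c.
have i1 : mu.-integrable setT (EFin \o (fun u => u + c)).
  apply/integrableP; split; first exact/measurable_EFinP.
  apply: (@fin_integral_le (fun u => `|u + c|) (fun u => (u + c) ^+ 2) 1 1) h => //.
  - exact: measurableT_comp.
  - exact: measurable_funX.
  - by move=> u; apply: sqr_ge0.
  - move=> u; rewrite normr_ge0 mul1r /=.
    by rewrite -real_normK ?num_real //; have := normr_ge0 (u + c); nra.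
have i2 : mu.-integrable setT (EFin \o cst c).
  apply/integrableP; split; first exact/measurable_EFinP/measurable_cst.
  by rewrite [X in (X < _)%E](intc `|c|) lte_mul_pinfty.
rewrite -intc -integralB //.
by apply: eq_integral => u _ /=; rewrite -EFinB addrK.
Qed.

End FiniteIntegral.

(** * Existence of the spectral measure of a closed form *)

Section FormSpectralMeasure.
Variables (R : realType) (H : hilbertType R) (t : sform R H) (c : R).
Hypothesis ct : cform t c.
Let K := res t c.
Let Kl : rlin K := res_rlin ct.
Let Ks : forall x y, rip (K x) y = rip x (K y) := res_sym ct.
Let Kc : forall x, normsq (K x) <= rip (K x) x := res_coer' ct.
Let Ki : forall x, K x = 0 -> x = 0 := @res_inj _ _ _ _ ct.
Let Es := Et c Kl Ks Kc.
Let E := spm c Kl Ks Kc Ki.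

Lemma res_CS x y : rip (K x) y ^+ 2 <= rip (K x) x * rip (K y) y.
Proof.
have := pf_CS (pf_bt ct) (resV ct x) (resV ct y).
by rewrite !(resE ct) -?(res_sym ct) //; apply: resV.
Qed.

Lemma form_pvm : pvm E.
Proof.
split=> [W x mW|W x y mW|x|F x mF tF].
- exact: op_idem (spm_proj _ _ _ _ _ mW) _.
- have [hP cP _] := spmP c Kl Ks Kc Ki mW.
  have h := op_sym hP; apply: ip_rip; rewrite -/E h //; congr (rip _ _).
  by have := commutesE ct (op_lin hP) cP 'i y 0; rewrite (rlin0 (op_lin hP)) !addr0.
- exact: spm_setT.
- exact: spm_sigma.
Qed.

Let U_ex s x : exists u, Es s u = u /\ K u = Es s x.
Proof.
have [h|h] := ltrP 0 (s + c); last first.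
  by exists 0; rewrite /Es !(Et_0 _ _ _ h) (rlin0 Kl).
have [u h1 h2] := res_onto ct (Et_proj c Kl Ks Kc s) (Et_comm c Kl Ks Kc s) (m := s + c)
  (fun y => Et_eq h) (op_idem (Et_proj c Kl Ks Kc s) x).
by exists u.
Qed.
(** U s x is (T + c) E_s x, available for every x. Then <U s x, E_s x> and |U s x|^2 are the
    Stieltjes primitives of u + c and (u + c)^2. *)
Let U s x := sval (cid (U_ex s x)).
Let EU s x : Es s (U s x) = U s x. Proof. by rewrite /U; case: cid => u []. Qed.
Let KU s x : K (U s x) = Es s x. Proof. by rewrite /U; case: cid => u []. Qed.

Let Kinj x y : K x = K y -> x = y.
Proof. by move=> h; apply/eqP; rewrite -subr_eq0; apply/eqP/Ki; rewrite (rlinB _ _ Kl) h subrr. Qed.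

Let EK s x : K (Es s x) = Es s (K x). Proof. exact: Et_K. Qed.
Let Emono s r x : s <= r -> Es s (Es r x) = Es s x. Proof. exact: Et_mono. Qed.
Let Emono' s r x : s <= r -> Es r (Es s x) = Es s x. Proof. exact: Et_mono'. Qed.
Let EB s x y : Es s (x - y) = Es s x - Es s y.
Proof. exact: rlinB (op_lin (Et_proj c Kl Ks Kc s)). Qed.
Let Esym s x y : rip (Es s x) y = rip x (Es s y).
Proof. exact: op_sym (Et_proj c Kl Ks Kc s) _ _. Qed.
Let Eid s x : Es s (Es s x) = Es s x.
Proof. exact: op_idem (Et_proj c Kl Ks Kc s) _. Qed.

Let EUU s r x : s <= r -> Es s (U r x) = U s x.
Proof. by move=> sr; apply: Kinj; rewrite EK !KU Emono. Qed.

(** The differences w of U and z of E satisfy K w = z and live between the levels s and r.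
    Orthogonality reduces the increments to <w, z> and |w|^2, and there s + c <= T + c <= r + c. *)
Let increment s r x : - c <= s -> s <= r ->
  [/\ (s + c) * (normsq (Es r x) - normsq (Es s x)) <= rip (U r x) (Es r x) - rip (U s x) (Es s x),
      rip (U r x) (Es r x) - rip (U s x) (Es s x) <= (r + c) * (normsq (Es r x) - normsq (Es s x)),
      (s + c) ^+ 2 * (normsq (Es r x) - normsq (Es s x)) <= normsq (U r x) - normsq (U s x) &
      normsq (U r x) - normsq (U s x) <= (r + c) ^+ 2 * (normsq (Es r x) - normsq (Es s x))].
Proof.
move=> cs; rewrite le_eqVlt => /orP[/eqP <-|sr']; first by rewrite !subrr !mulr0.
have sr := ltW sr'; have rc : 0 < r + c by lra.
have [w wE] : exists w, w = U r x - U s x by eexists.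
have [z zE] : exists z, z = Es r x - Es s x by eexists.
have Kw : K w = z by rewrite wE zE (rlinB _ _ Kl) !KU.
have Ew : Es r w = w by rewrite wE EB EU -{1}(EU s) Emono' // EU.
have Ez : Es r z = z by rewrite zE EB Eid Emono'.
have ew : Es s w = 0 by rewrite wE EB EUU // EU subrr.
have ez : Es s z = 0 by rewrite zE EB Emono // Eid subrr.
have hz : normsq (Es r x) - normsq (Es s x) = normsq z.
  have -> : Es r x = Es s x + z by rewrite zE addrC subrK.
  by rewrite nsqD Esym ez rip0r; ring.
have hw : normsq (U r x) - normsq (U s x) = normsq w.
  have -> : U r x = U s x + w by rewrite wE addrC subrK.
  by rewrite nsqD -(EU s) Esym ew rip0r; ring.
have o1 : rip w (Es s x) = 0 by rewrite -Esym ew rip0l.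
have o2 : rip (U s x) z = 0 by rewrite -EU Esym ez rip0r.
have hzw : rip (U r x) (Es r x) - rip (U s x) (Es s x) = rip w z.
  have -> : Es r x = Es s x + z by rewrite zE addrC subrK.
  have -> : U r x = U s x + w by rewrite wE addrC subrK.
  by rewrite ripDl !ripDr o1 o2; ring.
rewrite hz hw hzw.
have h1 : normsq w <= (r + c) * rip w z by have := Et_eq rc Ew; rewrite Kw ripC.
have w0 := nsq_ge0 w; have z0 := nsq_ge0 z; have wz := rip_CS w z.
have q0 : 0 <= rip w z by rewrite -(pmulr_rge0 _ rc); lra.
have up : rip w z <= (r + c) * normsq z.
  have [|q1] := lerP (rip w z) 0; first by move=> h; apply: le_trans h _; rewrite mulr_ge0 // ltW.
  rewrite -(ler_pM2l q1) -expr2; apply: le_trans wz _.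
  by have := ler_wpM2r z0 h1; lra.
have [sc|sc] := ltrP 0 (s + c); last first.
  have -> : s + c = 0 by lra.
  by rewrite expr2 !mul0r; split=> //; nra.
have h2 : (s + c) * rip w z <= normsq w by have := Et_ker' sc ew; rewrite Kw ripC.
have h3 := Et_ker' sc ez; have h4 := res_CS z w.
have h5 : rip (K z) w = normsq z by rewrite Ks Kw nsqE.
rewrite h5 Kw in h4.
have low : (s + c) * normsq z <= rip w z.
  have [|z1] := lerP (normsq z) 0; first by move=> h; rewrite (_ : normsq z = 0) ?mulr0 //; lra.
  rewrite -(ler_pM2l z1); rewrite (ripC z w) in h4.
  by have := ler_wpM2r q0 h3; have := ler_wpM2l (ltW sc) h4; rewrite expr2; nra.
by split=> //; rewrite expr2; nra.
Qed.

Let m x := pm form_pvm x.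
Let q n : R := - c + n%:R.

Let mE x W : measurable W -> m x W = (normsq (E W x))%:E.
Proof. exact: pmE. Qed.

Let Et_cvs x : cvs (fun n => Es (q n) x) x.
Proof.
move=> e e0; have [t0 ht0] := Et_top c Kl Ks Kc Ki x e0.
exists (Num.truncn `|t0 + c|).+1 => n hn; rewrite nsqBC; apply: ht0.
have := truncnS_gt `|t0 + c|; have := ler_norm (t0 + c).
have : (Num.truncn `|t0 + c|).+1%:R <= n%:R :> R by rewrite ler_nat.
rewrite /q; lra.
Qed.

Let m_itv x s r : - c <= s -> s <= r ->
  m x [set` `]s, r]] = (normsq (Es r x) - normsq (Es s x))%:E.
Proof. by move=> _ sr; rewrite mE ?spm_itv. Qed.

Let Es0 x : Es (- c) x = 0.
Proof. by apply: Et_0; rewrite addNr. Qed.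

Let m_low x : m x [set` `]-oo, - c]] = 0%E.
Proof.
rewrite mE //; congr EFin; apply/eqP; rewrite eq_le nsq_ge0 andbT.
apply/ler_addgt0Pr => e /(Et_cvs x)[N /(_ N (leqnn N))/ltW h]; rewrite add0r; apply: le_trans h.
have qN : - c <= q N by rewrite lerDl.
set A := [set` `]-oo, - c]]; pose B := [set` `](- c), (q N)]].
have hB := pvm_oproj form_pvm (measurable_itv `](- c), (q N)]); have hA := pvm_oproj form_pvm (measurable_itv `]-oo, - c]).
have -> : E A x = E A (x - E B x).
  rewrite (rlinB _ _ (op_lin hA)) (pvm_disj form_pvm) ?subr0 //; first exact: measurable_itv.
  apply/seteqP; split=> // z; rewrite /A /B /= !in_itv /= => -[h1 /andP[h2 _]]; lra.
apply: le_trans (oproj_le _ hA) _.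
have := oproj_split x hB; have := oproj_split x (Et_proj c Kl Ks Kc (q N)).
rewrite (nsqBC _ x) -/(Es _ x) [normsq (E B x)]spm_itv // [Et _ _ _ _ (- c) x]Et_0 ?addNr //.
rewrite nsq0 subr0 -/(Es _ x); lra.
Qed.

Let int1 x : (rip (U (q n) x) (Es (q n) x))%:E @[n --> \oo] --> (\int[m x]_u (u + c)%:E)%E.
Proof.
apply: (@stieltjes_cvg _ (m x) (fun u => u + c) (fun s => normsq (Es s x))
  (fun s => rip (U s x) (Es s x)) (- c)) => //.
- exact: m_itv.
- exact: (measurable_shift c).
- by rewrite addNr.
- by move=> s r _ sr; rewrite lerD2r.
- by exists 1 => s r _ _ _; lra.
- by rewrite Es0 rip0r.
- by move=> s r h1 h2; have [-> -> _ _] := increment x h1 h2.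
Qed.

Let int2 x : (normsq (U (q n) x))%:E @[n --> \oo] --> (\int[m x]_u ((u + c) ^+ 2)%:E)%E.
Proof.
apply: (@stieltjes_cvg _ (m x) (fun u => (u + c) ^+ 2) (fun s => normsq (Es s x))
  (fun s => normsq (U s x)) (- c)) => //.
- exact: m_itv.
- exact: measurable_funX (measurable_shift c).
- by rewrite sqr_ge0.
- by move=> s r h1 h2; rewrite ler_sqr ?nnegrE; lra.
- move=> T; exists (2 * (T + c)) => s r h1 h2 h3; nra.
- apply/eqP; rewrite (_ : U _ x = 0) ?nsq0 //; apply: Ki.
  by rewrite KU Es0.
- by move=> s r h1 h2; have [_ _ -> ->] := increment x h1 h2.
Qed.

Let U_res n u : U (q n) (K u) = Es (q n) u.
Proof. by apply: Kinj; rewrite KU EK. Qed.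

Let int1_res u : (\int[m (K u)]_r (r + c)%:E = (rip u (K u))%:E)%E.
Proof.
apply: cvg_unique (@int1 (K u)) _ => //; apply: EFin_lim => e e0.
have [N hN] := cvs_rip (K u) (Et_cvs u) e0; exists N => n /hN.
by rewrite U_res -Esym Eid.
Qed.

Let int2_res u : (\int[m (K u)]_r ((r + c) ^+ 2)%:E = (normsq u)%:E)%E.
Proof.
apply: cvg_unique (@int2 (K u)) _ => //; apply: EFin_lim => e e0.
by have [N hN] := cvs_nsq (Et_cvs u) e0; exists N => n /hN; rewrite U_res.
Qed.

(** The norms of U (q n) x increase and are bounded by the integral. By orthogonality these vectors
    are Cauchy, and K maps their limit to lim E_{q n} x = x. *)
Let int2_dom x : (\int[m x]_r ((r + c) ^+ 2)%:E < +oo)%E -> exists u, K u = x.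
Proof.
move=> hfin; have fn : (\int[m x]_r ((r + c) ^+ 2)%:E)%E \is a fin_num.
  by rewrite ge0_fin_numE // integral_ge0 // => r _; rewrite lee_fin sqr_ge0.
have := @int2 x; rewrite -(fineK fn); set l := fine _ => /fine_cvgP[_ /(@cvgrPdist_lt _ R) hl].
have inc i j : (i <= j)%N -> normsq (U (q i) x) <= normsq (U (q j) x).
  move=> ij; have qi : - c <= q i by rewrite lerDl.
  have qij : q i <= q j by rewrite lerD2l ler_nat.
  have [_ _ h _] := increment x qi qij; rewrite -subr_ge0; apply: le_trans h.
  by rewrite mulr_ge0 ?sqr_ge0 // subr_ge0; apply: Et_nondecr.
have bnd i : normsq (U (q i) x) <= l.
  apply: (@lim_ge _ (fun n => normsq (U (q n) x))) => [e e0|].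
    by have [N _ hN] := hl e e0; exists N => n /hN /=; rewrite distrC.
  by exists i => n; apply: inc.
have [|u hu] := @cauchys_cvs _ _ (fun n => U (q n) x).
  move=> e e0; have [N hN] := mono_cauchy inc bnd e0.
  have key i j : (N <= i)%N -> (i <= j)%N -> normsq (U (q j) x - U (q i) x) < e.
    move=> Ni ij; have qij : q i <= q j by rewrite lerD2l ler_nat.
    have := oproj_split (U (q j) x) (Et_proj c Kl Ks Kc (q i)).
    rewrite -/(Es _ _) EUU // => h; have := hN j i Ni; lra.
  exists N => i j Ni Nj; have [ij|/ltnW ji] := leqP i j; last exact: key.
  by rewrite nsqBC; apply: key.
exists u; apply: cvs_unique (Et_cvs x); have := cvs_rbnd Kl (K_bnd Kc) hu.
by congr cvs; apply/funext => n; rewrite KU.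
Qed.

Let mT x : m x setT = (normsq x)%:E.
Proof. by rewrite mE // (pv_setT form_pvm). Qed.

Lemma dom_res x : dom (op_of_form t) x <-> exists u, K u = x.
Proof.
split=> [h|[u <-]]; last by have [] := form_op_resK ct u.
by exists (op_of_form t x + c%:C *: x); apply: (form_op_resP ct).
Qed.

Lemma form_spectral_measure : spectral_measure (op_of_form t) E.
Proof.
have fin x : (m x setT < +oo)%E by rewrite mT ltry.
split.
- exact: pv_idem form_pvm.
- exact: pv_sym form_pvm.
- exact: pv_setT form_pvm.
- by move=> F x mF tF; apply/cvsP; apply: pv_sigma form_pvm _ _ mF tF.
- move=> x; rewrite (pvm_integral form_pvm) dom_res -/(m x); split=> [[u <-]|h].
  (* The total mass is finite, so r^2 <= 2 (r + c)^2 + 2 c^2 passes from the shifted integral to the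
     one in the definition; the converse is similar. *)
  + apply: (@fin_integral_le _ _ (fin _) _ (fun r => (r + c) ^+ 2) 2 (2 * c ^+ 2)) => //.
    * exact: measurable_funX (measurable_shift c).
    * by rewrite mulr_ge0 ?sqr_ge0.
    * by move=> u0; apply: sqr_ge0.
    * by move=> u0; rewrite sqr_ge0 /=; have := sqr_ge0 (u0 + 2 * c); nra.
    * by rewrite int2_res ltry.
  + apply: int2_dom.
    apply: (@fin_integral_le _ _ (fin _) _ (fun r => r ^+ 2) 2 (2 * c ^+ 2)) => //.
    * exact: measurable_funX (measurable_shift c).
    * by rewrite mulr_ge0 ?sqr_ge0.
    * by move=> u0; apply: sqr_ge0.
    * by move=> u0; rewrite sqr_ge0 /=; have := sqr_ge0 (u0 - c); nra.
- move=> x /dom_res[u <-]; rewrite (pvm_integral form_pvm) -/(m (K u)).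
  rewrite (integral_shift (fin _) (c := c)) ?int1_res ?int2_res ?ltry //.
  have [_ /= e] := form_op_resK ct u; rewrite mT -EFinM -EFinB e.
  apply: complex_ext; first by rewrite -/(rip _ _) ripBl ripZl nsqE.
  (* The value is required as a complex number: its imaginary part vanishes because K is symmetric
     and <u, K u> is real. *)
  rewrite Im_ip ripBl ripZl /= -/K.
  have i0 v : rip v ('i *: v) = 0 by rewrite -Im_ip ip_nsq.
  have : rip u ('i *: K u) = - rip u ('i *: K u).
    by rewrite {1}(res_i ct) -Ks -rip_iC ripC.
  rewrite i0; lra.
Qed.

End FormSpectralMeasure.

(** * Uniqueness of the negative spectral subspace *)

Section SpectralUniqueness.
Variables (R : realType) (H : hilbertType R) (t : sform R H) (c : R).
Hypothesis ct : cform t c.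
Let K := res t c.
Let T := op_of_form t.
Variable E : set R -> H -> H.
Hypothesis TE : spectral_measure T E.

Lemma spectral_pvm : pvm E.
Proof.
case: TE => h1 h2 h3 h4 _ _; split=> // F x mF tF; exact/cvsP/h4.
Qed.
Let pE := spectral_pvm.
Let m x := pm pE x.
Let mE x W : measurable W -> m x W = (normsq (E W x))%:E.
Proof. exact: pmE. Qed.

Let m_fin x : (m x setT < +oo)%E.
Proof. by rewrite mE // (pv_setT pE) ltry. Qed.

Let domE x : dom T x <-> (\int[m x]_r (r ^+ 2)%:E < +oo)%E.
Proof. by rewrite (sm_dom TE) (pvm_integral pE). Qed.

Let m_id : measurable_fun setT (fun r : R => r).
Proof. exact: measurable_id. Qed.

Let int_id x : dom T x -> (m x).-integrable setT EFin.
Proof.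
move=> /domE h; apply/integrableP; split; first exact/measurable_EFinP.
apply: (@fin_integral_le _ _ (m_fin x) (fun r => `|r|) (fun r => r ^+ 2) 1 1) h => //.
- by move=> r; apply: sqr_ge0.
- move=> r; rewrite normr_ge0 mul1r /=.
  by rewrite -real_normK ?num_real //; have := normr_ge0 r; nra.
Qed.

Let valE x : dom T x -> (\int[m x]_r r%:E = (quad t x)%:E)%E.
Proof.
move=> dx; have fn := integrable_fin_num measurableT (int_id dx).
rewrite -(fineK fn) -(pvm_integral pE); congr EFin.
have /(congr1 (@complex.Re R)) := sm_value TE dx; rewrite [RHS]/= => <-.
have [Vx h] : fdom t x /\ forall z, fdom t z -> rt t x z = rip (T x) z by apply/(form_opP ct).
by rewrite -/(rip _ _) -h // quad_rt.
Qed.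

Section Commutation.
Variable W : set R.
Hypothesis mW : measurable W.
Let P := E W.
Let hP : oproj P := pvm_oproj pE mW.

Let PB x y : P (x - y) = P x - P y.
Proof. exact: rlinB (op_lin hP). Qed.

(** P commutes with every E A, so the scalar measure splits along P. Hence P preserves the operator
    domain and the quadratic form splits too. *)
Let m_split x A : measurable A -> m x A = measure_add (m (P x)) (m (x - P x)) A.
Proof.
move=> mA; rewrite measure_addE !mE // -EFinD; congr EFin.
have PA y : P (E A y) = E A (P y) by rewrite /P !pvm_setI // setIC.
by rewrite (oproj_split (E A x) hP) PA (rlinB _ _ (op_lin (pvm_oproj pE mA))).
Qed.

Let dom_sub x y : (forall A, measurable A -> (m y A <= m x A)%E) -> dom T x -> dom T y.
Proof.
move=> h /domE hx; apply/domE; apply: le_lt_trans hx.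
apply: ge0_le_measure_integral => // [r|]; first by rewrite lee_fin sqr_ge0.
by apply/measurable_EFinP; apply: measurable_funX.
Qed.

Lemma spectral_dom x : dom T x -> dom T (P x) /\ dom T (x - P x).
Proof.
by move=> dx; split; apply: dom_sub dx => A mA; rewrite (m_split x mA) measure_addE ?leeDl ?leeDr.
Qed.

Let q_split x : dom T x -> quad t x = quad t (P x) + quad t (x - P x).
Proof.
move=> dx; have [d1 d2] := spectral_dom dx; apply: EFin_inj; rewrite EFinD -!valE //.
rewrite -integral_measure_add //; try exact: int_id.
by apply: eq_measure_integral => A mA _; apply: m_split.
Qed.

Let domV x : dom T x -> fdom t x.
Proof. by move=> /(dom_res ct)[u <-]; apply: resV. Qed.
Let domD x y : dom T x -> dom T y -> dom T (x + y).
Proof.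
move=> /(dom_res ct)[u <-] /(dom_res ct)[v <-]; apply/(dom_res ct); exists (u + v).
exact: rlinD (res_rlin ct).
Qed.

(** Additivity of the quadratic form on the vector P x + (y - P y) leaves no room for a cross
    term. *)
Let cross x y : dom T x -> dom T y -> bt t c (P x) (y - P y) = 0.
Proof.
move=> dx dy; have [d1 _] := spectral_dom dx; have [_ d2] := spectral_dom dy.
have Pz : P (P x + (y - P y)) = P x.
  by rewrite (rlinD _ _ (op_lin hP)) PB !(op_idem hP) subrr addr0.
have := q_split (domD d1 d2); rewrite Pz [P x + _]addrC addrK [_ + P x]addrC.
have := pf_qD (pf_bt ct) (domV d1) (domV d2).
have := nsqD (P x) (y - P y).
have -> : rip (P x) (y - P y) = 0 by rewrite (op_sym hP) PB (op_idem hP) subrr rip0r.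
rewrite !(quad_bt t c) => -> ->; lra.
Qed.

(** P (K u) is in the domain, hence equals K w for some w; testing weakly and discarding cross terms
    identifies w with P u. *)
Lemma spectral_K u : P (K u) = K (P u).
Proof.
have dK v : dom T (K v) by apply/(dom_res ct); exists v.
have [d1 d2] := spectral_dom (dK u); have /(dom_res ct)[w wE] := d1.
rewrite -wE; congr K; apply/eqP; rewrite -subr_eq0; apply/eqP/(res_inj ct)/rip_ext => z.
rewrite (res_sym ct) rip0l ripBl; set y := res t c z.
have dy : dom T y by apply: dK.
have [d3 d4] := spectral_dom dy.
rewrite -(resE ct w (domV dy)) wE.
have -> : bt t c (P (K u)) y = bt t c (P (K u)) (P y).
  have {1}-> : y = P y + (y - P y) by rewrite addrC subrK.
  rewrite (pf_Dr (pf_bt ct)) ?cross ?addr0 //; exact: domV.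
have <- : bt t c (K u) (P y) = bt t c (P (K u)) (P y).
  have {1}-> : K u = P (K u) + (K u - P (K u)) by rewrite addrC subrK.
  rewrite (pf_Dl (pf_bt ct)) ?(pf_sym (pf_bt ct) (domV d2)) ?cross ?addr0 //; exact: domV.
by rewrite (resE ct) ?(op_sym hP) ?subrr //; apply: domV.
Qed.

End Commutation.

Let neg : set R := [set` `]-oo, 0[].
Let pos : set R := [set` `[0, +oo[].
Let mneg : measurable neg. Proof. exact: measurable_itv. Qed.
Let mpos : measurable pos. Proof. exact: measurable_itv. Qed.
Let N := E neg.

Let int_split x : (\int[m x]_r r%:E = \int[m x]_(r in neg) r%:E + \int[m x]_(r in pos) r%:E)%E.
Proof.
have -> : [set: R] = neg `|` pos.
  by apply/seteqP; split=> // z _; rewrite /neg /pos /= !in_itv /= andbT; case: (ltrP z 0); [left | right].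
rewrite integral_setU //.
by apply/disj_set2P/seteqP; split=> // z; rewrite /neg /pos /= !in_itv /= andbT => -[h1 h2]; lra.
Qed.

Let mEid (D : set R) : measurable_fun D EFin.
Proof. by apply/measurable_EFinP; apply: measurable_funTS. Qed.

Lemma spectral_nonneg x : dom T x -> N x = 0 -> 0 <= quad t x.
Proof.
move=> dx Nx; have m0 : m x neg = 0%E by rewrite mE // -/N Nx nsq0.
rewrite -lee_fin -valE // int_split null_set_integral ?add0e //.
by apply: integral_ge0 => r; rewrite /pos /= in_itv /= andbT lee_fin.
Qed.

(** All mass of x lies on ]-oo, 0[, where the integrand is negative. A nonnegative integral makes it
    vanish almost everywhere, so there is no mass. *)
Lemma spectral_neg x : dom T x -> N x = x -> 0 <= quad t x -> x = 0.
Proof.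
move=> dx Nx q0; have m0 : m x pos = 0%E.
  rewrite mE // -Nx /N pvm_setI // (_ : _ `&` _ = set0) ?(pvm_set0 pE) ?nsq0 //.
  by apply/seteqP; split=> // z; rewrite /neg /pos /= !in_itv /= andbT => -[h1]; rewrite ltNge h1.
have := valE dx; rewrite int_split [X in (_ + X)%E]null_set_integral // adde0 => e.
have e1 : (\int[m x]_(r in neg) `|r%:E| = 0)%E.
  apply/eqP; rewrite eq_le integral_ge0 ?andbT //.
  rewrite (eq_integral (fun r : R => (- r%:E)%E)); last first.
    by move=> r; rewrite inE /neg /= in_itv /= => h; rewrite /= ltr0_norm.
  rewrite integralN; first by rewrite e -EFinN lee_fin oppr_le0.
  exact: integrable_add_def (integrableS measurableT mneg (fun _ _ => I) (int_id dx)).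
have [/(_ e1)[A [mA A0 hA]] _] := ae_eq_integral_abs (m x) mneg (@mEid neg).
have nA : neg `<=` A.
  move=> r nr; apply: hA => /= /(_ nr) [r0].
  by move: nr; rewrite /neg /= in_itv /= r0 ltxx.
have := mE x mneg; rewrite -/N Nx (@subset_measure0 _ _ _ (m x) neg A mneg mA nA A0) => -[] /esym.
exact: nsq_eq0.
Qed.

Variable F : H -> H.
Hypothesis hF : level t c 0 F.

(** N and F commute, so a discrepancy between their ranges would be a vector on which the form is
    both negative and nonnegative. Applying the injective K first moves it into dom T, where the
    spectral integral is available. *)
Lemma spectral_level x : N x = x <-> F x = x.
Proof.
have hN : oproj N := pvm_oproj pE mneg.
have NK u : N (K u) = K (N u) by exact: spectral_K.
have FN y : F (N y) = N (F y).
  by apply/esym/(lv_comm hF); [exact: op_lin hN | exact: oproj_bnd hN | exact: NK].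
have NB y z : N (y - z) = N y - N z by exact: rlinB (op_lin hN).
have dK y : dom T (K y) by apply/(dom_res ct); exists y.
have K0 y : K y = 0 -> y = 0 by apply: (res_inj ct).
split=> h; apply/eqP; rewrite eq_sym -subr_eq0; apply/eqP/K0.
  have e1 : N (K (x - F x)) = K (x - F x) by rewrite NK NB -FN h.
  have e2 : F (K (x - F x)) = 0 by rewrite (lvK ct hF) (lvB hF) (lv_idem hF) subrr (rlin0 (res_rlin ct)).
  apply: spectral_neg => //; rewrite -[leLHS](mul0r (normsq (K (x - F x)))).
  by apply: (lv_ge hF) => //; apply: resV.
have e1 : F (K (x - N x)) = K (x - N x) by rewrite (lvK ct hF) (lvB hF) FN h.
have e2 : N (K (x - N x)) = 0 by rewrite NK NB (op_idem hN) subrr; apply: rlin0 (res_rlin ct).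
apply/eqP/negPn/negP => n0; have := lv_lt hF e1 n0; rewrite mul0r.
by have := spectral_nonneg (dK _) e2; lra.
Qed.

End SpectralUniqueness.

Lemma spectral_subspace_level (R : realType) (H : hilbertType R) (t : sform R H) (c : R)
    (F : H -> H) : cform t c -> level t c 0 F ->
  spectral_subspace (op_of_form t) [set` `]-oo, 0[] = [set x | F x = x].
Proof.
move=> ct hF; apply/seteqP; split=> x /=.
  by move=> [E TE]; move/(spectral_level ct TE hF).
by move=> Fx; have TE := form_spectral_measure ct; eexists; [exact: TE | apply/(spectral_level ct TE hF)].
Qed.

(** * Eigenvalue counting and variational principles *)

(** The supremum of the x with P on [a, x] satisfies P by the left hypothesis and would be passed by
    the right one. *)
Lemma real_induction (R : realType) (a : R) (P : R -> Prop) : P a ->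
  (forall x, a <= x -> P x -> exists2 e, 0 < e & forall y, x < y -> y < x + e -> P y) ->
  (forall x, a < x -> (forall y, a <= y -> y < x -> P y) -> P x) ->
  forall x, a <= x -> P x.
Proof.
move=> Pa Pr Pl b ab; apply: contrapT => nPb.
pose S : set R := [set x | a <= x /\ forall y, a <= y -> y <= x -> P y].
have Sa : S a.
  split=> // y ay ya; suff -> : y = a by [].
  by apply/eqP; rewrite eq_le ya.
have ub x : S x -> x <= b.
  by move=> [_ hx]; rewrite leNgt; apply/negP => bx; apply: nPb; apply: hx => //; apply: ltW.
have hS : has_sup S by split; [exists a | exists b => x; apply: ub].
have sa : a <= sup S by apply: sup_upper_bound.
have below y : a <= y -> y < sup S -> P y.
  by move=> ay /(sup_gt (proj1 hS))[z [_ hz] yz]; apply: hz => //; apply: ltW.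
have Ps : P (sup S).
  have [<-//|n0] := eqVneq a (sup S); apply: Pl below.
  by rewrite lt_neqAle n0.
have [e e0 he] := Pr _ sa Ps; suff : S (sup S + e / 2).
  by move/(sup_upper_bound hS); lra.
split=> [|y ay hy]; first by lra.
have [ys|sy|->//] := ltgtP y (sup S); first exact: below.
by apply: he => //; lra.
Qed.

(** x is expanded in the dual basis for the inner product. The partial sums over a list are bounded
    for all x of H, not only of L, so that induction on the list goes through. *)
Lemma quad_fin_bound (R : realType) (H : hilbertType R) (t : sform R H) (c : R) (L : set H) n :
  cform t c -> L `<=` fdom t -> has_dim L n ->
  exists C, forall x, L x -> quad t x <= C * normsq x.
Proof.
move=> ct LV [e [ie LE]]; have st := cf_sesq ct; have pb := pf_bt ct.
have Le i : L (e i) by have [d ->] := basis_in e i; rewrite LE; exists d.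
pose t0 := SForm [set: H] (fun x y => '[x, y]).
have [||d y ty|d hd] := @dual_basis _ _ t0 _ _ _ _ ie.
- by split=> //= d y z w _ _ _; rewrite !ipE.
- by [].
- by apply: nsq_eq0; move: ty; rewrite /t0 /= ip_nsq => -[].
have qD v w : fdom t v -> fdom t w -> bt t c (v + w) (v + w) <= 2 * bt t c v v + 2 * bt t c w w.
  move=> Vv Vw; have := pf_qD pb Vv Vw; have := pf_qB pb Vv Vw.
  have := pf_ge0 pb (pf_VB pb Vv Vw); lra.
have Vi v : fdom t v -> fdom t ('i *: v) by apply: (cf_VZ ct).
have qZ (z : R[i]) v : fdom t v ->
    bt t c (z *: v) (z *: v) <= normsq z * (2 * (bt t c v v + bt t c ('i *: v) ('i *: v))).
  move=> Vv; rewrite scaleriE normsqC; apply: le_trans (qD _ _ _ _) _; try exact: pf_VZ pb _ _ _.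
    by apply: (pf_VZ pb); apply: Vi.
  rewrite !(pf_qZ pb) //; last exact: Vi.
  have := pf_ge0 pb Vv; have := pf_ge0 pb (Vi _ Vv).
  have := sqr_ge0 (complex.Re z); have := sqr_ge0 (complex.Im z); nra.
pose f k := \sum_j d k j *: e j.
have key (s : seq 'I_n) : exists C, forall x, let y := \sum_(i <- s) '[x, f i] *: e i in
    fdom t y /\ bt t c y y <= C * normsq x.
  elim: s => [|i s [C IH]].
    exists 0 => x; rewrite /= big_nil mul0r; split; first exact: pf_0 pb.
    by rewrite (pf_0l pb) //; apply: pf_0 pb.
  pose Q := 2 * (bt t c (e i) (e i) + bt t c ('i *: e i) ('i *: e i)).
  have Ve := LV _ (Le i).
  have Q0 : 0 <= Q by have := pf_ge0 pb Ve; have := pf_ge0 pb (Vi _ Ve); rewrite /Q; lra.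
  exists (2 * (normsq (f i) * Q) + 2 * C) => x; have [IH1 IH2] := IH x.
  have Vz : fdom t ('[x, f i] *: e i) by apply: (cf_VZ ct).
  rewrite /= big_cons; split; first exact: pf_VD pb _ _ _ _.
  apply: le_trans (qD _ _ Vz IH1) _; have h1 := qZ '[x, f i] _ Ve.
  have h2 := ler_wpM2r Q0 (ip_CS x (f i)); rewrite -/Q in h1; lra.
have [C hC] := key (enum 'I_n); exists (C + `|c|) => x Lx.
have yE : \sum_(i <- enum 'I_n) '[x, f i] *: e i = x.
  move: Lx; rewrite LE => -[z ->]; rewrite big_enum /=; apply: eq_bigr => i _; congr (_ *: _).
  rewrite ip_suml (bigD1 i) //= big1 => [|k /negbTE ki]; rewrite ipZl (hd _ _ : '[_, _] = _).
    by rewrite eqxx mulr1 addr0.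
  by rewrite ki mulr0.
have [_] := hC x; rewrite /= yE (quad_bt t c) => hx.
have := ler_norm (- c); rewrite normrN; have := nsq_ge0 x; nra.
Qed.

(** * The negative index of a decreasing family of forms *)

Section FormFamily.
Variables (R : realType) (H : hilbertType R) (V : set H) (s : R -> sform R H).
Variables (mu : R) (ess : set R).
Hypothesis sV : forall l, fdom (s l) = V.
Hypothesis s_cform : forall l, mu < l -> exists c, cform (s l) c.
Hypothesis s_up : forall l l' x, mu < l -> l <= l' ->
  quad (s l) x <= quad (s l') x + (l' - l) * normsq x.
Hypothesis s_decr : forall l, mu < l -> exists2 e, 0 < e & exists2 k, 0 < k &
  forall x l', V x -> quad (s l) x <= e * normsq x -> l <= l' ->
    quad (s l') x <= quad (s l) x - k * (l' - l) * normsq x.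
Hypothesis ess_closed : forall l, mu < l -> ~ ess l -> finite_dim (form_ker (s l)) /\
  (forall (fn : nat -> H) f, (forall n, exists x, form_eq (s l) x (fn n)) -> cvs fn f ->
    exists x, form_eq (s l) x f).
Hypothesis ess_open : forall l c, mu < l -> cform (s l) c ->
  (forall f, (forall x, form_ker (s l) x -> rip f x = 0) -> exists x, form_eq (s l) x f) ->
  finite_dim (form_ker (s l)) -> ~ ess l.

(** The shift c and the projection F are auxiliary, hence quantified here; k is unique by
    [neg_index_uniq], and [kappa_neg_index] links it to [kappa_minus]. *)
Definition neg_index (l : R) (k : nat) := exists c F,
  [/\ cform (s l) c, level (s l) c 0 F & has_dim [set x | F x = x] k].

Lemma s_neg_mono l l' x : mu < l -> l < l' -> V x -> x != 0 ->
  quad (s l) x <= 0 -> quad (s l') x < 0.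
Proof.
move=> ml ll Vx x0 q0; have [e e0 [k k0 h]] := s_decr ml; have n0 := nsq_gt0 x0.
have e1 : quad (s l) x <= e * normsq x by apply: le_trans q0 _; apply: mulr_ge0; exact: ltW.
have := h x l' Vx e1 (ltW ll); have : 0 < k * (l' - l) * normsq x.
  by rewrite !mulr_gt0 // subr_gt0.
lra.
Qed.

(** The level projection is injective on X, since F x = 0 would give s_l[x] >= 0. *)
Lemma neg_index_le l k X k' : neg_index l k' -> has_dim X k -> X `<=` V ->
  (forall x, X x -> x != 0 -> quad (s l) x < 0) -> (k <= k')%N.
Proof.
move=> [c [F [cs hF dF]]] dX XV Xneg.
have dFX : has_dim [set F x | x in X] k.
  apply: has_dim_map dX => [d x y _ _|x Xx Fx]; first exact: (lvE cs hF).
  apply/eqP/negPn/negP => x0; have := Xneg _ Xx x0.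
  have Vx : fdom (s l) x by rewrite sV; apply: XV.
  by have := lv_ge hF Vx Fx; rewrite mul0r; lra.
by apply: has_dim_le dFX dF _ => _ [x _ <-]; apply: (lv_idem hF).
Qed.

Lemma neg_index_space l k : neg_index l k -> exists X,
  [/\ has_dim X k, X `<=` V, forall x, X x -> x != 0 -> quad (s l) x < 0 &
      forall x, V x -> (forall y, X y -> '[x, y] = 0) -> 0 <= quad (s l) x].
Proof.
move=> [c [F [cs hF dF]]]; exists [set x | F x = x]; split=> //= [x Fx|x Fx x0|x Vx hx].
- by rewrite -(sV l) -Fx; apply: (lvV cs hF).
- by have := lv_lt hF Fx x0; rewrite mul0r.
- rewrite -(mul0r (normsq x)); apply: (lv_ge hF); first by rewrite sV.
  by apply: nsq_eq0; rewrite nsqE -(op_sym (lv_proj hF)) ripC /rip (lv_idem hF) hx // (lv_idem hF).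
Qed.

Lemma neg_index_ub l L m : mu < l -> has_dim L m ->
  (forall x, V x -> (forall y, L y -> '[x, y] = 0) -> 0 <= quad (s l) x) ->
  exists2 k, (k <= m)%N & neg_index l k.
Proof.
move=> ml dL Lpos; have [c cs] := s_cform ml; have [F hF] := level_exists cs 0.
have sF : lin_subspace [set x | F x = x].
  split=> [|d x y Fx Fy] /=; first exact: rlin0 (op_lin (lv_proj hF)).
  by rewrite (lvE cs hF) Fx Fy.
have [[j jm dj]|[L' L'F dL']] := dim_dichotomy m.+1 sF; first by exists j => //; exists c, F.
have [x [L'x x0 hx]] := orth_vector dL' dL (ltnSn m).
have Fx : F x = x := L'F _ L'x; have := lv_lt hF Fx x0; rewrite mul0r => q0.
have Vx : V x by rewrite -(sV l) -Fx; apply: (lvV cs hF).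
by have := Lpos x Vx hx; lra.
Qed.

Lemma neg_index_mono l l' k k' : mu < l -> l <= l' -> neg_index l k -> neg_index l' k' -> (k <= k')%N.
Proof.
move=> ml ll /neg_index_space[X [dX XV Xneg _]] h'; apply: (neg_index_le h' dX XV) => x Xx x0.
move: ll; rewrite le_eqVlt => /orP[/eqP <-|ll]; first exact: Xneg.
by apply: (s_neg_mono ml ll (XV _ Xx) x0); apply: ltW; apply: Xneg.
Qed.

Lemma neg_index_uniq l k k' : mu < l -> neg_index l k -> neg_index l k' -> k = k'.
Proof.
move=> ml h h'; apply/eqP; rewrite eqn_leq.
by rewrite (neg_index_mono ml (lexx _) h h') (neg_index_mono ml (lexx _) h' h).
Qed.

(** Off the negative space of l', either s_l[x] > e |x|^2, or the decrease up to l' forces s_l[x] >=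
    k (l' - l) |x|^2. A positive lower bound in finite codimension makes l non-essential. *)
Lemma neg_index_down l l' k' : mu < l -> l < l' -> neg_index l' k' ->
  ~ ess l /\ exists2 k, (k <= k')%N & neg_index l k.
Proof.
move=> ml ll /neg_index_space[X [dX XV _ Xpos]].
have [e e0 [k k0 h]] := s_decr ml; have kl : 0 < k * (l' - l) by rewrite mulr_gt0 // subr_gt0.
pose d := Num.min e (k * (l' - l)).
have d0 : 0 < d by rewrite lt_min e0.
have pos x : V x -> (forall y, X y -> '[x, y] = 0) -> d * normsq x <= quad (s l) x.
  move=> Vx hx; have n0 := nsq_ge0 x; have [q|q] := lerP (quad (s l) x) (e * normsq x).
    have := h x l' Vx q (ltW ll); have := Xpos x Vx hx.
    have : d * normsq x <= k * (l' - l) * normsq x by rewrite ler_wpM2r // ge_min lexx orbT.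
    lra.
  apply: le_trans (ltW q); by rewrite ler_wpM2r // ge_min lexx.
split; last first.
  apply: neg_index_ub dX _ => // x Vx hx; apply: le_trans (pos _ Vx hx).
  by rewrite mulr_ge0 ?nsq_ge0 // ltW.
have [c cs] := s_cform ml; apply: (ess_open ml cs).
  by apply: (fin_codim_solve cs dX d0) => x; rewrite sV; apply: pos.
by apply: (fin_codim_ker cs dX d0) => x; rewrite sV; apply: pos.
Qed.

(** By the gap, s_l <= -e on its negative space. As s_l' exceeds s_l by at most l - l' < e times
    |x|^2, this space is still negative at l'. *)
Lemma neg_index_left l : mu < l -> ~ ess l -> exists2 e, 0 < e &
  forall l' k', mu < l' -> l - e < l' -> l' <= l -> neg_index l' k' -> neg_index l k'.
Proof.
move=> ml nl; have [[m dm] rc] := ess_closed ml nl; have [c cs] := s_cform ml.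
have [F hF] := level_exists cs 0; have [e e0 [gneg _]] := spectral_gap cs dm rc hF.
exists e => // l' k' ml' h1 h2 h'.
have sF : lin_subspace [set x | F x = x].
  split=> [|d x y Fx Fy] /=; first exact: rlin0 (op_lin (lv_proj hF)).
  by rewrite (lvE cs hF) Fx Fy.
have FV x : F x = x -> V x by move=> Fx; rewrite -(sV l) -Fx; apply: (lvV cs hF).
have neg x : F x = x -> x != 0 -> quad (s l') x < 0.
  move=> Fx x0; have := s_up x ml' h2; have := gneg x Fx; have := nsq_gt0 x0; nra.
have [[j jm dj]|[L' L'F dL']] := dim_dichotomy k'.+1 sF; last first.
  have := neg_index_le h' dL' (fun x hx => FV _ (L'F _ hx)) (fun x hx => neg _ (L'F _ hx)).
  by rewrite ltnn.
have nj : neg_index l j by exists c, F.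
suff -> : k' = j by [].
by apply/eqP; rewrite eqn_leq (neg_index_mono ml' h2 h' nj).
Qed.

(* X is the negative spectral subspace and Z its sum with the kernel. *)
Lemma neg_ker_space l k m : mu < l -> neg_index l k -> has_dim (form_ker (s l)) m -> exists Z,
  [/\ has_dim Z (k + m), Z `<=` V, forall x, Z x -> quad (s l) x <= 0,
      (exists2 X, X `<=` Z & has_dim X k /\
        forall x, V x -> (forall y, X y -> '[x, y] = 0) -> 0 <= quad (s l) x) &
      ~ ess l -> exists2 e, 0 < e &
        forall x, V x -> (forall y, Z y -> '[x, y] = 0) -> e * normsq x <= quad (s l) x].
Proof.
move=> ml hk dm; have [c [F [cs hF dF]]] := hk.
have F0 y : form_ker (s l) y -> F y = 0 by apply: (level_ker_0 cs hF (lexx 0)).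
have dZ := has_dim_add dF dm (fun x y (Fx : F x = x) hy =>
  etrans (congr1 (fun z => '[z, y]) (esym Fx)) (etrans (lv_sym cs hF x y)
    (etrans (congr1 (fun z => '[x, z]) (F0 _ hy)) (ip0r x)))).
eexists; split; first exact: dZ.
- move=> z /= [x Fx [y [Vy _] ->]]; rewrite -(sV l); apply: (pf_VD (pf_bt cs)) => //.
  by rewrite -Fx; apply: (lvV cs hF).
- move=> z /= [x Fx [y hy ->]]; have Vx : fdom (s l) x by rewrite -Fx; apply: (lvV cs hF).
  have q : quad (s l) x <= 0.
    have [->|x0] := eqVneq x 0; last by have := lv_lt hF Fx x0; rewrite mul0r => /ltW.
    by rewrite (quad_bt _ c) (pf_0l (pf_bt cs)) ?nsq0 ?mulr0 ?subr0 //; apply: (pf_0 (pf_bt cs)).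
  have := pf_qD (pf_bt cs) Vx hy.1; have := nsqD x y; have := form_ker_quad hy.
  have := hy.2 _ Vx; rewrite (rt_sym cs hy.1 Vx) /bt !(quad_bt _ c) /bt => -> h2 -> h4.
  move: h2 h4 q; rewrite (quad_bt _ c) /bt; lra.
- exists [set x | F x = x].
    move=> x Fx /=; exists x => //; exists 0; last by rewrite addr0.
    by case: (form_ker_sub cs).
  split=> // x Vx hx; rewrite -(mul0r (normsq x)); apply: (lv_ge hF); first by rewrite sV.
  by apply: nsq_eq0; rewrite nsqE -(op_sym (lv_proj hF)) ripC /rip (lv_idem hF) hx //= (lv_idem hF).
move=> nl; have [_ rc] := ess_closed ml nl; have [e e0 [_ gpos]] := spectral_gap cs dm rc hF.
exists e => // x Vx hx; apply: gpos; first by rewrite sV.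
  apply: nsq_eq0; rewrite nsqE -(op_sym (lv_proj hF)) ripC /rip (lv_idem hF) hx //=.
  exists (F x); first exact: (lv_idem hF).
  by exists 0; rewrite ?addr0 //; case: (form_ker_sub cs).
move=> y hy; rewrite /rip hx //=; exists 0; first exact: rlin0 (op_lin (lv_proj hF)).
by exists y; rewrite ?add0r.
Qed.

Lemma neg_index_ker l l' k m k' : mu < l -> l < l' -> neg_index l k ->
  has_dim (form_ker (s l)) m -> neg_index l' k' -> (k + m <= k')%N.
Proof.
move=> ml ll hk dm h'; have [Z [dZ ZV Zneg _ _]] := neg_ker_space ml hk dm.
by apply: (neg_index_le h' dZ ZV) => x Zx x0; apply: (s_neg_mono ml ll (ZV _ Zx) x0 (Zneg _ Zx)).
Qed.

(** Negative space plus kernel becomes strictly negative to the right of l; on its complement s_l >=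
    e, so s_l' stays nonnegative while l' - l < e. *)
Lemma neg_index_right l k m : mu < l -> ~ ess l -> neg_index l k ->
  has_dim (form_ker (s l)) m -> exists2 e, 0 < e &
  forall l', l < l' -> l' < l + e -> neg_index l' (k + m).
Proof.
move=> ml nl hk dm; have [Z [dZ ZV Zneg _ /(_ nl)[e e0 Zpos]]] := neg_ker_space ml hk dm.
exists e => // l' ll le; have ml' : mu < l' by lra.
have [|j jm hj] := neg_index_ub ml' dZ.
  move=> x Vx hx; have := s_up x ml (ltW ll); have := Zpos x Vx hx; have := nsq_ge0 x; nra.
suff -> : (k + m)%N = j by [].
by apply/eqP; rewrite eqn_leq jm (neg_index_ker ml ll hk dm hj).
Qed.

End FormFamily.

Local Open Scope card_scope.

(** In a sorted sequence the positions of one eigenvalue, counted from the first of them, form such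
    a set, and its cardinality is the multiplicity. *)
Lemma card_initial (D : set nat) m : (forall i j, (i <= j)%N -> D j -> D i) ->
  D #= `I_m -> forall i, D i <-> (i < m)%N.
Proof.
move=> dD cD i; split=> [Di|im].
  rewrite -card_le_II; apply: card_le_trans (_ : D #<= _); last by move: cD => /card_eqPle[].
  by apply: subset_card_le => j /= ji; apply: dD Di.
apply: contrapT => nD; have : `I_m #<= `I_i.
  apply: card_le_trans (_ : D #<= _); first by move: cD => /card_eqPle[].
  apply: subset_card_le => j Dj /=; rewrite ltnNge; apply/negP => ij; exact/nD/(dD _ _ ij).
by rewrite card_le_II leqNgt im.
Qed.

Lemma has_dim_above (R : realType) (H : lmodType R[i]) (X S : set H) k j : has_dim X k ->
  (k <= j)%N -> (forall L i, has_dim L i -> (i < j)%N -> exists x, S x /\ ~ L x) ->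
  exists2 L, has_dim L j & X `<=` L.
Proof.
move=> dX /subnKC <-; elim: (j - k)%N => [|i IH] hS; first by exists X; rewrite ?addn0.
have [|L dL XL] := IH; first by move=> L i' dL hi; apply: hS dL _; rewrite addnS ltnS ltnW.
have [x [_ Lx]] : exists x, S x /\ ~ L x by apply: hS dL _; rewrite addnS.
rewrite addnS; eexists; first exact: has_dim_extend dL Lx.
by move=> y /XL Ly /=; exists y => //; exists 0; rewrite scale0r addr0.
Qed.

(** * The index as eigenvalue counting function below the essential spectrum *)

Section Counting.
Variables (R : realType) (H : hilbertType R) (V : set H) (s : R -> sform R H).
Variables (mu : R) (ess : set R).
Hypothesis sV : forall l, fdom (s l) = V.
Hypothesis s_cform : forall l, mu < l -> exists c, cform (s l) c.
Hypothesis s_up : forall l l' x, mu < l -> l <= l' ->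
  quad (s l) x <= quad (s l') x + (l' - l) * normsq x.
Hypothesis s_decr : forall l, mu < l -> exists2 e, 0 < e & exists2 k, 0 < k &
  forall x l', V x -> quad (s l) x <= e * normsq x -> l <= l' ->
    quad (s l') x <= quad (s l) x - k * (l' - l) * normsq x.
Hypothesis ess_closed : forall l, mu < l -> ~ ess l -> finite_dim (form_ker (s l)) /\
  (forall (fn : nat -> H) f, (forall n, exists x, form_eq (s l) x (fn n)) -> cvs fn f ->
    exists x, form_eq (s l) x f).
Hypothesis ess_open : forall l c, mu < l -> cform (s l) c ->
  (forall f, (forall x, form_ker (s l) x -> rip f x = 0) -> exists x, form_eq (s l) x f) ->
  finite_dim (form_ker (s l)) -> ~ ess l.

Let lam_e : \bar R := ereal_inf [set t%:E | t in [set t : R | ess t /\ mu < t]].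
Local Notation nidx := (neg_index s).

Lemma below_ess l : mu < l -> (l%:E < lam_e)%E -> ~ ess l.
Proof.
move=> ml ll el; have : (lam_e <= l%:E)%E by apply: ereal_inf_lbound; exists l.
by rewrite leNgt ll.
Qed.

(** A finite index excludes essential spectrum to its left; applied to gamma, it places lambda_e
    above [mu]. *)
Lemma lam_e_ge g k : mu < g -> nidx g k -> (g%:E <= lam_e)%E.
Proof.
move=> mg hk; apply: le_ereal_inf_tmp => _ [t [et mt] <-]; rewrite lee_fin leNgt; apply/negP => tg.
by have [] := neg_index_down sV s_cform s_decr ess_open mt tg hk.
Qed.

Lemma above_ess l k : mu < l -> (lam_e < l%:E)%E -> ~ nidx l k.
Proof.
by move=> ml h /(lam_e_ge ml); rewrite leNgt h.
Qed.

Variables (gamma : R) (kg : nat).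
Hypothesis mg : mu < gamma.
Hypothesis gk : nidx gamma kg.

Lemma neg_index_fin l : mu < l -> (l%:E < lam_e)%E -> exists k, nidx l k.
Proof.
have [gl|lg] := lerP gamma l; last first.
  by move=> ml _; have [_ [k _ hk]] := neg_index_down sV s_cform s_decr ess_open ml lg gk; exists k.
move=> _; move: l gl; apply: real_induction => [_|x gx hx|x gx hx].
- by exists kg.
- have mx : mu < x := lt_le_trans mg gx.
  have [xe|xe] := boolP (x%:E < lam_e)%E; last first.
    (* The predicate carries the condition y < [lam_e], so past that point any radius serves. *)
    exists 1 => // y xy _ ye; case/negP: xe; apply: lt_trans ye; by rewrite lte_fin.
  have [k hk] := hx xe; have nx := below_ess mx xe; have [[m dm] _] := ess_closed mx nx.
  have [e e0 he] := neg_index_right sV s_cform s_up s_decr ess_closed mx nx hk dm.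
  by exists e => // y xy ye _; exists (k + m)%N; apply: he.
- move=> xe; have mx : mu < x := lt_trans mg gx.
  have nx := below_ess mx xe.
  have [e e0 he] := neg_index_left sV s_cform s_up s_decr ess_closed mx nx.
  pose y := Num.max gamma (x - e / 2).
  have gy : gamma <= y by rewrite le_max lexx.
  have yx : y < x by rewrite gt_max gx /=; lra.
  have ye : x - e / 2 <= y by rewrite le_max lexx orbT.
  have [|k hk] := hx y gy yx; first by apply: lt_trans xe; rewrite lte_fin.
  by exists k; apply: he hk; [exact: lt_le_trans mg gy | by apply: lt_le_trans ye; lra | exact: ltW].
Qed.

Variables (g0 : R) (kappa : nat) (N : option nat) (lam : nat -> R).
Hypothesis mg0 : mu < g0.
Hypothesis hkappa : nidx g0 kappa.
Hypothesis lam_ge : forall n, in_range N n -> g0 <= lam n /\ ((lam n)%:E < lam_e)%E.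
Hypothesis lam_mono : forall m n, in_range N m -> in_range N n -> (m <= n)%N -> lam m <= lam n.
Hypothesis lam_ker : forall t, g0 <= t -> (t%:E < lam_e)%E ->
  exists2 k, has_dim (form_ker (s t)) k & [set n | in_range N n /\ lam n = t] #= `I_k.

Let in_range_le m n : (0 < m)%N -> (m <= n)%N -> in_range N n -> in_range N m.
Proof.
move=> m0 mn [n0 hn]; split=> //; case: N hn => // p; exact: leq_trans.
Qed.

(** An enumerated eigenvalue has a nonzero kernel, so the index increases strictly to its right. *)
Let no_eigen n t y k : in_range N n -> lam n = t -> t < y -> nidx t k -> nidx y k -> False.
Proof.
move=> rn lt ty ht hy; have [gn en] := lam_ge rn; rewrite lt in gn en.
have [m dm cm] := lam_ker gn en; have mt : mu < t := lt_le_trans mg0 gn.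
have := neg_index_ker sV s_decr ess_closed mt ty ht dm hy; rewrite -{2}[k]addn0 leq_add2l leqn0 => /eqP m0.
move: cm; rewrite m0 II0 card_eq0 => /eqP e.
by have : [set n | in_range N n /\ lam n = t] n by []; rewrite e.
Qed.

Lemma count_eigenvalues l : g0 <= l -> (l%:E < lam_e)%E ->
  exists2 j, nidx l (kappa + j) & forall i, (in_range N i.+1 /\ lam i.+1 < l) <-> (i < j)%N.
Proof.
move: l; apply: real_induction => [_|x gx hx|x gx hx].
(* No enumerated eigenvalue is below g0. Eigenvalues are numbered from 1, whence [i.+1]. *)
- exists 0%N; rewrite ?addn0 // => i; split=> // -[/lam_ge[h _]]; lra.
- have mx : mu < x := lt_le_trans mg0 gx.
  have [xe|xe] := boolP (x%:E < lam_e)%E; last first.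
    exists 1 => // y xy _ ye; case/negP: xe; apply: lt_trans ye; by rewrite lte_fin.
  have [j hj ij] := hx xe; have nx := below_ess mx xe; have [m dm cm] := lam_ker gx xe.
  have [e e0 he] := neg_index_right sV s_cform s_up s_decr ess_closed mx nx hj dm.
  have jge i : in_range N i.+1 -> (j <= i)%N -> x <= lam i.+1.
    move=> ri ji; rewrite leNgt; apply/negP => h.
    by have := (ij i).1 (conj ri h); rewrite ltnNge ji.
  (* The first j eigenvalues are below x; D collects the positions of x itself, shifted to start at
     0. *)
  pose D : set nat := [set i | in_range N (j + i).+1 /\ lam (j + i).+1 = x].
  have cD : D #= `I_m.
    apply: card_eq_trans cm; rewrite card_eq_sym.
    have -> : [set n | in_range N n /\ lam n = x] = (fun i => (j + i).+1) @` D.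
      apply/seteqP; split=> [n [rn ln]|_ [i [ri li] <-]] //.
      case: n rn ln => [[]//|n] rn ln.
      have jn : (j <= n)%N.
        by rewrite leqNgt; apply/negP => /(ij n).2[_]; rewrite ln ltxx.
      by exists (n - j)%N; rewrite /D /= subnKC.
    by apply: inj_card_eq => i i' _ _ [] /addnI.
  have dD i i' : (i <= i')%N -> D i' -> D i.
    move=> ii [ri li]; have ri' : in_range N (j + i).+1.
      by apply: in_range_le ri; rewrite // ltnS leq_add2l.
    split=> //; apply/eqP; rewrite eq_le jge ?leq_addr // andbT -li.
    by apply: lam_mono; rewrite // ltnS leq_add2l.
  exists e => // y xy ye yl; exists (j + m)%N; first by rewrite addnA; apply: he.
  move=> i; have [ilj|jli] := ltnP i j.
    split=> _; first by rewrite ltn_addr.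
    by have [ri li] := (ij i).2 ilj; split=> //; apply: lt_trans xy.
  rewrite -(subnKC jli) ltn_add2l -(card_initial dD cD) /D /= subnKC //.
  split=> [[ri li]|[ri ->]] //; split=> //; apply/eqP; rewrite eq_le jge // andbT leNgt; apply/negP => xl.
  (* An eigenvalue strictly between x and y would raise the index, which is constant to the right of
     x. *)
  apply: (@no_eigen i.+1 (lam i.+1) y (kappa + j + m)) => //; apply: he => //; lra.
- move=> xe; have mx : mu < x := lt_trans mg0 gx.
  have nx := below_ess mx xe.
  have [e e0 he] := neg_index_left sV s_cform s_up s_decr ess_closed mx nx.
  pose y := Num.max g0 (x - e / 2).
  have gy : g0 <= y by rewrite le_max lexx.
  have yx : y < x by rewrite gt_max gx /=; lra.
  have ye : x - e / 2 <= y by rewrite le_max lexx orbT.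
  have [|j hj ij] := hx y gy yx; first by apply: lt_trans xe; rewrite lte_fin.
  exists j; first by apply: he hj; [exact: lt_le_trans mg0 gy | apply: lt_le_trans ye; lra | exact: ltW].
  move=> i; rewrite -ij; split=> -[ri li]; split=> //; last by lra.
  (* An eigenvalue in [y, x[ would raise the index, but by [neg_index_left] the index there agrees
     with that at x. *)
  rewrite ltNge; apply/negP => yl.
  have [gl le] := lam_ge ri; have [|j' hj' _] := hx (lam i.+1) _ li le; first by lra.
  apply: (@no_eigen i.+1 (lam i.+1) x (kappa + j')) => //.
  by apply: he hj'; [exact: lt_le_trans mg0 gl | apply: lt_le_trans (le_trans ye yl); lra | exact: ltW].
Qed.

End Counting.

(** * Variational principles for a functional governed by the signs of s_l *)

Section MinMax.
Variables (R : realType) (H : hilbertType R) (V : set H) (s : R -> sform R H).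
Variables (mu : R) (ess : set R).
Hypothesis sV : forall l, fdom (s l) = V.
Hypothesis s_cform : forall l, mu < l -> exists c, cform (s l) c.
Hypothesis s_up : forall l l' x, mu < l -> l <= l' ->
  quad (s l) x <= quad (s l') x + (l' - l) * normsq x.
Hypothesis s_decr : forall l, mu < l -> exists2 e, 0 < e & exists2 k, 0 < k &
  forall x l', V x -> quad (s l) x <= e * normsq x -> l <= l' ->
    quad (s l') x <= quad (s l) x - k * (l' - l) * normsq x.
Variables (t0 : sform R H) (c0 : R).
Hypothesis ct0 : cform t0 c0.
Hypothesis t0V : fdom t0 = V.
Hypothesis s_le : forall l x, mu < l -> quad (s l) x <= quad t0 x - l * normsq x.
Variable g : H -> \bar R.
Hypothesis g_lt : forall l x, mu < l -> V x -> x != 0 -> (g x < l%:E)%E <-> quad (s l) x < 0.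
Local Notation nidx := (neg_index s).

Definition gsup (L : set H) : \bar R := ereal_sup [set g x | x in L `\ 0].
Definition ginf (L : set H) : \bar R :=
  ereal_inf [set g x | x in [set x | V x /\ forall z, L z -> '[x, z] = 0] `\ 0].

Let g_ge l x : mu < l -> V x -> x != 0 -> 0 <= quad (s l) x -> (l%:E <= g x)%E.
Proof.
move=> ml Vx x0 q; rewrite leNgt; apply/negP => /(g_lt ml Vx x0); rewrite ltNge q //.
Qed.

(** [g_lt] treats strict inequalities only; strict decrease makes s_{l+e}[x] negative for every e >
    0. *)
Let g_le l x : mu < l -> V x -> x != 0 -> quad (s l) x <= 0 -> (g x <= l%:E)%E.
Proof.
move=> ml Vx x0 q; apply/lee_addgt0Pr => e e0; apply: ltW; rewrite -EFinD.
have ll : l < l + e by lra.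
apply/(g_lt _ Vx x0); first by apply: lt_trans ll.
exact: (s_neg_mono s_decr ml ll Vx x0 q).
Qed.

Lemma gsup_ge l k' L k : mu < l -> nidx l k' -> has_dim L k -> L `<=` V -> (k' < k)%N ->
  (l%:E <= gsup L)%E.
Proof.
move=> ml /(neg_index_space sV)[X [dX XV _ Xpos]] dL LV kk.
have [x [Lx x0 hx]] := orth_vector dL dX kk.
apply: le_trans (_ : (g x <= _)%E); first by apply: g_ge => //; [apply: LV | apply: Xpos; [apply: LV |]].
by apply: ereal_sup_ubound; exists x => //; split=> //; apply/eqP.
Qed.

Lemma gsup_le l L : (forall x, L x -> x != 0 -> (g x <= l)%E) -> (gsup L <= l)%E.
Proof.
by move=> h; apply: ge_ereal_sup => _ [x [Lx /eqP x0] <-]; apply: h.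
Qed.

Lemma ginf_ge l k' X L : mu < l -> has_dim X k' -> X `<=` L ->
  (forall x, V x -> (forall y, X y -> '[x, y] = 0) -> 0 <= quad (s l) x) -> (l%:E <= ginf L)%E.
Proof.
move=> ml dX XL Xpos; apply: le_ereal_inf_tmp => _ [x [[Vx hx] /eqP x0] <-].
by apply: g_ge => //; apply: Xpos => // y /XL; apply: hx.
Qed.

Lemma ginf_le l Z L k m : has_dim Z k -> has_dim L m -> (m < k)%N -> Z `<=` V ->
  (forall x, Z x -> x != 0 -> (g x <= l)%E) -> (ginf L <= l)%E.
Proof.
move=> dZ dL mk ZV hZ; have [x [Zx x0 hx]] := orth_vector dZ dL mk.
apply: le_trans (hZ x Zx x0); apply: ereal_inf_lbound; exists x => //; split; last exact/eqP.
by split=> //; apply: ZV.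
Qed.

Lemma large_neg L k : L `<=` V -> has_dim L k -> exists2 l, mu < l &
  forall x, L x -> x != 0 -> quad (s l) x < 0.
Proof.
move=> LV dL; have [|C hC] := quad_fin_bound ct0 _ dL; first by rewrite t0V.
pose l := Num.max (C + 1) (mu + 1); have ml : mu < l by rewrite lt_max; apply/orP; right; lra.
have Cl : C + 1 <= l by rewrite le_max lexx.
exists l => // x Lx x0; have := s_le x ml; have := hC x Lx; have := nsq_gt0 x0; nra.
Qed.

(** Since k > kappa, the supremum r is at least g0 > [mu], where g is governed by the forms. If r
    were not attained, s_r would be negative on L, uniformly by finite dimension, and would remain
    so slightly to the left, making the supremum smaller. *)
Lemma gsup_max g0 kappa L k : mu < g0 -> nidx g0 kappa -> L `<=` V -> has_dim L k ->
  (kappa < k)%N -> is_max [set g x | x in L `\ 0] (gsup L).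
Proof.
move=> mg0 hk LV dL kk; split; last by move=> y hy; apply: ereal_sup_ubound.
have lo := gsup_ge mg0 hk dL LV kk; have [l ml lneg] := large_neg LV dL.
have hi : (gsup L <= l%:E)%E.
  by apply: gsup_le => x Lx x0; apply: ltW; apply/(g_lt ml (LV _ Lx) x0); apply: lneg.
have fs : gsup L \is a fin_num.
  by apply: fin_real; rewrite (lt_le_trans (ltNyr _) lo) (le_lt_trans hi (ltry _)).
have [r rE] : exists r, gsup L = r%:E by exists (fine (gsup L)); rewrite fineK.
have mr : mu < r by move: lo; rewrite rE lee_fin; apply: lt_le_trans.
apply: contrapT => nS.
have neg x : L x -> x != 0 -> quad (s r) x < 0.
  move=> Lx x0; apply/(g_lt mr (LV _ Lx) x0); rewrite lt_neqAle -rE; apply/andP; split.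
    by apply/eqP => e; apply: nS; exists x => //; split=> //; apply/eqP.
  by apply: ereal_sup_ubound; exists x => //; split=> //; apply/eqP.
have [c cs] := s_cform mr; have st := cf_sesq cs; have sy := cf_sym cs.
have [|||x Lx x0|C C0 hC] := @uniform_pos _ _ (opp_form (s r)) L k _ _ _ dL.
- split=> [|d x y z Vx Vy Vz /=]; first exact: st.1.
  by have [-> ->] := st.2 d x y z Vx Vy Vz; rewrite !opprD !mulrN.
- by move=> x y Vx Vy /=; rewrite sy // rmorphN.
- by rewrite /= sV.
- by rewrite /quad /= raddfN oppr_gt0; apply: neg.
(* The first entry keeps r - d above [mu], the second keeps the loss from [s_up] within half of -
   s_r[x]. *)
pose d := Num.min ((r - mu) / 2) (C^-1 / 2).
have Ci : 0 < C^-1 by rewrite invr_gt0.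
have CC : C * C^-1 = 1 by rewrite divff ?gt_eqF.
have d0 : 0 < d by rewrite lt_min; apply/andP; split; lra.
have d1 : d <= (r - mu) / 2 by rewrite ge_min lexx.
have d2 : d <= C^-1 / 2 by rewrite ge_min lexx orbT.
have ml' : mu < r - d by lra.
have rr : r - d <= r by lra.
have : (gsup L <= (r - d)%:E)%E.
  apply: gsup_le => x Lx x0; apply: ltW; apply/(g_lt ml' (LV _ Lx) x0).
  have := s_up x ml' rr; have := hC x Lx; have := neg x Lx x0.
  rewrite /quad /= raddfN -/(quad (s r) x) => q1 q2 q3.
  have h3 : d * normsq x <= C^-1 / 2 * (C * - quad (s r) x).
    by apply: ler_pM => //; [exact: ltW | exact: nsq_ge0].
  have h4 : C^-1 / 2 * (C * - quad (s r) x) = - quad (s r) x / 2.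
    by rewrite -[RHS]mul1r -CC; ring.
  rewrite h4 in h3; lra.
by rewrite rE lee_fin; lra.
Qed.

Hypothesis ess_closed : forall l, mu < l -> ~ ess l -> finite_dim (form_ker (s l)) /\
  (forall (fn : nat -> H) f, (forall n, exists x, form_eq (s l) x (fn n)) -> cvs fn f ->
    exists x, form_eq (s l) x f).

Lemma minmax_eigen t k m K : mu < t -> nidx t k -> has_dim (form_ker (s t)) m ->
  (k < K)%N -> (K <= k + m)%N ->
  is_min [set gsup L | L in [set L | L `<=` V /\ has_dim L K]] t%:E /\
  is_max [set ginf L | L in [set L | L `<=` setT /\ has_dim L (K - 1)%N]] t%:E.
Proof.
move=> mt hk dm kK Km.
have [Z [dZ ZV Zneg [X XZ [dX Xpos]] _]] := neg_ker_space sV ess_closed mt hk dm.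
have [L LZ dL] := has_dim_shrink dZ Km.
have Lle x : L x -> x != 0 -> (g x <= t%:E)%E.
  by move=> /LZ Zx x0; apply: g_le => //; [apply: ZV | apply: Zneg].
have LV x : L x -> V x by move=> /LZ /ZV.
have lo L' : L' `<=` V -> has_dim L' K -> (t%:E <= gsup L')%E.
  by move=> L'V dL'; apply: gsup_ge hk dL' L'V kK.
have up L' : has_dim L' (K - 1)%N -> (ginf L' <= t%:E)%E.
  move=> dL'; apply: ginf_le dL dL' _ LV Lle; rewrite subn1 prednK //; exact: leq_trans kK.
(* X is enlarged by vectors of Z, which suffice because K - 1 < dim Z. *)
have [|M j dM jK|L' dL' XL'] := @has_dim_above _ _ X Z k (K - 1)%N dX.
- by rewrite subn1 -ltnS prednK //; apply: leq_trans kK.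
- apply: contrapT => h; have ZM : Z `<=` M.
    by move=> x Zx; apply: contrapT => nM; apply: h; exists x.
  have := has_dim_le dZ dM ZM; rewrite leqNgt; case/negP; apply: leq_trans jK _.
  by rewrite subn1; apply: leq_trans (leq_pred _) Km.
split; split.
- by exists L => //; apply/eqP; rewrite eq_le gsup_le //= lo.
- by move=> _ [L1 [L1V dL1] <-]; apply: lo.
- by exists L' => //; apply/eqP; rewrite eq_le up //=; apply: ginf_ge dX XL' Xpos.
- by move=> _ [L1 [_ dL1] <-]; apply: up.
Qed.

Hypothesis V_dense : dense V.
Hypothesis V_sub : lin_subspace V.
Hypothesis H_inf : ~ finite_dim [set: H].

(** A finite-dimensional dense subspace is the whole space, by projecting onto it. *)
Lemma V_infinite k : exists2 L, L `<=` V & has_dim L k.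
Proof.
have [[j _ dj]|[L LV dL]] := dim_dichotomy k V_sub; last by exists L.
case: H_inf; exists j; rewrite (_ : [set: H] = V) //; apply/seteqP; split=> // x _.
have [p Vp hp] := fin_proj x dj.
suff /subr0_eq -> : x - p = 0 by [].
by apply: (dense_ip_eq V_dense) => z Vz; rewrite ip0l hp.
Qed.

(** An index below K on the left of r and no finite index on its right squeeze both expressions to
    r; neither extremum need be attained. *)
Lemma minmax_ess r j K : mu < r -> (forall l, mu < l -> l < r -> exists2 k, (k <= j)%N & nidx l k) ->
  (forall l k, r < l -> ~ nidx l k) -> (j < K)%N ->
  r%:E = ereal_inf [set gsup L | L in [set L | L `<=` V /\ has_dim L K]] /\
  r%:E = ereal_sup [set ginf L | L in [set L | L `<=` setT /\ has_dim L (K - 1)%N]].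
Proof.
move=> mr below above jK.
have near_below (y : \bar R) : (forall l, mu < l -> l < r -> (l%:E <= y)%E) -> (r%:E <= y)%E.
  move=> h; apply/lee_subgt0Pr => e e0; rewrite -EFinB.
  (* The maximum with the midpoint of [mu] and r keeps l in the range of the hypotheses. *)
  have [l [ml lr el]] : exists l, [/\ mu < l, l < r & r - e <= l].
    exists (Num.max (r - e) ((mu + r) / 2)); split; last by rewrite le_max lexx.
      by rewrite lt_max; apply/orP; right; lra.
    by rewrite gt_max; apply/andP; split; lra.
  by apply: le_trans (h l ml lr); rewrite lee_fin.
(* Without a finite index the negative spectral subspace contains subspaces of every dimension. *)
have big l : r < l -> exists L, [/\ L `<=` V, has_dim L K & forall x, L x -> x != 0 -> (g x <= l%:E)%E].
  move=> rl; have ml := lt_trans mr rl; have [c cs] := s_cform ml; have [F hF] := level_exists cs 0.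
  have sF : lin_subspace [set x | F x = x].
    split=> [|d x y Fx Fy] /=; first exact: rlin0 (op_lin (lv_proj hF)).
    by rewrite (lvE cs hF) Fx Fy.
  have [[i _ di]|[L LF dL]] := dim_dichotomy K sF; first by case: (above l i rl); exists c, F.
  have LV x : L x -> V x by move=> /LF Fx; rewrite -(sV l) -Fx; apply: (lvV cs hF).
  exists L; split=> // x Lx x0; apply: g_le => //; first exact: LV.
  by have := lv_lt hF (LF _ Lx) x0; rewrite mul0r => /ltW.
have re (e : R) : 0 < e -> r < r + e by move=> e0; lra.
split; apply/eqP; rewrite eq_le; apply/andP; split.
- apply: le_ereal_inf_tmp => _ [L [LV dL] <-]; apply: near_below => l ml lr.
  by have [k kj hk] := below l ml lr; apply: gsup_ge hk dL LV (leq_ltn_trans kj jK).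
- apply/lee_addgt0Pr => e /re /big[L [LV dL hL]]; rewrite -EFinD.
  by apply: le_trans (gsup_le hL); apply: ereal_inf_lbound; exists L.
- apply: near_below => l ml lr; have [k kj hk] := below l ml lr.
  have [X [dX _ _ Xpos]] := neg_index_space sV hk.
  have [|M i dM _|L dL XL] := @has_dim_above _ _ X setT k (K - 1)%N dX.
  + by rewrite subn1 -ltnS prednK; apply: leq_ltn_trans jK.
  + apply: contrapT => h; case: H_inf; exists i; rewrite (_ : setT = M) //; apply/seteqP; split=> // x _.
    by apply: contrapT => nM; apply: h; exists x.
  by apply: le_trans (ginf_ge ml dX XL Xpos) _; apply: ereal_sup_ubound; exists L.
- apply: ge_ereal_sup => _ [L [_ dL] <-]; apply/lee_addgt0Pr => e /re /big[Z [ZV dZ hZ]].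
  rewrite -EFinD; apply: ginf_le dZ dL _ ZV hZ.
  by rewrite subn1 prednK //; apply: leq_ltn_trans jK.
Qed.

End MinMax.

Lemma form_of_cform (R : realType) (H : hilbertType R) (T : op H H) (t : sform R H) :
  is_form_of T t -> exists c, cform t c.
Proof.
move=> [[st yt [c lt] ct] [dt _ _]]; exists (1 - c); split=> // x Vx.
by have := lt x Vx; lra.
Qed.

Lemma kappa_neg_index (R : realType) (H : hilbertType R) (s : R -> sform R H) l c k :
  cform (s l) c -> kappa_minus (op_of_form (s l)) k <-> neg_index s l k.
Proof.
move=> cs; rewrite /kappa_minus; split=> [|[c' [F [cs' hF dF]]]].
  have [F hF] := level_exists cs 0; rewrite (spectral_subspace_level cs hF) => dF.
  by exists c, F.
by rewrite (spectral_subspace_level cs' hF).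
Qed.

Unset Implicit Arguments.

Theorem theorem5p12 (R : realType) (H1 H2 : hilbertType R)
  (H1_neq0 : exists x : H1, x != 0) (H2_neq0 : exists y : H2, y != 0)
  (A : op H1 H1) (B : op H2 H1) (D : op H2 H2)
  (fa : sform R H1) (fd : sform R H2)
  (A_sa : selfadjoint A) (A_below : bounded_below A)
  (B_lin : linear_op B) (B_dense : densely_defined B) (B_closable : closable B)
  (D_sa : selfadjoint D) (D_above : bounded_above D)
  (fa_form : is_form_of A fa)
  (fd_form : is_form_of (opp_op D) (opp_form fd))
  (fa_sub : fdom fa `<=` dom (adjoint B))
  (cases : (dom B `<=` dom D /\ is_core D (dom B)) \/ fdom fd `<=` dom B)
  (a b : R) (b_ge0 : 0 <= b)
  (ab_bound : forall x, fdom fa x ->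
     normsq (adjoint B x) <= a * normsq x + b * quad fa x)
  (dplus : R)
  (dplus_max : [set t : R | spectrum D t%:C] dplus /\
               ubound [set t : R | spectrum D t%:C] dplus) :
  let M := closure_op (block_op A B D) in
  let mu := dplus + b + Num.sqrt (Num.max (b * dplus + b ^+ 2 + a) 0) in
  let S := schur B D fa in
  let lambda_e : \bar R :=
    ereal_inf [set t%:E | t in [set t : R | ess_spectrum M t%:C /\ mu < t]] in
  let subspaces (V : set H1) (k : nat) : set (set H1) :=
    [set L | L `<=` V /\ has_dim L k] in
  let vals := lambda_values B fa fd in
  let sup_on := sup_on B fa fd in
  let inf_perp := inf_perp B fa fd in
  (exists2 gamma : R, mu < gamma & exists k, kappa_minus (S gamma) k) ->
  (mu%:E < lambda_e)%E /\
  forall gamma0 : R, mu < gamma0 -> (gamma0%:E < lambda_e)%E ->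
  exists2 kappa : nat, kappa_minus (S gamma0) kappa &
  forall (N : option nat) (lam : nat -> R),
  eigenvalue_sequence M gamma0 lambda_e N lam ->
  (forall n, in_range N n ->
    [/\ forall L, subspaces (fdom fa) (kappa + n)%N L ->
          is_max (vals L) (sup_on L),
        is_min [set sup_on L | L in subspaces (fdom fa) (kappa + n)%N]
          (lam n)%:E &
        is_max [set inf_perp L | L in subspaces setT (kappa + n - 1)%N]
          (lam n)%:E]) /\
  (forall N0, N = Some N0 -> ~ finite_dim [set: H1] ->
    (lambda_e < +oo)%E /\
    forall n, (N0 < n)%N ->
    [/\ forall L, subspaces (fdom fa) (kappa + n)%N L ->
          is_max (vals L) (sup_on L),
        lambda_e =
          ereal_inf [set sup_on L | L in subspaces (fdom fa) (kappa + n)%N] &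
        lambda_e =
          ereal_sup [set inf_perp L | L in subspaces setT (kappa + n - 1)%N]]).
Proof.
move=> M mu S lambda_e subspaces vals sup_on inf_perp [gamma mg [kg hkg]].
have [ca cfa] := form_of_cform fa_form; have [cd cfd] := form_of_cform fd_form.
have faA : graph_op (op_of_form fa) = graph_op A by case: fa_form => _ [].
have fdD : graph_op (op_of_form (opp_form fd)) = graph_op (opp_op D) by case: fd_form => _ [].
have D_spec r : dplus < r -> resolvent_set D r%:C.
  move=> dr; apply: contrapT => h; have := dplus_max.2 r h; by rewrite leNgt dr.
pose s := schur_form B D fa; pose V := fdom fa.
pose ess : set R := [set t | ess_spectrum M t%:C].
pose g := inf_lambda_plus B fa fd.
have mud l : mu < l -> dplus < l := @mu_dplus _ _ _ _ b_ge0 l.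
have mudb l : mu < l -> dplus + b < l.
  by move=> /mu_dist[].
have sV l : fdom (s l) = V by [].
have s_cform l : mu < l -> exists c, cform (s l) c.
  exact: mu_cform B_dense cfa cfd fdD D_spec fa_sub b_ge0 ab_bound l.
have s_up l l' x : mu < l -> l <= l' ->
    quad (s l) x <= quad (s l') x + (l' - l) * normsq x.
  by move=> /mud; apply: schur_up cfd fdD D_spec _ _ _.
have s_decr l : mu < l -> exists2 e, 0 < e & exists2 k, 0 < k &
    forall x l', V x -> quad (s l) x <= e * normsq x -> l <= l' ->
      quad (s l') x <= quad (s l) x - k * (l' - l) * normsq x.
  exact: schur_decr cfd fdD D_spec b_ge0 ab_bound l.
have s_le l x : mu < l -> quad (s l) x <= quad fa x - l * normsq x.
  by move=> /mud; apply: schur_le cfd fdD D_spec _ _.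
have g_lt l x : mu < l -> V x -> x != 0 -> (g x < l%:E)%E <-> quad (s l) x < 0.
  by move=> ml Vx x0; apply: inf_lambda_lt cfd fdD D_spec b_ge0 ab_bound _ _ ml Vx x0 H2_neq0.
have ess_closed l : mu < l -> ~ ess l -> finite_dim (form_ker (s l)) /\
  (forall (fn : nat -> H1) f, (forall n, exists x, form_eq (s l) x (fn n)) -> cvs fn f ->
    exists x, form_eq (s l) x f).
  move=> ml /contrapT fM.
  have [fk rc] := fredholm_schur B_dense cfa faA cfd fdD D_spec fa_sub cases b_ge0 ab_bound (mud _ ml) fM.
  split=> // fn f hfn hf; have [|x Vx hx] := rc fn f _ hf; last by exists x.
  by move=> n; have [x [Vx hx]] := hfn n; exists x.
have ess_open l c : mu < l -> cform (s l) c ->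
    (forall f, (forall x, form_ker (s l) x -> rip f x = 0) -> exists x, form_eq (s l) x f) ->
    finite_dim (form_ker (s l)) -> ~ ess l.
  move=> ml cs hs fk; apply; move: fk.
  apply: (schur_fredholm B_dense cfa faA cfd fdD D_spec fa_sub cases b_ge0 ab_bound (mud _ ml) cs (mudb _ ml)).
  by move=> f hf; have [x [Vx hx]] := hs f hf; exists x.
have kn l k : mu < l -> kappa_minus (S l) k <-> neg_index s l k.
  by move=> ml; have [c cs] := s_cform l ml; apply: kappa_neg_index cs.
have gk : neg_index s gamma kg by apply/kn.
have ge := lam_e_ge sV s_cform s_decr ess_open mg gk.
split; first by apply: lt_le_trans ge; rewrite lte_fin.
move=> gamma0 mg0 g0e.
have fin := neg_index_fin sV s_cform s_up s_decr ess_closed ess_open mg gk.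
have [kappa hk] := fin gamma0 mg0 g0e; exists kappa; first by apply/kn.
move=> N lam [lam_ge lam_mono lam_mult].
have lam_ker t : gamma0 <= t -> (t%:E < lambda_e)%E ->
    exists2 k, has_dim (form_ker (s t)) k & [set n | in_range N n /\ lam n = t] #= `I_k.
  move=> gt te; have [k dk ck] := lam_mult t gt te; exists k => //.
  have mt : mu < t by apply: lt_le_trans gt.
  by move: dk; apply: (ker_dim B_dense cfa faA cfd fdD D_spec fa_sub cases b_ge0 ab_bound (mud _ mt) k).1.
have count := count_eigenvalues sV s_cform s_up s_decr ess_closed mg0 hk lam_ge lam_mono lam_ker.
have is_max_n n : (0 < n)%N -> forall L, subspaces V (kappa + n)%N L -> is_max (vals L) (sup_on L).
  move=> n0 L [LV dL].
  apply: (gsup_max sV s_cform s_up cfa erefl s_le g_lt mg0 hk LV dL).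
  by rewrite -[ltnLHS]addn0 ltn_add2l.
split=> [n rn|N0 NE Hinf].
  have [gn en] := lam_ge n rn; have n0 : (0 < n)%N by case: rn.
  have mt : mu < lam n by apply: lt_le_trans gn.
  have [j hj ij] := count (lam n) gn en; have [m dm _] := lam_ker (lam n) gn en.
  have nE : n = n.-1.+1 by rewrite prednK.
  (* j counts the eigenvalues strictly below [lam n], so it cannot reach position n. *)
  have jn : (j < n)%N.
    rewrite nE ltnS leqNgt; apply/negP => /(ij n.-1).2[_]; by rewrite -nE ltxx.
  (* Just to the right of [lam n] the count is j + m, and it includes position n. The auxiliary y
     must stay below [lambda_e], which may be infinite. *)
  have nm : (n <= j + m)%N.
    have ne := below_ess mt en.
    have [e e0 he] := neg_index_right sV s_cform s_up s_decr ess_closed mt ne hj dm.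
    have [y [ty ye yl]] : exists y, [/\ lam n < y, y < lam n + e & (y%:E < lambda_e)%E].
      move: en; case: (lambda_e) => [r| |] //.
        rewrite lte_fin => tr; exists (Num.min (lam n + e / 2) ((lam n + r) / 2)).
        rewrite lte_fin lt_min !gt_min; split; first by apply/andP; split; lra.
          by apply/orP; left; lra.
        by apply/orP; right; lra.
      by move=> _; exists (lam n + e / 2); split; [lra | lra | rewrite ltry].
    have gy : gamma0 <= y by lra.
    have [j' hj' ij'] := count y gy yl.
    have my : mu < y by apply: lt_le_trans gy.
    have := neg_index_uniq sV s_decr my hj' (he y ty ye); rewrite -addnA => /addnI <-.
    by rewrite nE; apply/ij'; rewrite -nE.
  have kj : (kappa + j < kappa + n)%N by rewrite ltn_add2l.
  have kn' : (kappa + n <= kappa + j + m)%N by rewrite -addnA leq_add2l.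
  have [hmin hmax] := minmax_eigen sV s_decr g_lt ess_closed mt hj dm kj kn'.
  by split=> //; apply: is_max_n.
(* Only N0 eigenvalues exist, which bounds the index uniformly up to [lambda_e]. *)
have jN l : gamma0 <= l -> (l%:E < lambda_e)%E -> exists2 j, (j <= N0)%N & neg_index s l (kappa + j).
  move=> gl le; have [j hj ij] := count l gl le; exists j => //.
  by rewrite leqNgt; apply/negP => /(ij N0).2[[_]]; rewrite NE ltnn.
have below l : mu < l -> (l%:E < lambda_e)%E -> exists2 k, (k <= kappa + N0)%N & neg_index s l k.
  move=> ml le; have [k hl] := fin l ml le; exists k => //.
  have [||j jN0 hj] := jN (Num.max l gamma0).
  - by rewrite le_max lexx orbT.
  - by rewrite EFin_max gt_max le g0e.
  apply: leq_trans (neg_index_mono sV s_decr ml _ hl hj) _; first by rewrite le_max lexx.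
  by rewrite leq_add2l.
(* Otherwise the index stays at most kappa + N0 for all l, whereas for large l the form s_l is
   negative on any given subspace of dom a of dimension kappa + N0 + 1. *)
have efin : (lambda_e < +oo)%E.
  rewrite ltNge; apply/negP; rewrite leye_eq => /eqP eoo.
  have [L LV dL] := V_infinite (cf_dense cfa) (cf_sesq cfa).1 Hinf (kappa + N0).+1.
  have [l ml lneg] := large_neg cfa erefl s_le LV dL.
  have [|k kN hl] := below l ml; first by rewrite eoo ltry.
  by have := neg_index_le sV hl dL LV lneg; rewrite leqNgt ltnS kN.
split=> // n nN.
have [r rE] : exists r, lambda_e = r%:E.
  move: efin g0e; case: (lambda_e) => [r| |] //; by exists r.
have mr : mu < r by apply: lt_trans mg0 _; rewrite -lte_fin -rE.
have kK : (kappa + N0 < kappa + n)%N by rewrite ltn_add2l.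
have [|l k rl|e1 e2] := minmax_ess sV s_cform s_decr g_lt Hinf mr _ _ kK.
- by move=> l ml lr; apply: below; rewrite // rE lte_fin.
- apply: (above_ess sV s_cform s_decr ess_open (lt_trans mr rl)).
  by rewrite -/lambda_e rE lte_fin.
by rewrite rE; split=> //; apply: is_max_n; apply: leq_ltn_trans nN.
Qed.
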